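(* Let $d=2$, $k\ge1$ odd, $V_h=V_h^k$, $V_{0h}=V_{0h}^k$, and $$W_h=V^{k+1}_{h,\mathcal T}\oplus V^k_{h,\mathcal F_I}\oplus V^k_{nc,\mathcal F_I},\qquad V_{1h}=V^{k+1}_{h,\mathcal T}\oplus V^k_{h,\mathcal F_I}\oplus V^k_{h,\mathcal F_{\Gamma_0}}\oplus V^k_{nc,\mathcal F_I}\oplus V^k_{nc,\mathcal F_{\Gamma_0}}.$$ Then there exist $\gamma\in(0,1)$ and $C>0$ independent of $h$ and $\epsilon>0$ such that for all $(u_h,\lambda_h)\in V_h\times W_h$, $\sup_{(v_h,w_h)\in V_h\times W_h}A_{uc}[(u_h,\lambda_h),(v_h,w_h)]/|||(v_h,w_h)|||_{uc}\ge C|||(u_h,\lambda_h)|||_{uc}$, and for all $(u_h,\lambda_h)\in V_{0h}\times V_{1h}$, $\sup_{(v_h,w_h)\in V_{0h}\times V_{1h}}A_{cp}[(u_h,\lambda_h),(v_h,w_h)]/|||(v_h,w_h)|||_{cp}\ge C|||(u_h,\lambda_h)|||_{cp}$.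
   Context: $\Omega\subset\mathbb R^2$ bounded polygonal, $\{\mathcal T_h\}$ shape-regular, quasi-uniform conforming triangulations, $h=\max_K\operatorname{diam}K$; $\mathcal T$ the set of triangles, $\mathcal F$ the edges, $\mathcal F_I$ interior edges. $\omega\subset\Omega$ nonempty open with $\operatorname{dist}(\omega,\partial\Omega)>0$. $\Gamma_0$ open part of $\partial\Omega$, $\Gamma_1=\partial\Omega\setminus\Gamma_0$, $\mathcal F_{\Gamma_0}$ boundary edges in $\Gamma_0$, no edge in both $\Gamma_0,\Gamma_1$. $V_h^k$: continuous piecewise polynomials of degree $\le k$; $V^k_{0h}=\{v\in V_h^k:v|_{\Gamma_0}=0\}$. Lagrange basis $\{B^n_N\}$ of $V^n_h$ with equidistant barycentric nodes $\mathcal N^n$; for a set $\mathcal X$ of triangles or edges, $V^n_{h,\mathcal X}=\operatorname{span}\{B^n_N:N\in\mathcal N^n\cap X^o,X\in\mathcal X\}$ ($X^o$ relative interior). Edge bubbles: $B^{CR}_{k,F}=P_k(1-2\lambda_{K,z_{K,F}})$ on each triangle $K$ having $F$ as an edge, $0$ elsewhere ($P_k$ Legendre polynomial with $P_k(1)=1$, $z_{K,F}$ vertex opposite $F$, $\lambda_{K,z}$ barycentric coordinate); $V^k_{nc,\mathcal X}=\operatorname{span}\{B^{CR}_{k,F}:F\in\mathcal X\}$. $(\cdot,\cdot)_U,\|\cdot\|_U$: $L^2(U)$; $\langle u,v\rangle_\Omega=(u,v)_\Omega+(\nabla u,\nabla v)_\Omega$; $a_h(x,y)=\sum_K(\nabla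 x,\nabla y)_K$; $\langle x,y\rangle_{\mathcal T_h}=\sum_K[(x,y)_K+(\nabla x,\nabla y)_K]$, $\|x\|^2_{H^1(\mathcal T_h)}=\langle x,x\rangle_{\mathcal T_h}$; $\Delta_h$ elementwise Laplacian; $[\![\nabla x\cdot n]\!]=\nabla x|_{K_1}\cdot n_{K_1}+\nabla x|_{K_2}\cdot n_{K_2}$; $\mathcal J_h(x,y)=\sum_{F\in\mathcal F_I}\int_Fh[\![\nabla x\cdot n]\!][\![\nabla y\cdot n]\!]dS$. $A_{uc}[(u,\lambda),(v,w)]=\epsilon\langle u,v\rangle_\Omega+a_h(\lambda,v)+(u,v)_\omega+a_h(u,w)-\gamma^2\langle\lambda,w\rangle_{\mathcal T_h}$; $A_{cp}$ is the same without $(u,v)_\omega$; $|||(v,w)|||^2_{uc}=\epsilon\|v\|^2_{H^1(\Omega)}+\|v\|^2_\omega+\mathcal J_h(v,v)+\|h\Delta_hv\|^2_\Omega+\|\gamma w\|^2_{H^1(\mathcal T_h)}$; $|||(v,w)|||^2_{cp}=\epsilon\|v\|^2_{H^1(\Omega)}+\mathcal J_h(v,v)+h\|\nabla v\cdot\nu\|^2_{\Gamma_0}+\|h\Delta_hv\|^2_\Omega+\|\gamma w\|^2_{H^1(\mathcal T_h)}$. *)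

(* Defs.v *)
From HB Require Import structures.
From mathcomp Require Import all_boot all_order all_algebra.
From mathcomp Require Import all_classical all_reals all_analysis.
Import Order.TTheory GRing.Theory Num.Theory.
Set Implicit Arguments.
Unset Strict Implicit.
Unset Printing Implicit Defensive.
Local Open Scope ring_scope.
Local Open Scope classical_set_scope.

Section FEM.
Variable R : realType.

Definition pt := (R * R)%type.
Definition pdot (x y : pt) : R := x.1 * y.1 + x.2 * y.2.
Definition psub (x y : pt) : pt := (x.1 - y.1, x.2 - y.2).
Definition pnorm (x : pt) : R := Num.sqrt (pdot x x).
Definition pdist (x y : pt) : R := pnorm (psub x y).
Definition pcross (x y : pt) : R := x.1 * y.2 - x.2 * y.1.

Definition eopen (A : set pt) : Prop :=
  forall x, A x -> exists2 r : R, 0 < r & forall y, pdist x y < r -> A y.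
Definition einterior (A : set pt) : set pt :=
  [set x | exists2 r : R, 0 < r & forall y, pdist x y < r -> A y].
Definition eclosure (A : set pt) : set pt :=
  [set x | forall r : R, 0 < r -> exists y, A y /\ pdist x y < r].
Definition eboundary (A : set pt) : set pt := eclosure A `\` einterior A.

Definition tri := {ffun 'I_3 -> pt}.
Definition nx (i : 'I_3) : 'I_3 := inord ((i + 1) %% 3).
Definition nx2 (i : 'I_3) : 'I_3 := inord ((i + 2) %% 3).

Definition bary_comb (K : tri) (l : 'I_3 -> R) : pt :=
  (\sum_(i < 3) l i * (K i).1, \sum_(i < 3) l i * (K i).2).
Definition closedTri (K : tri) : set pt :=
  [set x | exists l : 'I_3 -> R,
     [/\ forall i, 0 <= l i, \sum_(i < 3) l i = 1 & x = bary_comb K l]].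
Definition openTri (K : tri) : set pt :=
  [set x | exists l : 'I_3 -> R,
     [/\ forall i, 0 < l i, \sum_(i < 3) l i = 1 & x = bary_comb K l]].
Definition nondeg (K : tri) : Prop := pcross (psub (K 1%R) (K 0%R)) (psub (K 2%R) (K 0%R)) != 0.

Definition edge := (pt * pt)%type.
Definition seg_pt (F : edge) (t : R) : pt :=
  (F.1.1 + t * (F.2.1 - F.1.1), F.1.2 + t * (F.2.2 - F.1.2)).
Definition closedSeg (F : edge) : set pt := [set x | exists2 t, 0 <= t <= 1 & x = seg_pt F t].
Definition openSeg (F : edge) : set pt := [set x | exists2 t, 0 < t < 1 & x = seg_pt F t].

(* canonical (lexicographically ordered) representative of the unordered edge {a,b} *)
Definition lexle (a b : pt) : bool := (a.1 < b.1) || ((a.1 == b.1) && (a.2 <= b.2)).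
Definition mkedge (a b : pt) : edge := if lexle a b then (a, b) else (b, a).
Definition tedge (K : tri) (i : 'I_3) : edge := mkedge (K (nx i)) (K (nx2 i)).

Definition diamT (K : tri) : R :=
  Num.max (pdist (K 0%R) (K 1%R)) (Num.max (pdist (K 1%R) (K 2%R)) (pdist (K 2%R) (K 0%R))).
Definition areaT (K : tri) : R := `|pcross (psub (K 1%R) (K 0%R)) (psub (K 2%R) (K 0%R))| / 2.
Definition perimT (K : tri) : R :=
  pdist (K 0%R) (K 1%R) + pdist (K 1%R) (K 2%R) + pdist (K 2%R) (K 0%R).
Definition inradius (K : tri) : R := 2 * areaT K / perimT K.

Definition mesh := seq tri.
Definition meshsize (T : mesh) : R := \big[Num.max/0]_(K <- T) diamT K.

Definition conforming (Om : set pt) (T : mesh) : Prop :=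
  [/\ (T != [::]) && uniq T,
      (forall K, K \in T -> nondeg K),
      eclosure Om = \bigcup_(K in [set K | K \in T]) closedTri K,
      Om = einterior (\bigcup_(K in [set K | K \in T]) closedTri K) &
      forall K1 K2, K1 \in T -> K2 \in T -> K1 != K2 ->
        let S := closedTri K1 `&` closedTri K2 in
        [\/ S = set0,
            (exists i j, K1 i = K2 j /\ S = [set K1 i]) |
            (exists i i' j j', [/\ i != i', K1 i = K2 j, K1 i' = K2 j' &
                                  S = closedSeg (K1 i, K1 i')])]].

Definition edgesT (T : mesh) : seq edge :=
  undup [seq tedge K i | K <- T, i <- enum 'I_3].
Definition edgesI (Om : set pt) (T : mesh) : seq edge :=
  [seq F <- edgesT T | `[< openSeg F `<=` Om >]].
Definition edgesG0 (Om G0 : set pt) (T : mesh) : seq edge :=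
  [seq F <- edgesT T | `[< ~ (openSeg F `<=` Om) /\ openSeg F `<=` G0 >]].

(* p : {poly {poly R}} ; outer variable = y, inner variable = x *)
Definition P2 := {poly {poly R}}.
Definition ev (p : P2) (x : pt) : R := (p.[x.2%:P]).[x.1].
Definition deg2le (n : nat) (p : P2) : Prop := forall i j, ((p`_i)`_j != 0) -> (i + j <= n)%N.
Definition dX (p : P2) : P2 := map_poly (@deriv R) p.
Definition dY (p : P2) : P2 := deriv p.
Definition grad (p : P2) (x : pt) : pt := (ev (dX p) x, ev (dY p) x).
Definition lapP (p : P2) : P2 := dX (dX p) + dY (dY p).
Definition cst2 (c : R) : P2 := c%:P%:P.
Definition affP (a b c : R) : P2 := ((a%:P + b%:P * 'X)%:P + (c%:P)%:P * 'X).
Definition comp2 (P : {poly R}) (q : P2) : P2 := \sum_(i < size P) cst2 P`_i * q ^+ i.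

(* Legendre polynomials, normalised by P_k(1) = 1 (Bonnet recurrence) *)
Fixpoint leg2 (n : nat) : {poly R} * {poly R} :=
  match n with
  | 0%N => (1, 'X)
  | n'.+1 => let pq := leg2 n' in
      (pq.2, (n'.+2%:R)^-1 *: ((2 * n' + 3)%:R *: ('X * pq.2) - (n'.+1)%:R *: pq.1))
  end.
Definition legendre (n : nat) : {poly R} := (leg2 n).1.

Definition baryP (K : tri) (i : 'I_3) : P2 :=
  let q := K (nx i) in let r := K (nx2 i) in let w := psub q r in
  let D := pcross (psub q (K i)) (psub r (K i)) in
  affP (pcross q r / D) (w.2 / D) (- w.1 / D).

Definition nK (K : tri) (i : 'I_3) : pt :=
  let e := psub (K (nx2 i)) (K (nx i)) in
  let n0 := (e.2 / pnorm e, - e.1 / pnorm e) in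
  if pdot n0 (psub (K i) (K (nx i))) < 0 then n0 else (- n0.1, - n0.2).

Definition bfun := tri -> P2.

Definition inVh (n : nat) (T : mesh) (v : bfun) : Prop :=
  (forall K, K \in T -> deg2le n (v K)) /\
  (forall K1 K2, K1 \in T -> K2 \in T -> forall x,
      closedTri K1 x -> closedTri K2 x -> ev (v K1) x = ev (v K2) x).
Definition inV0h (n : nat) (T : mesh) (G0 : set pt) (v : bfun) : Prop :=
  inVh n T v /\ (forall K, K \in T -> forall x, G0 x -> closedTri K x -> ev (v K) x = 0).

Definition isNode (n : nat) (T : mesh) (N : pt) : Prop :=
  exists2 K, K \in T & exists a : 'I_3 -> nat,
    (\sum_(i < 3) a i)%N = n /\ N = bary_comb K (fun i => (a i)%:R / n%:R).
Definition lagrangeB (n : nat) (T : mesh) (N : pt) (b : bfun) : Prop :=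
  inVh n T b /\ forall N', isNode n T N' -> forall K, K \in T -> closedTri K N' ->
     ev (b K) N' = (if N' == N then 1 else 0).

Definition inSpanLag (n : nat) (T : mesh) (P : pt -> Prop) (v : bfun) : Prop :=
  exists (s : seq pt) (c : pt -> R) (b : pt -> bfun),
    (forall N, N \in s -> [/\ isNode n T N, P N & lagrangeB n T N (b N)]) /\
    (forall K, K \in T -> v K = \sum_(N <- s) cst2 (c N) * b N K).

Definition inTriInt (T : mesh) (N : pt) : Prop := exists2 K, K \in T & openTri K N.
Definition inEdgesInt (Fs : seq edge) (N : pt) : Prop := exists2 F, F \in Fs & openSeg F N.

(* Crouzeix-Raviart type edge bubble B^CR_{k,F} *)
Definition bubble (k : nat) (F : edge) : bfun := fun K =>
  \sum_(i < 3 | tedge K i == F) comp2 (legendre k) (1 - cst2 2 * baryP K i).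
Definition inSpanNC (k : nat) (T : mesh) (Fs : seq edge) (v : bfun) : Prop :=
  exists (s : seq edge) (c : edge -> R),
    {subset s <= Fs} /\ (forall K, K \in T -> v K = \sum_(F <- s) cst2 (c F) * bubble k F K).

Definition inSum3 (T : mesh) (A B C : bfun -> Prop) (v : bfun) : Prop :=
  exists a b c, [/\ A a, B b, C c & forall K, K \in T -> v K = a K + b K + c K].
Definition inSum5 (T : mesh) (A B C D E : bfun -> Prop) (v : bfun) : Prop :=
  exists a b c d e, [/\ A a /\ B b, C c, D d, E e &
     forall K, K \in T -> v K = a K + b K + c K + d K + e K].

Definition inWh (k : nat) (Om : set pt) (T : mesh) : bfun -> Prop :=
  inSum3 T (inSpanLag k.+1 T (inTriInt T))
           (inSpanLag k T (inEdgesInt (edgesI Om T)))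
           (inSpanNC k T (edgesI Om T)).
Definition inV1h (k : nat) (Om G0 : set pt) (T : mesh) : bfun -> Prop :=
  inSum5 T (inSpanLag k.+1 T (inTriInt T))
           (inSpanLag k T (inEdgesInt (edgesI Om T)))
           (inSpanLag k T (inEdgesInt (edgesG0 Om G0 T)))
           (inSpanNC k T (edgesI Om T))
           (inSpanNC k T (edgesG0 Om G0 T)).

Definition mu2 := ((@lebesgue_measure R) \x (@lebesgue_measure R))%E.
Definition intK (D : set pt) (f : pt -> R) : R := Rintegral mu2 D f.
Definition intF (F : edge) (g : pt -> R) : R :=
  pdist F.1 F.2 * Rintegral (@lebesgue_measure R) `[0, 1] (fun t => g (seg_pt F t)).

Definition L2T (T : mesh) (x y : bfun) : R :=
  \sum_(K <- T) intK (closedTri K) (fun p => ev (x K) p * ev (y K) p).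
Definition ah (T : mesh) (x y : bfun) : R :=
  \sum_(K <- T) intK (closedTri K) (fun p => pdot (grad (x K) p) (grad (y K) p)).
Definition L2om (om : set pt) (T : mesh) (x y : bfun) : R :=
  \sum_(K <- T) intK (closedTri K `&` om) (fun p => ev (x K) p * ev (y K) p).
(* <x, y>_{T_h} ( = <x, y>_Omega for conforming x, y ) *)
Definition H1T (T : mesh) (x y : bfun) : R := L2T T x y + ah T x y.
(* sum over the triangles having F as an edge of grad x|_K . n_K ; on an
   interior edge this is the jump [[grad x . n]], on a boundary edge grad x . nu *)
Definition flux (T : mesh) (x : bfun) (F : edge) (p : pt) : R :=
  \sum_(K <- T) \sum_(i < 3 | tedge K i == F) pdot (grad (x K) p) (nK K i).
Definition Jh (Om : set pt) (T : mesh) (x y : bfun) : R :=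
  \sum_(F <- edgesI Om T) intF F (fun p => meshsize T * flux T x F p * flux T y F p).
Definition bdryG0 (Om G0 : set pt) (T : mesh) (x : bfun) : R :=
  \sum_(F <- edgesG0 Om G0 T) intF F (fun p => flux T x F p ^+ 2).
Definition lapNorm (T : mesh) (x : bfun) : R :=
  \sum_(K <- T) intK (closedTri K) (fun p => (meshsize T * ev (lapP (x K)) p) ^+ 2).

Definition Auc (Om om : set pt) (T : mesh) (eps gam : R) (u lam v w : bfun) : R :=
  eps * H1T T u v + ah T lam v + L2om om T u v + ah T u w - gam ^+ 2 * H1T T lam w.
Definition Acp (T : mesh) (eps gam : R) (u lam v w : bfun) : R :=
  eps * H1T T u v + ah T lam v + ah T u w - gam ^+ 2 * H1T T lam w.
Definition Nuc (Om om : set pt) (T : mesh) (eps gam : R) (v w : bfun) : R :=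
  Num.sqrt (eps * H1T T v v + L2om om T v v + Jh Om T v v + lapNorm T v
            + gam ^+ 2 * H1T T w w).
Definition Ncp (Om G0 : set pt) (T : mesh) (eps gam : R) (v w : bfun) : R :=
  Num.sqrt (eps * H1T T v v + Jh Om T v v + meshsize T * bdryG0 Om G0 T v + lapNorm T v
            + gam ^+ 2 * H1T T w w).

End FEM.

(* Main.v *)
(* Testing with v = u and w = - lambda + d w_u, d > 0 small, both estimates
   follow from a lifting w_u of u with
     a_h(u, w_u) >= Q / 2   and   |w_u|^2_{H^1(T_h)} <= C Q,
   where Q is the sum of |h Delta_h u|^2 and of h |flux u|^2 over the edges that
   carry an edge function.  On each triangle w_u is - a h^2 b_K Delta u (b_K the
   cubic bubble) plus an edge part, a Lagrange function plus Crouzeix-Raviart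
   bubbles, whose trace on each edge is h flux u modulo multiples of the Legendre
   polynomial P_k.  As the fluxes have degree < k they are orthogonal to P_k, so
   elementwise integration by parts turns a_h(u, w_u) into Q up to a term that a
   large weight a absorbs.  For odd k such traces exist: P_k takes opposite values
   at the ends of an edge.
   All integrals are over polynomials, hence are computed from the antiderivative
   along edges and from Green's formula on triangles; inverse estimates come from
   the finite dimension of the polynomial space on the reference triangle. *)

Require Import Defs.
From HB Require Import structures.
From mathcomp Require Import all_boot all_order all_algebra.
From mathcomp Require Import ring lra zify.
From mathcomp Require Import polyrcf.
From mathcomp Require Import all_classical all_reals all_analysis.
From mathcomp Require Import measurable_realfun.
Import Order.TTheory GRing.Theory Num.Theory.
Import numFieldNormedType.Exports.
Set Implicit Arguments.
Unset Strict Implicit.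
Unset Printing Implicit Defensive.
Local Open Scope classical_set_scope.
Local Open Scope ring_scope.

(** * Univariate polynomials on the unit interval; Legendre polynomials *)

Section Poly1.
Variable R : realType.
Implicit Types p q g : {poly R}.

(** The choice [v = u] makes [a_h(lambda, v)] cancel against the part [w = - lambda] of [a_h(u, w)]
    and keeps the [eps], [omega] and [gamma^2 |lambda|^2] terms; only the jump, boundary and
    Laplacian terms have to come from [d w_u]. Its cost [gamma^2 d <lambda, w_u>] is absorbed for
    [d = 1 / (1 + C)], and [gamma = 1/2] serves throughout. The lifting does not involve [eps];
    uniformity in [h] comes from transporting all estimates to one reference triangle, with
    determinant comparable to [h^2], and from bounding [h] by the size of Omega. A Crouzeix-Raviart
    bubble has nonzero trace on the other edges of its triangles, also on boundary edges that carry
    no edge function. There the trace is a multiple of [P_k], invisible to the fluxes, so the spaces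
    can omit those edges. The supremum ranges over pairs of nonzero norm. If
    [|||(u, lambda)||| = 0], the test pair has norm zero too and another admissible pair must be
    exhibited; in [V_0h] this depends on whether constants satisfy the boundary condition. *)

Definition prim p : {poly R} := \poly_(i < (size p).+1) (p`_i.-1 / i%:R).
Definition J p : R := (prim p).[1].

(** At [i = 0] the divisor is [0], so the quotient is [0] by convention: this is the antiderivative
    that vanishes at [0]. *)
Lemma coef_prim p i : (prim p)`_i = p`_i.-1 / i%:R.
Proof.
rewrite coef_poly; case: ltnP => // hi.
by case: i hi => [//|i] /= hi; rewrite nth_default // mul0r.
Qed.

Lemma deriv_prim p : (prim p)^`() = p.
Proof.
apply/polyP => i; rewrite coef_deriv coef_prim /= -[LHS]mulr_natr.
by rewrite mulfVK // pnatr_eq0.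
Qed.

Lemma prim0 p : (prim p).[0] = 0.
Proof. by rewrite horner_coef0 coef_prim invr0 mulr0. Qed.

Lemma J_is_linear : linear_for *%R J.
Proof.
move=> c p q; rewrite /J.
have -> : prim (c *: p + q) = c *: prim p + prim q.
  by apply/polyP => i; rewrite !(coef_prim, coefD, coefZ) mulrDl mulrA.
by rewrite hornerD hornerZ.
Qed.
HB.instance Definition _ := GRing.isLinear.Build R {poly R} R *%R J J_is_linear.

Lemma JZ c p : J (c *: p) = c * J p.
Proof. exact: linearZ. Qed.

Lemma JD p q : J (p + q) = J p + J q.
Proof. exact: raddfD. Qed.
Lemma JB p q : J (p - q) = J p - J q.
Proof. exact: raddfB. Qed.

Lemma J_deriv p : J p^`() = p.[1] - p.[0].
Proof.
rewrite /J; have -> : prim p^`() = p - (p`_0)%:P.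
  apply/polyP => -[|i]; rewrite coef_prim coefB coefC /= ?coef_deriv.
    by rewrite invr0 mulr0 subrr.
  by rewrite -[X in X / _ = _]mulr_natr mulfK ?subr0 // pnatr_eq0.
by rewrite hornerD hornerN hornerC horner_coef0.
Qed.

(** Change of variables for an affine map, multiplied through by [d] so that no sign or
    invertibility of [d] is involved. *)
Lemma J_comp_aff p (a d : R) :
  J (p \Po (a%:P + d *: 'X)) * d = (prim p).[a + d] - (prim p).[a].
Proof.
have := J_deriv (prim p \Po (a%:P + d *: 'X)).
rewrite deriv_comp deriv_prim derivD derivC derivZ derivX add0r.
rewrite alg_polyC mulrC mul_polyC linearZ /= mulrC => ->.
by rewrite !horner_comp !hornerE.
Qed.

(** Stated over any integral domain: it serves for polynomials over [R] and for bivariate ones, seen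
    as polynomials over [{poly R}]. *)
Lemma poly_eq0_inj (A : idomainType) (f : nat -> A) n (p : {poly A}) : injective f ->
  (size p <= n)%N -> (forall i, (i < n)%N -> p.[f i] = 0) -> p = 0.
Proof.
move=> fi sp h; apply/eqP/negPn/negP => nz.
have := @max_poly_roots _ p [seq f i | i <- iota 0 n] nz.
rewrite size_map size_iota ltnNge sp => H; suff: false by []; apply: H.
  by apply/allP => x /mapP[i]; rewrite mem_iota => /h pi ->; rewrite rootE pi.
by rewrite map_inj_uniq ?iota_uniq.
Qed.

Lemma itv_seq (a b : R) : a < b -> exists2 f : nat -> R, injective f & forall n, a <= f n <= b.
Proof.
move=> ab; exists (fun n => a + (b - a) * (n.+1%:R)^-1) => [i j /addrI /mulfI|n].
  by rewrite subr_eq0 gt_eqF // => /(_ isT) /invr_inj /eqP; rewrite eqr_nat => /eqP [].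
rewrite lerDl mulr_ge0 ?subr_ge0 ?(ltW ab) ?invr_ge0 ?ler0n //=.
by rewrite -lerBrDl ler_piMr ?subr_ge0 ?(ltW ab) // invf_le1 ?ler1n ?ltr0n.
Qed.

Lemma poly_eq0_itv (a b : R) p : a < b -> (forall x, a <= x <= b -> p.[x] = 0) -> p = 0.
Proof.
by move=> /itv_seq[f fi fab] h; apply: (poly_eq0_inj fi (leqnn _)) => i _; apply: h.
Qed.

(** [G] is nondecreasing with equal end values, hence constant on the interval and then as a
    polynomial. This gives the definiteness of the integral. *)
Lemma deriv_ge0_const (a b : R) G : a < b ->
  (forall x, a <= x <= b -> 0 <= G^`().[x]) -> G.[b] = G.[a] -> G^`() = 0.
Proof.
move=> ab Gge0 Gab.
have mono : {in `[a, b] &, {homo horner G : x y / x <= y}}.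
  by apply: ler_hornerW => x; rewrite in_itv /= => /andP[ax xb]; apply: Gge0; rewrite !ltW.
have aI : a \in `[a, b] by rewrite in_itv /= lexx ltW.
have bI : b \in `[a, b] by rewrite in_itv /= lexx ltW.
have -> : G = (G.[a])%:P; last by rewrite derivC.
apply/eqP; rewrite -subr_eq0; apply/eqP/(poly_eq0_itv ab) => x axb.
have [ax xb] := andP axb; have xI : x \in `[a, b] by rewrite in_itv.
rewrite hornerD hornerN hornerC; apply/eqP; rewrite subr_eq0; apply/eqP/le_anti.
by rewrite (mono a x) // -{1}Gab (mono x b).
Qed.

Lemma prim_le (a b : R) p : a <= b ->
  (forall x, a <= x <= b -> 0 <= p.[x]) -> (prim p).[a] <= (prim p).[b].
Proof.
move=> ab h; apply: (@ler_hornerW _ a b); rewrite ?in_itv /= ?lexx ?ab //.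
by move=> x; rewrite in_itv deriv_prim /= => /andP[ax xb]; apply: h; rewrite !ltW.
Qed.

Lemma J_ge0 p : (forall x, 0 <= x <= 1 -> 0 <= p.[x]) -> 0 <= J p.
Proof. by move=> h; rewrite /J -(prim0 p); apply: prim_le => //; apply: ler01. Qed.

Lemma J_eq0 p : (forall x, 0 <= x <= 1 -> 0 <= p.[x]) -> J p = 0 -> p = 0.
Proof.
move=> h Jp; rewrite -[p]deriv_prim; apply: (@deriv_ge0_const 0 1) => //.
  by move=> x /h; rewrite deriv_prim.
by rewrite prim0.
Qed.

Lemma J_rev p : J (p \Po (1 - 'X)) = J p.
Proof.
have := @J_comp_aff p 1 (-1); rewrite scaleN1r mulrN1 subrr prim0 sub0r.
by move/oppr_inj.
Qed.

(** * Legendre polynomials: recurrence, differential equation, orthogonality *)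

Lemma leg_rec n : legendre R n.+2 =
  (n.+2%:R)^-1 *: ((2 * n + 3)%:R *: ('X * legendre R n.+1) - (n.+1)%:R *: legendre R n).
Proof. by []. Qed.

Lemma leg_rec' n : n.+2%:R%:P * legendre R n.+2 =
  (2 * n + 3)%:R%:P * ('X * legendre R n.+1) - (n.+1)%:R%:P * legendre R n.
Proof.
rewrite leg_rec !mul_polyC scalerA divff ?scale1r // pnatr_eq0 //.
Qed.

(** The two identities are proved together: the differentiated recurrence and the second one at [n]
    give the first at [n + 1]; the second at [n + 1] then uses both at [n]. Combined, they yield
    Legendre's equation. *)
Lemma leg_deriv n :
  (legendre R n.+1)^`() = 'X * (legendre R n)^`() + n.+1%:R%:P * legendre R n /\
  (legendre R n)^`() = 'X * (legendre R n.+1)^`() - n.+1%:R%:P * legendre R n.+1.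
Proof.
elim: n => [|n [IA IB]].
  by rewrite /legendre /= derivX derivC; split; ring.
have rec := leg_rec' n.
have drec : n.+2%:R%:P * (legendre R n.+2)^`() =
  (2 * n + 3)%:R%:P * (legendre R n.+1 + 'X * (legendre R n.+1)^`())
   - (n.+1)%:R%:P * (legendre R n)^`().
  have := congr1 (@deriv R) rec.
  by rewrite derivB !derivM !derivC derivX !mul0r !add0r mul1r.
have nz : n.+2%:R%:P != 0 :> {poly R} by rewrite polyC_eq0 pnatr_eq0.
move: rec drec nz IA IB.
set a := legendre R n; set b := legendre R n.+1; set c := legendre R n.+2.
set a' := a^`(); set b' := b^`(); set c' := c^`().
rewrite -!(natr1 n.+1) -!(natr1 n) natrD natrM !polyCD !polyCM /=.
rewrite -[n%:R%:P]/((n%:R)%:P); set N := (n%:R)%:P.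
move=> rec drec nz IA IB.
have A1 : c' = 'X * b' + (N + 1 + 1) * b.
  apply: (mulfI nz); rewrite drec IB; ring.
split; first exact: A1.
have e1 : b' = 'X * ('X * b' - (N + 1) * b) + (N + 1) * a by rewrite -IB.
rewrite A1.
have -> : 'X * ('X * b' + (N + 1 + 1) * b) - (N + 1 + 1) * c =
  ('X * ('X * b' - (N + 1) * b) + (N + 1) * a) +
   ((2 * N + 3) * ('X * b) - (N + 1) * a - (N + 1 + 1) * c) by ring.
rewrite -e1 rec.
have -> : (2%:P : {poly R}) = 1 + 1 by rewrite (_ : 2 = 1 + 1 :> R) ?polyCD.
rewrite -[1%:P]/(1 : {poly R}); ring.
Qed.


Lemma leg_ode n : ((1 - 'X ^+ 2) * (legendre R n)^`())^`() =
  - (n%:R * n.+1%:R)%:P * legendre R n.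
Proof.
case: n => [|n]; first by rewrite /legendre /= derivC mulr0 derivC mul0r oppr0 mul0r.
have [IA IB] := leg_deriv n.
have e : (1 - 'X ^+ 2) * (legendre R n.+1)^`() =
   n.+1%:R%:P * (legendre R n - 'X * legendre R n.+1).
  have : (legendre R n.+1)^`() = 'X * ('X * (legendre R n.+1)^`() - n.+1%:R%:P * legendre R n.+1)
     + n.+1%:R%:P * legendre R n by rewrite -IB.
  move: (legendre R n.+1)^`() => b' h; rewrite mulrBl mul1r [X in X - _]h; ring.
rewrite e derivM derivC mul0r add0r derivB derivM derivX mul1r IB.
rewrite -(natr1 n.+1) !polyCM !polyCD /=; ring.
Qed.

Lemma leg1 n : (legendre R n).[1] = 1.
Proof.
suff [] : (legendre R n).[1] = 1 /\ (legendre R n.+1).[1] = 1 by [].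
elim: n => [|n [IA IB]]; first by rewrite /legendre /= !hornerE.
split=> //; rewrite leg_rec !hornerE /= IA IB.
have nz : n.+2%:R != 0 :> R by rewrite pnatr_eq0.
apply: (mulfI nz); rewrite mulrA divff // mul1r.
rewrite -!(natr1 n.+1) -!(natr1 n) natrD natrM; ring.
Qed.

Lemma legN1 n : (legendre R n).[-1] = (-1) ^+ n.
Proof.
suff [] : (legendre R n).[-1] = (-1) ^+ n /\ (legendre R n.+1).[-1] = (-1) ^+ n.+1 by [].
elim: n => [|n [IA IB]]; first by rewrite /legendre /= !hornerE.
split=> //; rewrite leg_rec !hornerE /= IA IB.
have nz : n.+2%:R != 0 :> R by rewrite pnatr_eq0.
apply: (mulfI nz); rewrite mulrA divff // mul1r !exprS.
rewrite -!(natr1 n.+1) -!(natr1 n) natrD natrM; ring.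
Qed.

Lemma size_leg n : (size (legendre R n) <= n.+1)%N.
Proof.
suff [] : (size (legendre R n) <= n.+1)%N /\ (size (legendre R n.+1) <= n.+2)%N by [].
elim: n => [|n [IA IB]]; first by rewrite /legendre /= size_poly1 size_polyX.
split=> //; rewrite leg_rec (leq_trans (size_scale_leq _ _)) //.
rewrite (leq_trans (size_polyD _ _)) // geq_max size_polyN; apply/andP; split.
  rewrite (leq_trans (size_scale_leq _ _)) // (leq_trans (size_polyMleq _ _)) //.
  by rewrite size_polyX.
by rewrite (leq_trans (size_scale_leq _ _)) // (leq_trans IA) // leqW.
Qed.

(** The orientation [1 - 2 t] matches the argument [1 - 2 lambda] of the edge bubbles: along an edge
    adjacent to the vertex of [lambda], this coordinate is the parameter [t] or [1 - t]. *)
Definition LL k : {poly R} := legendre R k \Po (1 - 2%:P * 'X).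

Lemma LL_at k t : (LL k).[t] = (legendre R k).[1 - 2 * t].
Proof. by rewrite horner_comp !hornerE. Qed.

Lemma LL0 k : (LL k).[0] = 1. Proof. by rewrite LL_at mulr0 subr0 leg1. Qed.
Lemma LL1 k : (LL k).[1] = (-1) ^+ k.
Proof. by rewrite LL_at -(legN1 k); congr horner; ring. Qed.

(* [L = LL k] satisfies [(t (1 - t) L')' = - k (k + 1) L], an
   operator that is symmetric for [J] and maps [t ^ j] to
   lower order terms plus [t ^ j] times the distinct number [- j (j + 1)]. *)
Lemma LL_ode k : ('X * (1 - 'X) * (LL k)^`())^`() = - (k%:R * k.+1%:R)%:P * LL k.
Proof.
have e : 4%:P * ('X * (1 - 'X)) = (1 - 'X ^+ 2) \Po (1 - 2%:P * 'X) :> {poly R}.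
  by rewrite rmorphB /= rmorphXn /= comp_polyX rmorph1 (_ : 4 = 2 + 2 :> R) ?polyCD; [ring|ring].
have dq : (1 - 2%:P * 'X)^`() = - 2%:P :> {poly R}.
  by rewrite derivB derivM derivX !derivC mul0r mulr1 !add0r.
have n4 : (4%:P : {poly R}) != 0 by rewrite polyC_eq0 pnatr_eq0.
apply: (mulfI n4).
have -> : 4%:P * ('X * (1 - 'X) * (LL k)^`())^`() = (4%:P * ('X * (1 - 'X)) * (LL k)^`())^`().
  by rewrite -[in RHS]mulrA [in RHS]derivM derivC mul0r add0r.
rewrite e /LL deriv_comp dq mulrA -rmorphM /= derivM derivN derivC oppr0 mulr0 addr0.
rewrite deriv_comp dq leg_ode rmorphM /= rmorphN /= comp_polyC.
by rewrite (_ : 4 = 2 * 2 :> R) ?polyCM; [ring|ring].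
Qed.

Lemma deriv_Xn n : ('X^(n.+1))^`() = n.+1%:R%:P * 'X^n :> {poly R}.
Proof. by rewrite derivXn /= -[LHS]mulr_natl polyC_natr. Qed.

Lemma J_orth_Xn k j : (j < k)%N -> J (LL k * 'X^j) = 0.
Proof.
have sym m : J (LL k * ('X * (1 - 'X) * m^`())^`()) = J (('X * (1 - 'X) * (LL k)^`())^`() * m).
  apply/eqP; rewrite -subr_eq0 -raddfB /=.
  have -> : LL k * ('X * (1 - 'X) * m^`())^`() - ('X * (1 - 'X) * (LL k)^`())^`() * m =
    ('X * (1 - 'X) * (LL k * m^`() - (LL k)^`() * m))^`().
    by rewrite !(derivM, derivB, derivX, derivC); ring.
  by rewrite J_deriv !hornerM !hornerD !hornerN !hornerX !hornerC subrr mulr0 !mul0r subrr.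
have key j' : J (LL k * ('X * (1 - 'X) * ('X^j')^`())^`()) = - (k%:R * k.+1%:R) * J (LL k * 'X^j').
  by rewrite sym LL_ode -mulrA -polyCN mul_polyC linearZ.
elim: j => [|j IH] jk.
  (* The operator kills constants, so [k (k + 1)] times the integral vanishes, and [k > 0]. *)
  have := key 0%N; rewrite derivC mulr0 derivC mulr0 raddf0 => /esym/eqP.
  rewrite mulf_eq0 oppr_eq0 -natrM pnatr_eq0 muln_eq0 /= orbF => /orP[|/eqP//].
  by case: k jk {sym key}.
have := key j.+1.
pose c1 : {poly R} := (j.+1%:R * j.+1%:R)%:P.
pose c2 : {poly R} := (j.+1%:R * j.+2%:R)%:P.
have -> : ('X * (1 - 'X) * ('X^(j.+1) : {poly R})^`())^`() = c1 * 'X^j - c2 * 'X^(j.+1).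
  have -> : 'X * (1 - 'X) * ('X^(j.+1))^`() = j.+1%:R%:P * ('X^(j.+1) - 'X^(j.+2)) :> {poly R}.
    by rewrite deriv_Xn !exprS; ring.
  rewrite /c1 /c2 derivM derivC mul0r add0r derivB !deriv_Xn !polyCM; ring.
rewrite /c1 /c2 mulrBr !mulrA ![LL k * _%:P]mulrC -!mulrA !mul_polyC JB !JZ.
rewrite IH ?(ltnW jk) // mulr0 sub0r => /eqP; rewrite mulNr eqr_opp -subr_eq0 -mulrBl.
rewrite mulf_eq0 => /orP[|/eqP //]; rewrite -!natrM subr_eq0 eqr_nat => /eqP h.
suff : (j.+1 * j.+2 < k * k.+1)%N by rewrite h ltnn.
by apply: ltn_mul.
Qed.

Lemma J_orth k g : (size g <= k)%N -> J (LL k * g) = 0.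
Proof.
move=> sg; rewrite -[g]coefK poly_def mulr_sumr raddf_sum big1 // => i _.
by rewrite -[LHS]/(J _) -scalerAr JZ J_orth_Xn ?mulr0 // (leq_trans (ltn_ord i)).
Qed.

Lemma poly_eq0_nodes n g : (0 < n)%N -> (size g <= n.+1)%N ->
  (forall i, (i <= n)%N -> g.[i%:R / n%:R] = 0) -> g = 0.
Proof.
move=> n0 sg h; apply: (@poly_eq0_inj _ (fun i => i%:R / n%:R) n.+1) => // i j /mulIf.
by rewrite invr_eq0 pnatr_eq0 -lt0n n0 => /(_ isT) /eqP; rewrite eqr_nat => /eqP.
Qed.

(** * Coefficient bounds from a positive definite form *)

Section Gram.
Variables (A : comNzRingType) (iota : {rmorphism R -> A}) (F : A -> R) (N : nat)
  (phi : 'I_N -> A).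
Hypothesis FD : forall a b, F (a + b) = F a + F b.
Hypothesis FZ : forall c a, F (iota c * a) = c * F a.
Let lc (c : 'I_N -> R) := \sum_i iota (c i) * phi i.
Hypothesis F_ge0 : forall c, 0 <= F (lc c ^+ 2).
Hypothesis F_eq0 : forall c, F (lc c ^+ 2) = 0 -> forall i, c i = 0.

Let F0 : F 0 = 0.
Proof. by have := FZ 0 0; rewrite mulr0 mul0r. Qed.
Let Fsum (I : finType) (f : I -> A) : F (\sum_i f i) = \sum_i F (f i).
Proof. exact: (big_morph F FD F0). Qed.

(* [c i] is the [F]-inner product of [lc c] with the dual basis vector, so
   Cauchy-Schwarz bounds it by the norm of [lc c]. *)
Lemma gram_coef_bound : exists2 C, 0 < C & forall c i, c i ^+ 2 <= C * F (lc c ^+ 2).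
Proof.
pose M := \matrix_(i, j) F (phi i * phi j).
pose bil c d := F (lc c * lc d).
have bilE (c d : 'rV[R]_N) : bil (c 0) (d 0) = (c *m M *m d^T) 0 0.
  rewrite /bil /lc mulr_suml Fsum mxE.
  under [RHS]eq_bigr => j _ do rewrite !mxE mulr_suml.
  rewrite exchange_big /=; apply: eq_bigr => i _.
  rewrite mulr_sumr Fsum; apply: eq_bigr => j _.
  by rewrite mulrACA -rmorphM FZ mxE mulrAC.
have Munit : M \in unitmx.
  rewrite -row_free_unit; apply: inj_row_free => v vM.
  apply/rowP => i; rewrite mxE; apply: (F_eq0 (c := v 0)).
  by rewrite expr2 -/(bil _ _) bilE vM mul0mx mxE.
have Msym : M^T = M by apply/matrixP => i j; rewrite !mxE mulrC.
(* Row [i] of the inverse Gram matrix: the dual basis vector, whose pairing with [c] is [c i]. *)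
pose y i : 'rV[R]_N := delta_mx 0 i *m invmx M.
have dual (c : 'rV[R]_N) i : bil (c 0) (y i 0) = c 0 i.
  rewrite bilE /y trmx_mul trmx_inv Msym mulmxA mulmxK // trmx_delta.
  by rewrite -colE mxE.
have lcD (c d : 'rV[R]_N) a b : lc ((a *: c - b *: d) 0) = iota a * lc (c 0) - iota b * lc (d 0).
  rewrite /lc !mulr_sumr -sumrB; apply: eq_bigr => i _.
  by rewrite !mxE rmorphB !rmorphM mulrBl !mulrA.
(* The sum dominates every dual norm at once; the [1] keeps the constant positive when there is no
   basis vector. *)
exists (1 + \sum_i bil (y i 0) (y i 0)) => [|c i].
  by rewrite ltr_pwDl ?ltr01 // sumr_ge0 // => i _; rewrite /bil -expr2 F_ge0.
pose cv := \row_j c j; have cvE : cv 0 = c by apply/funext => j; rewrite mxE.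
rewrite -cvE -dual -[F _]/(bil (cv 0) (cv 0)).
set bcy := bil _ _; set bcc := bil _ _; set byy := bil (y i 0) (y i 0).
have byy_ge0 : 0 <= byy by rewrite /byy /bil -expr2.
have bcc_ge0 : 0 <= bcc by rewrite /bcc /bil -expr2.
have byy0 : 0 < byy.
  rewrite lt_def byy_ge0 andbT; apply/negP => /eqP h.
  have := dual (delta_mx 0 i *m invmx M) i; rewrite -/(y i) -/byy h => y0.
  have yz : y i = 0.
    by apply/rowP => j; rewrite [RHS]mxE; apply: (F_eq0 (c := y i 0)); rewrite expr2.
  have := congr1 (fun m => (m *m M) 0 i) yz.
  by rewrite /= /y mulmxKV // mul0mx !mxE !eqxx => /eqP; rewrite oner_eq0.
(* Cauchy-Schwarz: the form is nonnegative on [byy c - bcy y], where it equals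
   [byy (byy bcc - bcy^2)]. *)
have := F_ge0 ((byy *: cv - bcy *: y i) 0); rewrite lcD.
have -> : F ((iota byy * lc (cv 0) - iota bcy * lc (y i 0)) ^+ 2) =
  byy ^+ 2 * bcc - 2 * (byy * bcy) * bcy + bcy ^+ 2 * byy.
  have -> : (iota byy * lc (cv 0) - iota bcy * lc (y i 0)) ^+ 2 =
     iota (byy ^+ 2) * (lc (cv 0) * lc (cv 0)) + iota (- (2 * (byy * bcy))) * (lc (cv 0) * lc (y i 0))
      + iota (bcy ^+ 2) * (lc (y i 0) * lc (y i 0)).
    by rewrite !rmorphXn rmorphN !rmorphM rmorph_nat /=; ring.
  by rewrite !FD !FZ /bcc /byy /bcy /bil; ring.
move=> h; have h2 : bcy ^+ 2 <= byy * bcc.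
  rewrite -(ler_pM2l byy0) -subr_ge0; apply: le_trans h _.
  by rewrite le_eqVlt; apply/orP; left; apply/eqP; ring.
apply: le_trans h2 _; apply: ler_wpM2r => //.
rewrite (bigD1 i) //= -/byy addrCA lerDl addr_ge0 ?ler01 // sumr_ge0 // => j _.
by rewrite /bil -expr2.
Qed.
End Gram.

(** The Gram bound controls the coefficients by the integral of the square, and on the unit interval
    coefficients control values. *)
Lemma J_sup_bound n : exists2 C, 0 < C & forall g, (size g <= n)%N ->
  forall t, 0 <= t <= 1 -> g.[t] ^+ 2 <= C * J (g ^+ 2).
Proof.
have [||||C C0 hC] := @gram_coef_bound {poly R} polyC J n (fun i => 'X^i).
- by move=> a b; rewrite raddfD.
- by move=> c a; rewrite mul_polyC linearZ.
- by move=> c; apply: J_ge0 => x _; rewrite horner_exp sqr_ge0.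
- move=> c /J_eq0 H i.
  have /eqP : (\sum_i (c i)%:P * 'X^i) ^+ 2 = 0.
    by apply: H => x _; rewrite horner_exp sqr_ge0.
  rewrite sqrf_eq0 => /eqP /(congr1 (fun p : {poly R} => p`_i)).
  rewrite coef0 coef_sum (bigD1 i) //= coefCM coefXn eqxx mulr1 big1 ?addr0 // => j ji.
  by rewrite coefCM coefXn eq_sym (inj_eq val_inj) (negbTE ji) mulr0.
(* At most [n] coefficients contribute; [n.+1] keeps the constant positive for [n = 0]. *)
exists (n.+1%:R ^+ 2 * C) => [|g sg t /andP[t0 t1]].
  by rewrite mulr_gt0 // exprn_gt0 // ltr0n.
have gE : g = \sum_(i < n) (g`_i)%:P * 'X^i.
  rewrite -[LHS](coefK g); apply/polyP => j; rewrite coef_poly coef_sum.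
  case: ltnP => hj.
    rewrite (bigD1 (Ordinal (leq_trans hj sg))) //= coefCM coefXn eqxx mulr1 big1 ?addr0 //.
    by move=> i /eqP ij; rewrite coefCM coefXn; case: eqP => [h|]; [case: ij; apply: val_inj|rewrite mulr0].
  rewrite big1 // => i _; rewrite coefCM coefXn.
  by case: eqP => [h|]; [rewrite -h nth_default ?mul0r|rewrite mulr0].
have := hC (fun i => g`_i); rewrite -gE => {}hC.
have Jg0 : 0 <= J (g ^+ 2) by apply: J_ge0 => x _; rewrite horner_exp sqr_ge0.
have s0 : 0 <= Num.sqrt (C * J (g ^+ 2)) := sqrtr_ge0 _.
have ss : Num.sqrt (C * J (g ^+ 2)) ^+ 2 = C * J (g ^+ 2) by rewrite sqr_sqrtr // mulr_ge0 // ltW.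
rewrite -mulrA -ss -exprMn -[g.[t] ^+ 2]real_normK ?num_real //.
rewrite ler_pXn2r ?nnegrE ?normr_ge0 ?mulr_ge0 ?ler0n //.
rewrite {1}gE horner_sum (le_trans (ler_norm_sum _ _ _)) //.
apply: le_trans (_ : \sum_(i < n) Num.sqrt (C * J (g ^+ 2)) <= _).
  apply: ler_sum => i _; rewrite hornerCM hornerXn normrM.
  have ci : `|g`_i| <= Num.sqrt (C * J (g ^+ 2)).
    by rewrite -(ler_pXn2r (n := 2)) ?nnegrE ?normr_ge0 // ss real_normK ?num_real.
  rewrite (le_trans _ ci) // ler_piMr ?normr_ge0 // normrX ger0_norm // exprn_ile1 //.
by rewrite sumr_const card_ord -[leLHS]mulr_natl; apply: ler_wpM2r; rewrite // ler_nat leqW.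
Qed.

End Poly1.

(** * Bivariate polynomials *)

Section Poly2.
Variable R : realType.
Notation P2 := (P2 R).
Notation pt := (pt R).
Implicit Types (p q : P2) (x y z : pt) (c : R).

Lemma horner_ext (p q : {poly R}) : (forall t, p.[t] = q.[t]) -> p = q.
Proof.
move=> h; apply/eqP; rewrite -subr_eq0; apply/eqP; apply: (@poly_eq0_itv R 0 1); first exact: ltr01.
by move=> x _; rewrite hornerD hornerN h subrr.
Qed.

Lemma evD p q x : ev (p + q) x = ev p x + ev q x. Proof. by rewrite /ev !hornerD. Qed.
Lemma evN p x : ev (- p) x = - ev p x. Proof. by rewrite /ev !hornerN. Qed.
Lemma evB p q x : ev (p - q) x = ev p x - ev q x. Proof. by rewrite evD evN. Qed.
Lemma evM p q x : ev (p * q) x = ev p x * ev q x. Proof. by rewrite /ev !hornerM. Qed.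
Lemma ev_cst c x : ev (cst2 c) x = c. Proof. by rewrite /ev !hornerC. Qed.
Lemma ev0 x : ev 0 x = 0 :> R. Proof. by rewrite /ev !horner0. Qed.
Lemma ev1 x : ev 1 x = 1 :> R. Proof. by rewrite /ev !hornerC. Qed.
Lemma evX p n x : ev (p ^+ n) x = ev p x ^+ n. Proof. by rewrite /ev !horner_exp. Qed.
Lemma ev_aff a b c x : ev (affP a b c) x = a + b * x.1 + c * x.2.
Proof. by rewrite /ev /affP !hornerE /=. Qed.
Lemma ev_sum (I : Type) (r : seq I) (P : pred I) (f : I -> P2) x :
  ev (\sum_(i <- r | P i) f i) x = \sum_(i <- r | P i) ev (f i) x.
Proof. exact: (big_morph (fun p => ev p x) (fun p q => evD p q x) (ev0 x)). Qed.
Lemma ev_prod (I : Type) (r : seq I) (P : pred I) (f : I -> P2) x :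
  ev (\prod_(i <- r | P i) f i) x = \prod_(i <- r | P i) ev (f i) x.
Proof. exact: (big_morph (fun p => ev p x) (fun p q => evM p q x) (ev1 x)). Qed.

Lemma cst2M c d : cst2 (c * d) = cst2 c * cst2 d :> P2. Proof. by rewrite /cst2 !polyCM. Qed.
Lemma cst2D c d : cst2 (c + d) = cst2 c + cst2 d :> P2. Proof. by rewrite /cst2 !polyCD. Qed.
Lemma cst20 : cst2 0 = 0 :> P2. Proof. by rewrite /cst2 !polyC0. Qed.
Lemma cst21 : cst2 1 = 1 :> P2. Proof. by []. Qed.
Lemma cst2N c : cst2 (- c) = - cst2 c :> P2. Proof. by rewrite /cst2 !polyCN. Qed.

Lemma ev_comp2 (P : {poly R}) q x : ev (comp2 P q) x = P.[ev q x].
Proof.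
rewrite /comp2 ev_sum horner_coef; apply: eq_bigr => i _.
by rewrite evM ev_cst evX.
Qed.

Lemma ev_eq0_rect (a b c d : R) p : a < b -> c < d ->
  (forall x, a <= x.1 <= b -> c <= x.2 <= d -> ev p x = 0) -> p = 0.
Proof.
move=> ab cd h.
have h2 (y : R) : c <= y <= d -> p.[y%:P] = 0.
  by move=> hy; apply: (@poly_eq0_itv R a b) => // x hx; apply: (h (x, y)).
have [f fi fcd] := itv_seq cd; apply: (@poly_eq0_inj _ (fun n => (f n)%:P) _ p _ (leqnn _)).
  by move=> i j /polyC_inj /fi.
by move=> i _; apply/h2/fcd.
Qed.

Lemma ev_ext p q : (forall x, ev p x = ev q x) -> p = q.
Proof.
move=> h; apply/eqP; rewrite -subr_eq0; apply/eqP.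
by apply: (@ev_eq0_rect 0 1 0 1); rewrite ?ltr01 // => x _ _; rewrite evB h subrr.
Qed.

Definition px : P2 := 'X%:P.
Definition py : P2 := 'X.
Lemma ev_px x : ev px x = x.1. Proof. by rewrite /ev hornerC hornerX. Qed.
Lemma ev_py x : ev py x = x.2. Proof. by rewrite /ev hornerX hornerC. Qed.

Lemma P2_sumE p : p = \sum_(i < size p) \sum_(j < size p`_i) cst2 p`_i`_j * px ^+ j * py ^+ i.
Proof.
apply: ev_ext => x; rewrite ev_sum.
have -> : ev p x = \sum_(i < size p) (p`_i * x.2%:P ^+ i).[x.1].
  by rewrite /ev (horner_coef p) horner_sum.
apply: eq_bigr => i _.
rewrite hornerM ev_sum horner_coef mulr_suml; apply: eq_bigr => j _.
by rewrite !evM !evX ev_cst ev_px ev_py -polyC_exp hornerC.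
Qed.

(** Constants and the two coordinates generate the ring, so chain rules, measurability and
    boundedness need checking only on these generators. *)
Lemma P2_ind (P : P2 -> Prop) : (forall c, P (cst2 c)) -> P px -> P py ->
  (forall p q, P p -> P q -> P (p + q)) -> (forall p q, P p -> P q -> P (p * q)) ->
  forall p, P p.
Proof.
move=> Pc Px Py PD PM p; rewrite [p]P2_sumE.
have P0 : P 0 by rewrite -cst20.
have PE q n : P q -> P (q ^+ n).
  by move=> Pq; elim: n => [|n IH]; [rewrite expr0 -cst21|rewrite exprS; apply: PM].
do 2! (apply: big_ind; [exact: P0|exact: PD|move=> ? _]).
by apply: (PM); [apply: (PM); [exact: Pc|exact: PE]|exact: PE].
Qed.

(** * Partial derivatives *)

Lemma dXD p q : dX (p + q) = dX p + dX q.
Proof. by apply/polyP => i; rewrite /dX coefD !coef_map /= coefD derivD. Qed.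
Lemma dX0 : dX 0 = 0 :> P2. Proof. by rewrite /dX map_poly0. Qed.
Lemma coef_dX p i : (dX p)`_i = (p`_i)^`(). Proof. by rewrite coef_map. Qed.
Lemma dXM p q : dX (p * q) = dX p * q + p * dX q.
Proof.
apply/polyP => i; rewrite coefD !coefM coef_dX coefM raddf_sum /= -big_split /=.
by apply: eq_bigr => j _; rewrite derivM !coef_dX.
Qed.
Lemma dX_cst c : dX (cst2 c) = 0.
Proof. by rewrite /dX /cst2 map_polyC /= derivC. Qed.
Lemma dX_px : dX px = 1. Proof. by rewrite /dX map_polyC /= derivX. Qed.
Lemma dX_py : dX py = 0.
Proof. by apply/polyP => i; rewrite coef_dX coefX coef0; case: eqP => _; rewrite ?derivC // -polyC1 derivC. Qed.
Lemma dYD p q : dY (p + q) = dY p + dY q. Proof. exact: derivD. Qed.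
Lemma dYM p q : dY (p * q) = dY p * q + p * dY q. Proof. exact: derivM. Qed.
Lemma dY_cst c : dY (cst2 c) = 0. Proof. exact: derivC. Qed.
Lemma dY_px : dY px = 0. Proof. exact: derivC. Qed.
Lemma dY_py : dY py = 1. Proof. exact: derivX. Qed.
Lemma dXdY p : dX (dY p) = dY (dX p).
Proof.
by apply/polyP => i; rewrite coef_dX !coef_deriv coef_dX derivMn.
Qed.
Lemma dXZ c p : dX (cst2 c * p) = cst2 c * dX p. Proof. by rewrite dXM dX_cst mul0r add0r. Qed.
Lemma dYZ c p : dY (cst2 c * p) = cst2 c * dY p. Proof. by rewrite dYM dY_cst mul0r add0r. Qed.
Lemma affPE a b c : affP a b c = cst2 a + cst2 b * px + cst2 c * py.
Proof. by apply: ev_ext => x; rewrite ev_aff !evD !evM !ev_cst ev_px ev_py. Qed.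
Lemma dX_aff a b c : dX (affP a b c) = cst2 b.
Proof. by rewrite affPE !dXD !dXZ dX_cst dX_px dX_py mulr1 mulr0 add0r addr0. Qed.
Lemma dY_aff a b c : dY (affP a b c) = cst2 c.
Proof. by rewrite affPE !dYD !dYZ dY_cst dY_px dY_py mulr1 mulr0 !add0r. Qed.

(** Lets every integrand be written as a derivative, so that all integrals over triangles reduce to
    integrals along edges. *)
Lemma dY_surj p : exists G, dY G = p.
Proof.
exists (\sum_(i < size p) (((i.+1%:R)^-1 : R)%:P * p`_i)%:P * 'X^(i.+1)).
rewrite /dY raddf_sum /= -[RHS]coefK poly_def; apply: eq_bigr => i _.
rewrite derivM derivC mul0r add0r derivXn /= -[X in _ * X]mulr_natl mulrA -polyC_natr -polyCM.
rewrite mul_polyC; congr (_ *: _).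
by rewrite mulrAC -polyC_natr -polyCM mulVf ?pnatr_eq0 // polyC1 mul1r.
Qed.

(** * Restriction to curves and segments *)

Definition evs (f g : {poly R}) p : {poly R} :=
  \sum_(i < size p) \sum_(j < size p`_i) (p`_i`_j)%:P * f ^+ j * g ^+ i.
Lemma horner_evs f g p t : (evs f g p).[t] = ev p (f.[t], g.[t]).
Proof.
rewrite [p in RHS]P2_sumE /evs horner_sum ev_sum; apply: eq_bigr => i _.
rewrite horner_sum ev_sum; apply: eq_bigr => j _.
by rewrite !hornerM !horner_exp hornerC !evM !evX ev_cst ev_px ev_py.
Qed.
Definition seg1 (F : edge R) : {poly R} := (F.1.1)%:P + (F.2.1 - F.1.1)%:P * 'X.
Definition seg2 (F : edge R) : {poly R} := (F.1.2)%:P + (F.2.2 - F.1.2)%:P * 'X.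
Definition segP (F : edge R) p : {poly R} := evs (seg1 F) (seg2 F) p.
Lemma segPE F p t : (segP F p).[t] = ev p (seg_pt F t).
Proof. by rewrite /segP horner_evs /seg1 /seg2 !hornerE /seg_pt !(mulrC t). Qed.
Lemma segPD F p q : segP F (p + q) = segP F p + segP F q.
Proof. by apply: horner_ext => t; rewrite hornerD !segPE evD. Qed.
Lemma segPM F p q : segP F (p * q) = segP F p * segP F q.
Proof. by apply: horner_ext => t; rewrite hornerM !segPE evM. Qed.
Lemma segP_cst F c : segP F (cst2 c) = c%:P.
Proof. by apply: horner_ext => t; rewrite hornerC !segPE ev_cst. Qed.
Lemma segP0 F : segP F 0 = 0.
Proof. by apply: horner_ext => t; rewrite horner0 !segPE ev0. Qed.
Lemma segP_sum F (I : Type) (r : seq I) (P : pred I) (f : I -> P2) :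
  segP F (\sum_(i <- r | P i) f i) = \sum_(i <- r | P i) segP F (f i).
Proof. exact: (big_morph _ (segPD F) (segP0 F)). Qed.
Lemma segP_rev a b p : segP (b, a) p = segP (a, b) p \Po (1 - 'X).
Proof.
apply: horner_ext => t; rewrite horner_comp !hornerE !segPE /seg_pt /=; congr ev.
by congr pair; ring.
Qed.

Lemma segP_deriv F p : (segP F p)^`() =
  (F.2.1 - F.1.1)%:P * segP F (dX p) + (F.2.2 - F.1.2)%:P * segP F (dY p).
Proof.
move: p; apply: P2_ind => [c|||p q Hp Hq|p q Hp Hq].
- by rewrite segP_cst derivC dX_cst dY_cst segP0 !mulr0 addr0.
- rewrite dX_px dY_px -cst21 segP_cst segP0 mulr0 addr0 mulr1.
  have -> : segP F px = seg1 F.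
    by apply: horner_ext => t; rewrite segPE ev_px /seg1 /seg_pt !hornerE /= mulrC.
  by rewrite /seg1 derivD derivM derivX !derivC mul0r !add0r mulr1.
- rewrite dX_py dY_py -cst21 segP_cst segP0 mulr0 add0r mulr1.
  have -> : segP F py = seg2 F.
    by apply: horner_ext => t; rewrite segPE ev_py /seg2 /seg_pt !hornerE /= mulrC.
  by rewrite /seg2 derivD derivM derivX !derivC mul0r !add0r mulr1.
- by rewrite dXD dYD !segPD derivD Hp Hq; ring.
- by rewrite dXM dYM !segPD !segPM derivM Hp Hq; ring.
Qed.

(** * Total degree *)

Lemma deg2leP n p : deg2le n p <-> forall i, p`_i != 0 -> (size (p`_i)%R + i <= n.+1)%N.
Proof.
split=> h i.
  move=> nz; have := h i (size p`_i).-1.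
  rewrite -lead_coefE lead_coef_eq0 => /(_ nz); move: nz; rewrite -size_poly_gt0.
  by case: (size _) => // m _ /=; rewrite addSn addnC ltnS.
move=> j nz; have pi0 : p`_i != 0 by apply: contraNneq nz => ->; rewrite coef0.
have := h i pi0; rewrite addnC; have : (j < size (p`_i)%R)%N.
  by rewrite ltnNge; apply: contra nz => /leq_sizeP ->.
by move=> h1 h2; rewrite -ltnS (leq_trans _ h2) // -addnS leq_add2l.
Qed.

Lemma deg2le_size n p : deg2le n p -> (size p <= n.+1)%N.
Proof.
move=> h; apply/leq_sizeP => i hi; apply/eqP/negPn/negP => nz.
have := (deg2leP n p).1 h i nz; move: nz; rewrite -size_poly_gt0; lia.
Qed.
Lemma deg2le_sizei n p i : deg2le n p -> (size (p`_i)%R <= n.+1 - i)%N.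
Proof.
move=> h; case: (eqVneq p`_i 0) => [->|nz]; first by rewrite size_poly0.
by have := (deg2leP n p).1 h i nz; lia.
Qed.
Lemma deg2le_sub m n p : (m <= n)%N -> deg2le m p -> deg2le n p.
Proof. by move=> mn h i j /h; lia. Qed.
Lemma deg2leD n p q : deg2le n p -> deg2le n q -> deg2le n (p + q).
Proof.
move=> hp hq i j; rewrite !coefD.
case: (eqVneq p`_i`_j 0) => [->|/hp //]; rewrite add0r; exact: hq.
Qed.
Lemma deg2leN n p : deg2le n p -> deg2le n (- p).
Proof. by move=> hp i j; rewrite !coefN oppr_eq0; apply: hp. Qed.
Lemma deg2le_cst n c : deg2le n (cst2 c).
Proof. move=> i j; rewrite /cst2 coefC; case: i => [|i] /=; last by rewrite coef0 eqxx.
by rewrite coefC; case: j => [|j] //=; rewrite eqxx. Qed.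
Lemma deg2le0 n : deg2le n (0 : P2).
Proof. by rewrite -cst20; apply: deg2le_cst. Qed.
Lemma deg2leM m n p q : deg2le m p -> deg2le n q -> deg2le (m + n) (p * q).
Proof.
move=> hp hq i j; rewrite coefM coef_sum => nz; rewrite leqNgt; apply/negP => hij.
move/eqP: nz; apply; rewrite big1 // => a _; rewrite coefM big1 // => b _.
case: (eqVneq p`_a`_b 0) => [->|/hp h1]; first by rewrite mul0r.
case: (eqVneq q`_(i - a)`_(j - b) 0) => [->|/hq h2]; first by rewrite mulr0.
by have := ltn_ord a; have := ltn_ord b; lia.
Qed.
Lemma deg2leZ n c p : deg2le n p -> deg2le n (cst2 c * p).
Proof. by move=> h; rewrite -[n]add0n; apply: deg2leM => //; apply: deg2le_cst. Qed.
Lemma deg2leX m n p : deg2le m p -> deg2le (n * m) (p ^+ n).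
Proof.
move=> h; elim: n => [|n IH]; first by rewrite expr0 -cst21; apply: deg2le_cst.
by rewrite exprS mulSn; apply: deg2leM.
Qed.
Lemma deg2le_px : deg2le 1 px.
Proof.
move=> i j; rewrite /px coefC; case: i => [|i] /=; rewrite ?coef0 ?eqxx // coefX.
by case: (j =P 1%N) => [->//|_]; rewrite eqxx.
Qed.
Lemma deg2le_py : deg2le 1 py.
Proof.
move=> i j; rewrite /py coefX; case: (i =P 1%N) => [->|_]; last by rewrite coef0 eqxx.
by rewrite coefC; case: j => //=; rewrite eqxx.
Qed.
Lemma deg2le_aff a b c : deg2le 1 (affP a b c).
Proof.
rewrite affPE; apply: deg2leD; last exact/deg2leZ/deg2le_py.
by apply: deg2leD; [apply: deg2le_cst|exact/deg2leZ/deg2le_px].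
Qed.
Lemma deg2le_sum n (I : Type) (r : seq I) (P : pred I) (f : I -> P2) :
  (forall i, P i -> deg2le n (f i)) -> deg2le n (\sum_(i <- r | P i) f i).
Proof.
by move=> h; apply: (big_ind (deg2le n)) => //; [apply: deg2le0|apply: deg2leD].
Qed.
Lemma deg2le_dX n p : deg2le n p -> deg2le n.-1 (dX p).
Proof.
move=> h i j; rewrite coef_dX coef_deriv => nz.
have /h : p`_i`_j.+1 != 0 by apply: contraNneq nz => ->; rewrite mul0rn.
lia.
Qed.
Lemma deg2le_dY n p : deg2le n p -> deg2le n.-1 (dY p).
Proof.
move=> h i j; rewrite coef_deriv coefMn => nz.
have /h : p`_i.+1`_j != 0 by apply: contraNneq nz => ->; rewrite mul0rn.
lia.
Qed.

Lemma deg2le_ind n (P : P2 -> Prop) : P 0 -> (forall p q, P p -> P q -> P (p + q)) ->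
  (forall c i j, (i + j <= n)%N -> P (cst2 c * px ^+ j * py ^+ i)) ->
  forall p, deg2le n p -> P p.
Proof.
move=> P0 PD Pm p h; rewrite [p]P2_sumE.
apply: big_ind => // i _; apply: big_ind => // j _.
have [->|/h] := eqVneq p`_i`_j 0; first by rewrite cst20 !mul0r.
exact: Pm.
Qed.

Lemma size_segP n F p : deg2le n p -> (size (segP F p) <= n.+1)%N.
Proof.
move: p; apply: deg2le_ind => [|p q hp hq|c i j hij].
- by rewrite segP0 size_poly0.
- by rewrite segPD (leq_trans (size_polyD _ _)) // geq_max hp.
have segX q m : segP F (q ^+ m) = segP F q ^+ m.
  by apply: horner_ext => t; rewrite horner_exp !segPE evX.
have sx : (size (segP F px) <= 2)%N.
  have -> : segP F px = (F.2.1 - F.1.1) *: 'X + (F.1.1)%:P.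
    by apply: horner_ext => t; rewrite segPE ev_px /seg_pt !hornerE /= mulrC addrC.
  by rewrite (leq_trans (size_polyD _ _)) // geq_max (leq_trans (size_scale_leq _ _)) ?size_polyX // (leq_trans (size_polyC_leq1 _)).
have sy : (size (segP F py) <= 2)%N.
  have -> : segP F py = (F.2.2 - F.1.2) *: 'X + (F.1.2)%:P.
    by apply: horner_ext => t; rewrite segPE ev_py /seg_pt !hornerE /= mulrC addrC.
  by rewrite (leq_trans (size_polyD _ _)) // geq_max (leq_trans (size_scale_leq _ _)) ?size_polyX // (leq_trans (size_polyC_leq1 _)).
rewrite !segPM segP_cst !segX -mulrA mul_polyC (leq_trans (size_scale_leq _ _)) //.
have sE (r : {poly R}) m : (size r <= 2)%N -> (size (r ^+ m) <= m.+1)%N.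
  move=> sr; apply: leq_trans (size_poly_exp_leq _ _) _.
  by rewrite ltnS -[leqRHS]mul1n leq_mul2r; apply/orP; right; case: (size r) sr => [|[|[]]].
rewrite (leq_trans (size_polyMleq _ _)) //.
have := sE _ j sx; have := sE _ i sy; lia.
Qed.

(** * Substitution of polynomials and its chain rule *)

Definition sub2 (X1 X2 : P2) p : P2 :=
  \sum_(i < size p) \sum_(j < size p`_i) cst2 p`_i`_j * X1 ^+ j * X2 ^+ i.
Lemma ev_sub2 X1 X2 p x : ev (sub2 X1 X2 p) x = ev p (ev X1 x, ev X2 x).
Proof.
rewrite [p in RHS]P2_sumE /sub2 !ev_sum; apply: eq_bigr => i _.
by rewrite !ev_sum; apply: eq_bigr => j _; rewrite !evM !evX !ev_cst ev_px ev_py.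
Qed.
Lemma deg2le_sub2 n X1 X2 p : deg2le 1 X1 -> deg2le 1 X2 -> deg2le n p ->
  deg2le n (sub2 X1 X2 p).
Proof.
move=> h1 h2; move: p; apply: deg2le_ind => [|p q hp hq|c i j hij].
- by have -> : sub2 X1 X2 0 = 0; [apply: ev_ext => x; rewrite ev_sub2 !ev0|exact: deg2le0].
- have -> : sub2 X1 X2 (p + q) = sub2 X1 X2 p + sub2 X1 X2 q; last exact: deg2leD.
  by apply: ev_ext => x; rewrite evD !ev_sub2 evD.
have -> : sub2 X1 X2 (cst2 c * px ^+ j * py ^+ i) = cst2 c * X1 ^+ j * X2 ^+ i.
  by apply: ev_ext => x; rewrite ev_sub2 !evM !evX !ev_cst ev_px ev_py.
apply: (@deg2le_sub (0 + j * 1 + i * 1)%N); first lia.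
by apply: deg2leM; [apply: deg2leM; [apply: deg2le_cst|apply: deg2leX]|apply: deg2leX].
Qed.
Lemma sub2D X1 X2 p q : sub2 X1 X2 (p + q) = sub2 X1 X2 p + sub2 X1 X2 q.
Proof. by apply: ev_ext => x; rewrite evD !ev_sub2 evD. Qed.
Lemma sub2M X1 X2 p q : sub2 X1 X2 (p * q) = sub2 X1 X2 p * sub2 X1 X2 q.
Proof. by apply: ev_ext => x; rewrite evM !ev_sub2 evM. Qed.
Lemma sub2_cst X1 X2 c : sub2 X1 X2 (cst2 c) = cst2 c.
Proof. by apply: ev_ext => x; rewrite ev_sub2 !ev_cst. Qed.
Lemma sub2_0 X1 X2 : sub2 X1 X2 0 = 0. Proof. by rewrite -cst20 sub2_cst. Qed.
Lemma sub2_1 X1 X2 : sub2 X1 X2 1 = 1. Proof. by rewrite -cst21 sub2_cst. Qed.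
Lemma dX_sub2 X1 X2 p : dX (sub2 X1 X2 p) =
  sub2 X1 X2 (dX p) * dX X1 + sub2 X1 X2 (dY p) * dX X2.
Proof.
move: p; apply: P2_ind => [c|||p q Hp Hq|p q Hp Hq].
- by rewrite sub2_cst !dX_cst dY_cst sub2_0 !mul0r addr0.
- rewrite dX_px dY_px sub2_0 sub2_1 mul0r addr0 mul1r; congr dX.
  by apply: ev_ext => x; rewrite ev_sub2 ev_px.
- rewrite dX_py dY_py sub2_0 sub2_1 mul0r add0r mul1r; congr dX.
  by apply: ev_ext => x; rewrite ev_sub2 ev_py.
- by rewrite sub2D !dXD dYD !sub2D Hp Hq; ring.
- by rewrite sub2M !dXM dYM !sub2D !sub2M Hp Hq; ring.
Qed.
Lemma dY_sub2 X1 X2 p : dY (sub2 X1 X2 p) =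
  sub2 X1 X2 (dX p) * dY X1 + sub2 X1 X2 (dY p) * dY X2.
Proof.
move: p; apply: P2_ind => [c|||p q Hp Hq|p q Hp Hq].
- by rewrite sub2_cst dX_cst !dY_cst sub2_0 !mul0r addr0.
- rewrite dX_px dY_px sub2_0 sub2_1 mul0r addr0 mul1r; congr dY.
  by apply: ev_ext => x; rewrite ev_sub2 ev_px.
- rewrite dX_py dY_py sub2_0 sub2_1 mul0r add0r mul1r; congr dY.
  by apply: ev_ext => x; rewrite ev_sub2 ev_py.
- by rewrite sub2D dXD !dYD !sub2D Hp Hq; ring.
- by rewrite sub2M dXM !dYM !sub2D !sub2M Hp Hq; ring.
Qed.

End Poly2.

(** * Integration over triangles *)

Section Meas.
Variable R : realType.
Notation P2 := (P2 R).
Notation pt := (pt R).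
Notation mu := (@lebesgue_measure R).
Notation mu2 := (@mu2 R).
Implicit Types (p q G : P2) (z : pt) (a b c : pt) (D : set pt).

(** * Lebesgue integrals of polynomials *)

Lemma integral_poly (p : {poly R}) (a b : R) : a <= b ->
  (\int[mu]_(x in `[a, b]) (p.[x])%:E = ((prim p).[b] - (prim p).[a])%:E)%E.
Proof.
rewrite le_eqVlt => /orP[/eqP <-|ab].
  by rewrite set_itv1 integral_set1 subrr.
rewrite (@continuous_FTC2 _ (horner p) (horner (prim p))) //.
- by apply: continuous_subspaceT => x; exact: continuous_horner.
- split.
  + by move=> x _; exact: derivable_horner.
  + by apply: cvg_at_right_filter; exact: continuous_horner.
  + by apply: cvg_at_left_filter; exact: continuous_horner.
- by move=> x _; rewrite -derivE deriv_prim.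
Qed.

Lemma intF_J (F : edge R) (g : pt -> R) (p : {poly R}) :
  (forall t, g (seg_pt F t) = p.[t]) -> intF F g = pdist F.1 F.2 * J p.
Proof.
move=> h; rewrite /intF; congr (_ * _); rewrite /Rintegral.
under eq_integral do rewrite h.
by rewrite integral_poly ?ler01 //= prim0 subr0.
Qed.

Lemma measurable_ev p D : measurable_fun D (ev p).
Proof.
apply: measurable_funTS.
move: p; apply: P2_ind => [c|||p q Hp Hq|p q Hp Hq].
- by rewrite (_ : ev _ = cst c) //; apply/funext => z; rewrite ev_cst.
- by rewrite (_ : ev _ = fst) //; apply/funext => z; rewrite ev_px.
- by rewrite (_ : ev _ = snd) //; apply/funext => z; rewrite ev_py.
- rewrite (_ : ev _ = ev p \+ ev q); first exact: measurable_funD.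
  by apply/funext => z; rewrite evD.
- rewrite (_ : ev _ = ev p \* ev q); first exact: measurable_funM.
  by apply/funext => z; rewrite evM.
Qed.

Definition pbounded D := exists M, forall z, D z -> `|z.1| <= M /\ `|z.2| <= M.

Lemma ev_bounded p D : pbounded D -> exists C, forall z, D z -> `|ev p z| <= C.
Proof.
move=> [M hM]; move: p; apply: P2_ind => [c|||p q [C1 H1] [C2 H2]|p q [C1 H1] [C2 H2]].
- by exists `|c| => z _; rewrite ev_cst.
- by exists M => z /hM [? _]; rewrite ev_px.
- by exists M => z /hM [_ ?]; rewrite ev_py.
- by exists (C1 + C2) => z Dz; rewrite evD (le_trans (ler_normD _ _)) // lerD ?H1 ?H2.
- by exists (C1 * C2) => z Dz; rewrite evM normrM ler_pM ?normr_ge0 ?H1 ?H2.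
Qed.

Lemma pbounded_fin D : measurable D -> pbounded D -> (mu2 D < +oo)%E.
Proof.
move=> mD [M hM].
have mI : measurable (`[- M, M]%classic : set R) by exact: measurable_itv.
apply: (@le_lt_trans _ _ (mu2 (`[- M, M] `*` `[- M, M]))).
  apply: le_measure; rewrite ?inE //; first exact: measurableX.
  by move=> z /hM [h1 h2]; split; rewrite /= in_itv /= -ler_norml.
rewrite /mu2 product_measure1E //.
have fin : (mu (`[(- M)%R, M]%classic : set R) < +oo)%E.
  by rewrite lebesgue_measure_itv /=; case: ifP => _ //; rewrite -EFinD ltry.
by rewrite lte_mul_pinfty ?ge0_fin_numE ?measure_ge0.
Qed.

Lemma integrable_ev p D : measurable D -> pbounded D ->
  mu2.-integrable D (EFin \o ev p).
Proof.
move=> mD bD; apply: measurable_bounded_integrable => //.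
- exact: pbounded_fin.
- exact: measurable_ev.
have [C hC] := ev_bounded p bD; exists C; split; first exact: num_real.
by move=> M CM z Dz /=; rewrite (le_trans (hC z Dz)) // ltW.
Qed.

Lemma measurable_ge0 p : measurable [set z | 0 <= ev p z].
Proof.
have -> : [set z | 0 <= ev p z] = (ev p) @^-1` `[0, +oo[%classic.
  by apply/seteqP; split=> z /=; rewrite in_itv /= andbT.
by rewrite -[X in measurable X]setTI; apply: measurable_ev.
Qed.

(** Triangles given by three separate points, so that the vertices can be permuted freely when
    sorting them by abscissa. *)
Definition tri3 a b c : set pt := [set z | exists l m n : R,
  [/\ [/\ 0 <= l, 0 <= m & 0 <= n], l + m + n = 1, z.1 = l * a.1 + m * b.1 + n * c.1 &
   z.2 = l * a.2 + m * b.2 + n * c.2]].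
Definition cross3 a b c : R := pcross (psub b a) (psub c a).

Lemma tri3_rot a b c : tri3 b c a = tri3 a b c.
Proof.
apply/seteqP; split=> z [l [m [n [[h1 h2 h3] h4 h5 h6]]]].
  by exists n, l, m; split=> //; lra.
by exists m, n, l; split=> //; lra.
Qed.
Lemma tri3_swap a b c : tri3 a c b = tri3 a b c.
Proof.
by apply/seteqP; split=> z [l [m [n [[h1 h2 h3] h4 h5 h6]]]]; exists l, n, m; split=> //; lra.
Qed.

(** Cramer's rule: the three quotients are the barycentric coordinates of [z]. *)
Lemma tri3E a b c z : cross3 a b c != 0 ->
  tri3 a b c z <-> [/\ 0 <= cross3 z b c / cross3 a b c, 0 <= cross3 a z c / cross3 a b c
    & 0 <= cross3 a b z / cross3 a b c].
Proof.
move=> nz; split.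
  move=> [l [m [n [[h1 h2 h3] h4 h5 h6]]]].
  have le : l = 1 - m - n by lra.
  have -> : cross3 z b c = l * cross3 a b c.
    by rewrite /cross3 /pcross /psub /= h5 h6 le; ring.
  have -> : cross3 a z c = m * cross3 a b c.
    by rewrite /cross3 /pcross /psub /= h5 h6 le; ring.
  have -> : cross3 a b z = n * cross3 a b c.
    by rewrite /cross3 /pcross /psub /= h5 h6 le; ring.
  by rewrite !mulfK.
move=> [h1 h2 h3]; exists (cross3 z b c / cross3 a b c), (cross3 a z c / cross3 a b c), (cross3 a b z / cross3 a b c).
move: nz; rewrite /cross3 /pcross /psub /= => nz.
by split=> //; field.
Qed.

Lemma measurable_tri3 a b c : cross3 a b c != 0 -> measurable (tri3 a b c).
Proof.
move=> nz; set d := cross3 a b c.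
pose la := affP (pcross b c / d) ((b.2 - c.2) / d) ((c.1 - b.1) / d).
pose lb := affP (pcross c a / d) ((c.2 - a.2) / d) ((a.1 - c.1) / d).
pose lc := affP (pcross a b / d) ((a.2 - b.2) / d) ((b.1 - a.1) / d).
have -> : tri3 a b c = [set z | 0 <= ev la z] `&` [set z | 0 <= ev lb z] `&` [set z | 0 <= ev lc z].
  have e1 z : ev la z = cross3 z b c / d.
    by rewrite ev_aff /cross3 /pcross /psub /=; ring.
  have e2 z : ev lb z = cross3 a z c / d.
    by rewrite ev_aff /cross3 /pcross /psub /=; ring.
  have e3 z : ev lc z = cross3 a b z / d.
    by rewrite ev_aff /cross3 /pcross /psub /=; ring.
  apply/seteqP; split=> z.
    by move=> /(tri3E _ nz) [h1 h2 h3] /=; rewrite e1 e2 e3.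
  by move=> /= [[]]; rewrite e1 e2 e3 => h1 h2 h3; apply/(tri3E _ nz).
by apply: measurableI; [apply: measurableI|]; apply: measurable_ge0.
Qed.

Lemma pbounded_tri3 a b c : pbounded (tri3 a b c).
Proof.
exists (`|a.1| + `|b.1| + `|c.1| + (`|a.2| + `|b.2| + `|c.2|)) => z.
move=> [l [m [n [[h1 h2 h3] h4 h5 h6]]]].
have key (u v w : R) : `|l * u + m * v + n * w| <= `|u| + `|v| + `|w|.
  rewrite (le_trans (ler_normD _ _)) // lerD //.
    rewrite (le_trans (ler_normD _ _)) // lerD // normrM ger0_norm // ler_piMl //; lra.
  rewrite normrM ger0_norm // ler_piMl //; lra.
rewrite h5 h6; split; first by rewrite (le_trans (key _ _ _)) // lerDl !addr_ge0.
by rewrite (le_trans (key _ _ _)) // lerDr !addr_ge0.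
Qed.

Lemma integral_slice (x : R) (S : set R) (lo hi : R) G : lo <= hi ->
  (forall y : R, S y <-> lo <= y <= hi) ->
  (\int[mu]_(y in S) (ev (dY G) (x, y))%:E = (ev G (x, hi) - ev G (x, lo))%:E)%E.
Proof.
move=> lohi hS.
have -> : S = `[lo, hi]%classic by apply/seteqP; split=> y; rewrite /= in_itv /=; apply hS.
pose vx p := map_poly (horner_eval x) p.
have evv p y : ev p (x, y) = (vx p).[y].
  rewrite /ev /vx /= -{2}[y](hornerC y x).
  by rewrite -[_.[x]]/(horner_eval x _) -horner_map.
under eq_integral do rewrite evv.
have -> : vx (dY G) = (vx G)^`() by rewrite /vx deriv_map.
rewrite integral_poly // !evv; congr EFin.
have -> : prim (vx G)^`() = vx G - ((vx G)`_0)%:P.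
  apply/polyP => -[|i]; rewrite coef_prim coefB coefC /= ?coef_deriv.
    by rewrite invr0 mulr0 subrr.
  by rewrite -[X in X / _ = _]mulr_natr mulfK ?subr0 // pnatr_eq0.
by rewrite !hornerD !hornerN !hornerC; ring.
Qed.

(** The line through [a] and [b] as a graph over the first coordinate. When [a.1 = b.1] the slope is
    [0] by the convention for division; such a line only bounds an empty piece of the triangle. *)
Definition lineP a b : {poly R} :=
  (a.2 - a.1 * ((b.2 - a.2) / (b.1 - a.1)))%:P + ((b.2 - a.2) / (b.1 - a.1))%:P * 'X.
Lemma linePE a b (x : R) : (lineP a b).[x] = a.2 + (x - a.1) * ((b.2 - a.2) / (b.1 - a.1)).
Proof. by rewrite /lineP hornerD hornerM !hornerC hornerX; ring. Qed.

Lemma prim_line a b G : a.1 < b.1 ->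
  (prim (evs 'X (lineP a b) G)).[b.1] - (prim (evs 'X (lineP a b) G)).[a.1] =
  (b.1 - a.1) * J (segP (a, b) G).
Proof.
move=> ab; have nz : b.1 - a.1 != 0 by rewrite subr_eq0 gt_eqF.
have := J_comp_aff (evs 'X (lineP a b) G) a.1 (b.1 - a.1).
rewrite (addrC a.1) subrK => <-; rewrite mulrC; congr (_ * J _).
apply: horner_ext => t; rewrite horner_comp horner_evs segPE linePE !hornerE /seg_pt /=.
by congr ev; congr pair; rewrite ?[t * _]mulrC //; field.
Qed.


(** The line integral of [G dx] along the closed path [a], [b], [c]. *)
Definition circ a b c G : R :=
  (b.1 - a.1) * J (segP (a, b) G) + (c.1 - b.1) * J (segP (b, c) G) + (a.1 - c.1) * J (segP (c, a) G).

(** Treats both orientations of a triangle together: the slice is the segment from [l] to [m] if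
    [s = 1] and from [m] to [l] if [s = -1]. *)
Lemma slice_half (s : R) (x : R) (l m : R) G (S : set R) :
  (s = 1 \/ s = -1) -> 0 <= s * (m - l) ->
  (forall y : R, S y <-> 0 <= s * (y - l) /\ 0 <= s * (m - y)) ->
  (\int[mu]_(y in S) (ev (dY G) (x, y))%:E = (s * (ev G (x, m) - ev G (x, l)))%:E)%E.
Proof.
move=> [] -> hml hS.
  rewrite (@integral_slice x S l m) ?mul1r //; first by lra.
  by move=> y; rewrite hS; split=> [[? ?]|/andP[? ?]]; [apply/andP; split|split]; lra.
rewrite (@integral_slice x S m l) //; [|by lra|].
  by congr EFin; ring.
by move=> y; rewrite hS; split=> [[? ?]|/andP[? ?]]; [apply/andP; split|split]; lra.
Qed.

(** To the left of [b] only the edges from [a] cut the slice: since [x <= b.1], nonnegativity of the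
    coordinate at [a] follows from that of the coordinate at [c]. *)
Lemma tri3_sliceL a b c (x y : R) : cross3 a b c != 0 -> a.1 < b.1 -> b.1 <= c.1 ->
  a.1 <= x <= b.1 ->
  tri3 a b c (x, y) <->
   0 <= Num.sg (cross3 a b c) * (y - (lineP a b).[x]) /\
   0 <= Num.sg (cross3 a b c) * ((lineP a c).[x] - y).
Proof.
move=> nz ab bc /andP[ax xb]; rewrite !linePE.
have ba0 : b.1 - a.1 != 0 by rewrite subr_eq0 gt_eqF.
have ca0 : c.1 - a.1 != 0 by rewrite subr_eq0 gt_eqF // (lt_le_trans ab).
have gba : 0 < b.1 - a.1 by rewrite subr_gt0.
have gca : 0 < c.1 - a.1 by rewrite subr_gt0 (lt_le_trans ab).
rewrite (tri3E _ nz); set d := cross3 a b c in nz *.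
have eL : y - (a.2 + (x - a.1) * ((b.2 - a.2) / (b.1 - a.1))) = cross3 a b (x, y) / (b.1 - a.1).
  by rewrite /cross3 /pcross /psub /=; field.
have eM : a.2 + (x - a.1) * ((c.2 - a.2) / (c.1 - a.1)) - y = cross3 a (x, y) c / (c.1 - a.1).
  by rewrite /cross3 /pcross /psub /=; field.
rewrite eL eM.
have sgd u : (0 <= u / d) = (0 <= Num.sg d * u).
  have dd : 0 < d ^+ 2 by rewrite exprn_even_gt0.
  have -> : u / d = (Num.sg d * u) * (`|d| / d ^+ 2).
    rewrite [in RHS](normrEsg d); have := sqr_sg d; rewrite nz /= => hs.
    by transitivity ((Num.sg d ^+ 2) * (u / d)); [rewrite hs mul1r|field].
  have pos : 0 < `|d| / d ^+ 2 by apply: divr_gt0; rewrite // normr_gt0.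
  by rewrite (pmulr_lge0 _ pos).
rewrite -invr_gt0 in gca; have giba := gba; rewrite -invr_gt0 in giba.
rewrite !sgd !mulrA (pmulr_lge0 _ giba) (pmulr_lge0 _ gca).
split=> [[h1 h2 h3] //|[h1 h2]]; split=> //; rewrite -sgd.
have e : (b.1 - a.1) * (cross3 (x, y) b c / d) = (b.1 - x) + cross3 a b (x, y) / d * (c.1 - b.1).
  by move: nz; rewrite /d /cross3 /pcross /psub /= => nz; field.
rewrite -(pmulr_rge0 _ gba) e addr_ge0 ?subr_ge0 // mulr_ge0 ?subr_ge0 //.
by rewrite sgd.
Qed.

(** Mirror image of [tri3_sliceL]: to the right of [b] the coordinate at [c] is nonnegative as soon
    as the one at [a] is. *)
Lemma tri3_sliceR a b c (x y : R) : cross3 a b c != 0 -> a.1 <= b.1 -> b.1 < c.1 ->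
  b.1 <= x <= c.1 ->
  tri3 a b c (x, y) <->
   0 <= Num.sg (cross3 a b c) * (y - (lineP b c).[x]) /\
   0 <= Num.sg (cross3 a b c) * ((lineP a c).[x] - y).
Proof.
move=> nz ab bc /andP[ax xb]; rewrite !linePE.
have ba0 : c.1 - b.1 != 0 by rewrite subr_eq0 gt_eqF.
have ca0 : c.1 - a.1 != 0 by rewrite subr_eq0 gt_eqF // (le_lt_trans ab).
have gba : 0 < c.1 - b.1 by rewrite subr_gt0.
have gca : 0 < c.1 - a.1 by rewrite subr_gt0 (le_lt_trans ab).
rewrite (tri3E _ nz); set d := cross3 a b c in nz *.
have eL : y - (b.2 + (x - b.1) * ((c.2 - b.2) / (c.1 - b.1))) = cross3 (x, y) b c / (c.1 - b.1).
  by rewrite /cross3 /pcross /psub /=; field.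
have eM : a.2 + (x - a.1) * ((c.2 - a.2) / (c.1 - a.1)) - y = cross3 a (x, y) c / (c.1 - a.1).
  by rewrite /cross3 /pcross /psub /=; field.
rewrite eL eM.
have sgd u : (0 <= u / d) = (0 <= Num.sg d * u).
  have dd : 0 < d ^+ 2 by rewrite exprn_even_gt0.
  have -> : u / d = (Num.sg d * u) * (`|d| / d ^+ 2).
    rewrite [in RHS](normrEsg d); have := sqr_sg d; rewrite nz /= => hs.
    by transitivity ((Num.sg d ^+ 2) * (u / d)); [rewrite hs mul1r|field].
  have pos : 0 < `|d| / d ^+ 2 by apply: divr_gt0; rewrite // normr_gt0.
  by rewrite (pmulr_lge0 _ pos).
rewrite -invr_gt0 in gca; have giba := gba; rewrite -invr_gt0 in giba.
rewrite !sgd !mulrA (pmulr_lge0 _ giba) (pmulr_lge0 _ gca).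
split=> [[h1 h2 h3] //|[h1 h2]]; split=> //; rewrite -sgd.
have e : (c.1 - b.1) * (cross3 a b (x, y) / d) = (x - b.1) + cross3 (x, y) b c / d * (b.1 - a.1).
  by move: nz; rewrite /d /cross3 /pcross /psub /= => nz; field.
rewrite -(pmulr_rge0 _ gba) e addr_ge0 ?subr_ge0 // mulr_ge0 ?subr_ge0 //.
by rewrite sgd.
Qed.

Lemma integral_tri3_fubini a b c p : cross3 a b c != 0 ->
  (\int[mu2]_(z in tri3 a b c) (ev p z)%:E =
   \int[mu]_x \int[mu]_(y in [set y | tri3 a b c (x, y)]) (ev p (x, y))%:E)%E.
Proof.
move=> nz; rewrite integral_mkcond -integral12_prod_meas1; last first.
  by rewrite -integrable_mkcond; [apply: integrable_ev; [exact: measurable_tri3|exact: pbounded_tri3]|exact: measurable_tri3].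
apply: eq_integral => x _; rewrite /fubini_F [RHS]integral_mkcond.
apply: eq_integral => y _; rewrite /patch.
have -> // : ((x, y) \in tri3 a b c) = (y \in [set y | tri3 a b c (x, y)]).
by apply/idP/idP; rewrite !inE.
Qed.

(** The formulas for [g] are assumed only on pieces of positive length, because the middle vertex of
    a triangle may share its abscissa with either of the other two. *)
Lemma integral_two_pieces (g : R -> \bar R) (al be ga : R) (p q : {poly R}) :
  al <= be -> be <= ga ->
  (forall x, ~~ (al <= x <= ga) -> g x = 0%E) ->
  (al < be -> forall x, al <= x <= be -> g x = (p.[x])%:E) ->
  (be < ga -> forall x, be <= x <= ga -> g x = (q.[x])%:E) ->
  al < ga ->
  (\int[mu]_x g x = (((prim p).[be] - (prim p).[al]) + ((prim q).[ga] - (prim q).[be]))%:E)%E.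
Proof.
move=> ab bg g0 gp gq ag.
have intp (r : {poly R}) (A : set R) (u v : R) : measurable A -> A `<=` `[u, v] ->
    mu.-integrable A (EFin \o horner r).
  move=> mA AI.
  have H : mu.-integrable `[u, v] (EFin \o horner r).
    apply: continuous_compact_integrable; first exact: segment_compact.
    by apply: continuous_subspaceT => x; exact: continuous_horner.
  by apply: integrableS H => //; exact: measurable_itv.
have [abE|ab'] := eqVneq al be.
  have bg' : be < ga by rewrite -abE.
  rewrite abE subrr add0r -integral_poly // [RHS]integral_mkcond.
  apply: eq_integral => x _; rewrite /patch mem_setE /= in_itv /=.
  by case: ifP => h; [rewrite gq|rewrite g0 // abE h].
have {}ab' : al < be by rewrite lt_neqAle ab' ab.
(* Half open, so that the two pieces are disjoint and [g] is the sum of its restrictions. *)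
pose B : set R := `]be, ga]%classic.
transitivity (\int[mu]_x (((EFin \o horner p) \_ `[al, be]) x + ((EFin \o horner q) \_ B) x))%E.
  apply: eq_integral => x _; rewrite /patch /B !mem_setE /= !in_itv /=.
  have [h1|h1] := boolP (al <= x <= be).
    rewrite (gp ab' _ h1); case: ifP => h2; last by rewrite adde0.
    by move/andP: h2 => [h2 _]; move: h1; rewrite [x <= be]leNgt h2 andbF.
  rewrite add0e; case: ifP => h2.
    have /andP[h3 h4] := h2.
    by rewrite gq ?(ltW h3) ?h4 // (lt_le_trans h3).
  rewrite g0 //; apply/negP => /andP[h3 h4].
  move: h1 h2; rewrite h3 h4 /= andbT -ltNge => ->.
  by [].
rewrite integralD //=; last 2 first.
- rewrite -integrable_mkcond; last exact: measurable_itv.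
  by apply: (intp p _ al be) => //; exact: measurable_itv.
- rewrite -integrable_mkcond; last exact: measurable_itv.
  by apply: (intp q _ be ga); [exact: measurable_itv|exact: subset_itv_oc_cc].
rewrite -!integral_mkcond /B integral_itv_obnd_cbnd; last first.
  by apply/measurable_EFinP; apply: measurable_poly.
by rewrite !integral_poly.
Qed.

(** By Fubini and the fundamental theorem on slices, which run between the long edge [a c] and the
    broken line [a b c]; integrating the end values over the abscissa gives the three edge terms. *)
Lemma integral_tri3_sorted a b c G : cross3 a b c != 0 -> a.1 <= b.1 -> b.1 <= c.1 ->
  (\int[mu2]_(z in tri3 a b c) (ev (dY G) z)%:E =
   (- Num.sg (cross3 a b c) * circ a b c G)%:E)%E.
Proof.
move=> nz ab bc.
have ac : a.1 < c.1.
  rewrite lt_neqAle (le_trans ab bc) andbT; apply: contraNneq nz => e.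
  have e2 : b.1 = a.1 by apply/le_anti; rewrite ab {1}e bc.
  by rewrite /cross3 /pcross /psub /= -e e2 !subrr !mul0r mulr0 subrr.
set s := Num.sg (cross3 a b c).
have s1 : s = 1 \/ s = -1.
  by rewrite /s; case: sgrP nz => // _ _; [left|right].
pose M := lineP a c.
pose r1 := s%:P * (evs 'X M G - evs 'X (lineP a b) G).
pose r2 := s%:P * (evs 'X M G - evs 'X (lineP b c) G).
rewrite integral_tri3_fubini //.
rewrite (@integral_two_pieces _ a.1 b.1 c.1 r1 r2) //.
- have primB (r t : {poly R}) x : (prim (s%:P * (r - t))).[x] = s * ((prim r).[x] - (prim t).[x]).
    have -> : prim (s%:P * (r - t)) = s%:P * (prim r - prim t).
      apply/polyP => i; rewrite coef_prim !coefCM !coefB !coef_prim; ring.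
    by rewrite !hornerE.
  have Mint : (prim (evs 'X M G)).[c.1] - (prim (evs 'X M G)).[a.1] = (c.1 - a.1) * J (segP (a, c) G).
    exact: prim_line.
  have Jca : J (segP (c, a) G) = J (segP (a, c) G) by rewrite segP_rev J_rev.
  have Lint (u v : pt) : u.1 <= v.1 ->
     (prim (evs 'X (lineP u v) G)).[v.1] - (prim (evs 'X (lineP u v) G)).[u.1] = (v.1 - u.1) * J (segP (u, v) G).
    rewrite le_eqVlt => /orP[/eqP->|]; first by rewrite !subrr mul0r.
    exact: prim_line.
  have L1 := Lint _ _ ab; have L2 := Lint _ _ bc.
  rewrite !primB /circ Jca; congr EFin.
  set X1 := (prim (evs 'X (lineP a b) G)).[b.1] in L1 *.
  set X2 := (prim (evs 'X (lineP b c) G)).[c.1] in L2 *.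
  rewrite -L1 -L2 (_ : (a.1 - c.1) * J (segP (a, c) G) = - ((c.1 - a.1) * J (segP (a, c) G))); last by ring.
  rewrite -Mint; ring.
- move=> x hx; rewrite (_ : [set y | _] = set0) ?integral_set0 //.
  apply/seteqP; split=> y //= [l [m [n [[h1 h2 h3] h4 /= h5 _]]]].
  move/negP: hx; apply; rewrite h5; apply/andP; split; nra.
- move=> ab' x hx; rewrite /r1 hornerM hornerC hornerD hornerN !horner_evs hornerX.
  have e y : [set y | tri3 a b c (x, y)] y <-> 0 <= s * (y - (lineP a b).[x]) /\ 0 <= s * (M.[x] - y).
    exact: tri3_sliceL.
  apply: slice_half => //.
  (* The slice contains a point of the edge [a b]; adding the two inequalities that hold there
     orders the end points as [slice_half] requires. *)
  have [y [l [m [n [h1 h2 h3 h4]]]]] : exists y, tri3 a b c (x, y).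
    pose t := (x - a.1) / (b.1 - a.1).
    have gba : 0 < b.1 - a.1 by rewrite subr_gt0.
    have t0 : 0 <= t by rewrite divr_ge0 ?subr_ge0 ?(ltW ab') //; case/andP: hx.
    have t1 : t <= 1 by rewrite ler_pdivrMr // mul1r lerD2r; case/andP: hx.
    exists (a.2 + t * (b.2 - a.2)), (1 - t), t, 0; split=> /=; [split; lra|ring| |ring].
    by rewrite /t mul0r addr0; field; rewrite gt_eqF.
  have /e [] : tri3 a b c (x, y) by exists l, m, n.
  lra.
- move=> ab' x hx; rewrite /r2 hornerM hornerC hornerD hornerN !horner_evs hornerX.
  have e y : [set y | tri3 a b c (x, y)] y <-> 0 <= s * (y - (lineP b c).[x]) /\ 0 <= s * (M.[x] - y).
    exact: tri3_sliceR.
  apply: slice_half => //.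
  have [y [l [m [n [h1 h2 h3 h4]]]]] : exists y, tri3 a b c (x, y).
    pose t := (x - b.1) / (c.1 - b.1).
    have gba : 0 < c.1 - b.1 by rewrite subr_gt0.
    have t0 : 0 <= t by rewrite divr_ge0 ?subr_ge0 ?(ltW ab') //; case/andP: hx.
    have t1 : t <= 1 by rewrite ler_pdivrMr // mul1r lerD2r; case/andP: hx.
    exists (b.2 + t * (c.2 - b.2)), 0, (1 - t), t; split=> /=; [split; lra|ring| |ring].
    by rewrite /t mul0r add0r; field; rewrite gt_eqF.
  have /e [] : tri3 a b c (x, y) by exists l, m, n.
  lra.
Qed.

Lemma cross3_rot a b c : cross3 b c a = cross3 a b c.
Proof. by rewrite /cross3 /pcross /psub /=; ring. Qed.
Lemma cross3_swap a b c : cross3 a c b = - cross3 a b c.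
Proof. by rewrite /cross3 /pcross /psub /=; ring. Qed.
Lemma circ_rot a b c G : circ b c a G = circ a b c G.
Proof. by rewrite /circ; ring. Qed.
Lemma circ_swap a b c G : circ a c b G = - circ a b c G.
Proof.
rewrite /circ (segP_rev c b) (segP_rev b a) (segP_rev a c) !J_rev; ring.
Qed.

(** A transposition of vertices changes the sign of both [cross3] and [circ], and a rotation of
    neither, so the formula does not depend on the order and the sorted case suffices. *)
Lemma integral_tri3 a b c G : cross3 a b c != 0 ->
  (\int[mu2]_(z in tri3 a b c) (ev (dY G) z)%:E =
   (- Num.sg (cross3 a b c) * circ a b c G)%:E)%E.
Proof.
have rot u v w : (cross3 u v w != 0 -> (\int[mu2]_(z in tri3 u v w) (ev (dY G) z)%:E =
   (- Num.sg (cross3 u v w) * circ u v w G)%:E)%E) ->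
   (cross3 v w u != 0 -> (\int[mu2]_(z in tri3 v w u) (ev (dY G) z)%:E =
   (- Num.sg (cross3 v w u) * circ v w u G)%:E)%E).
  by rewrite (tri3_rot u v w) (cross3_rot u v w) (circ_rot u v w).
have swap u v w : (cross3 u v w != 0 -> (\int[mu2]_(z in tri3 u v w) (ev (dY G) z)%:E =
   (- Num.sg (cross3 u v w) * circ u v w G)%:E)%E) ->
   (cross3 u w v != 0 -> (\int[mu2]_(z in tri3 u w v) (ev (dY G) z)%:E =
   (- Num.sg (cross3 u w v) * circ u w v G)%:E)%E).
  rewrite (tri3_swap u v w) (cross3_swap u v w) (circ_swap u v w) oppr_eq0 sgrN => h nz.
  by rewrite h //; congr EFin; ring.
have sorted := integral_tri3_sorted.
have [ab|ba] := leP a.1 b.1; have [bc|cb] := leP b.1 c.1; have [ac|ca] := leP a.1 c.1.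
- by move=> nz; apply: sorted.
- by move=> nz; apply: sorted.
- by apply: (swap a c b) => nz; apply: sorted => //; apply: ltW.
- by apply: (rot c a b) => nz; apply: sorted => //; apply: ltW.
- apply: (rot c a b); apply: (rot b c a); apply: (swap b a c) => nz.
  by apply: sorted => //; apply: ltW.
- apply: (rot c a b); apply: (rot b c a) => nz.
  by apply: sorted => //; apply: ltW.
- by have := lt_trans cb ba; rewrite ltNge ac.
- apply: (rot c a b); apply: (swap c b a) => nz.
  by apply: sorted => //; apply: ltW.
Qed.

End Meas.

(** * Change of variables and scaling on triangles *)

Lemma I3_ind (P : 'I_3 -> Prop) : P 0 -> P 1 -> P 2 -> forall i, P i.
Proof.
move=> h0 h1 h2 [[|[|[|//]]] hi].
- by rewrite (_ : Ordinal hi = 0) //; apply/val_inj.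
- by rewrite (_ : Ordinal hi = 1) //; apply/val_inj.
- by rewrite (_ : Ordinal hi = 2) //; apply/val_inj.
Qed.
Lemma nx_0 : nx 0 = 1. Proof. by apply/val_inj; rewrite /nx /= inordK. Qed.
Lemma nx_1 : nx 1 = 2. Proof. by apply/val_inj; rewrite /nx /= inordK. Qed.
Lemma nx_2 : nx 2 = 0. Proof. by apply/val_inj; rewrite /nx /= inordK. Qed.
Lemma nx2_0 : nx2 0 = 2. Proof. by apply/val_inj; rewrite /nx2 /= inordK. Qed.
Lemma nx2_1 : nx2 1 = 0. Proof. by apply/val_inj; rewrite /nx2 /= inordK. Qed.
Lemma nx2_2 : nx2 2 = 1. Proof. by apply/val_inj; rewrite /nx2 /= inordK. Qed.
Definition nxE := (nx_0, nx_1, nx_2, nx2_0, nx2_1, nx2_2).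
Lemma sum3 (V : nmodType) (F : 'I_3 -> V) : \sum_(i < 3) F i = F 0 + F 1 + F 2.
Proof.
rewrite !big_ord_recl big_ord0 addr0 addrA; congr (F _ + F _ + F _); exact/val_inj.
Qed.

Section Triangle.
Variable R : realType.
Notation P2 := (P2 R).
Notation pt := (pt R).
Notation tri := (tri R).
Notation mu2 := (@mu2 R).
Implicit Types (p q G f u w : P2) (z : pt) (K : tri).

Definition crossK K : R := cross3 (K 0) (K 1) (K 2).
Lemma nondegE K : nondeg K = (crossK K != 0). Proof. by []. Qed.
Lemma closedTri3 K : closedTri K = tri3 (K 0) (K 1) (K 2).
Proof.
apply/seteqP; split=> z.
  move=> [l [l0 l1 ->]]; exists (l 0), (l 1), (l 2).
  by rewrite -sum3 l1 /= !sum3; split.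
move=> [l [m [n [[h1 h2 h3] h4 h5 h6]]]].
exists (fun i : 'I_3 => if i == 0 then l else if i == 1 then m else n); split.
- by apply: I3_ind.
- by rewrite sum3.
- by rewrite [z]surjective_pairing /bary_comb !sum3 h5 h6.
Qed.

Definition IK K p : R := intK (closedTri K) (ev p).

Lemma measurable_tri K : nondeg K -> measurable (closedTri K).
Proof. by rewrite closedTri3 => ?; apply: measurable_tri3. Qed.
Lemma integrable_tri K p : nondeg K -> mu2.-integrable (closedTri K) (EFin \o ev p).
Proof.
move=> nK; apply: integrable_ev; first exact: measurable_tri.
by rewrite closedTri3; apply: pbounded_tri3.
Qed.

Lemma IK_ext K (f : pt -> R) p : (forall z, f z = ev p z) -> intK (closedTri K) f = IK K p.
Proof. by move=> h; rewrite (_ : f = ev p) //; apply/funext. Qed.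
Lemma IKD K p q : nondeg K -> IK K (p + q) = IK K p + IK K q.
Proof.
move=> nK; rewrite -(@IK_ext _ (fun z => ev p z + ev q z)); last by move=> z; rewrite evD.
by rewrite /intK RintegralD //; [exact: measurable_tri| exact: integrable_tri..].
Qed.
Lemma IKZ K c p : nondeg K -> IK K (cst2 c * p) = c * IK K p.
Proof.
move=> nK; rewrite -(@IK_ext _ (fun z => c * ev p z)); last by move=> z; rewrite evM ev_cst.
by rewrite /intK RintegralZl //; [exact: measurable_tri| exact: integrable_tri..].
Qed.
Lemma IK0 K : nondeg K -> IK K 0 = 0.
Proof. by move=> nK; rewrite -(mul0r 0) -cst20 IKZ // mul0r. Qed.
Lemma IKN K p : nondeg K -> IK K (- p) = - IK K p.
Proof. by move=> nK; rewrite -mulN1r -cst21 -cst2N IKZ // mulN1r. Qed.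
Lemma IKB K p q : nondeg K -> IK K (p - q) = IK K p - IK K q.
Proof. by move=> nK; rewrite IKD // IKN. Qed.
Lemma IK_ge0 K p : (forall z, closedTri K z -> 0 <= ev p z) -> 0 <= IK K p.
Proof. by move=> h; rewrite /IK /intK; apply: Rintegral_ge0. Qed.
Lemma IK_sqr_ge0 K p : 0 <= IK K (p ^+ 2).
Proof. by apply: IK_ge0 => z _; rewrite evX sqr_ge0. Qed.
Lemma IK_le K p q : nondeg K -> (forall z, closedTri K z -> ev p z <= ev q z) ->
  IK K p <= IK K q.
Proof. by move=> nK h; rewrite -subr_ge0 -IKB //; apply: IK_ge0 => z /h; rewrite evB subr_ge0. Qed.

Lemma IK_dY K G : nondeg K ->
  IK K (dY G) = - Num.sg (crossK K) * circ (K 0) (K 1) (K 2) G.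
Proof. by move=> nK; rewrite /IK /intK /Rintegral closedTri3 integral_tri3. Qed.

Definition circY (a b c : pt) G : R :=
  (b.2 - a.2) * J (segP (a, b) G) + (c.2 - b.2) * J (segP (b, c) G) + (a.2 - c.2) * J (segP (c, a) G).

(** The exact form [dG] integrates to zero along a closed path. *)
Lemma circ_grad (a b c : pt) G : circ a b c (dX G) + circY a b c (dY G) = 0.
Proof.
have e (u v : pt) : (v.1 - u.1) * J (segP (u, v) (dX G)) + (v.2 - u.2) * J (segP (u, v) (dY G)) =
    ev G v - ev G u.
  have := J_deriv (segP (u, v) G); rewrite segP_deriv /= !mul_polyC JD !JZ => ->.
  rewrite !segPE /seg_pt /= !mul0r !mul1r !addr0 (addrC u.1) (addrC u.2) !subrK.
  by rewrite -!surjective_pairing.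
rewrite /circ /circY.
have := e a b; have := e b c; have := e c a; lra.
Qed.

(** With [G = dY H] the integrand is [dY (dX H)]; [circ_grad] turns the resulting integral of [dX H]
    along the boundary into one of [G dy]. No second Fubini argument with exchanged coordinates
    arises. *)
Lemma IK_dX K G : nondeg K ->
  IK K (dX G) = Num.sg (crossK K) * circY (K 0) (K 1) (K 2) G.
Proof.
move=> nK; have [H <-] := dY_surj G.
rewrite dXdY IK_dY // mulNr -mulrN; congr (_ * _).
by have := circ_grad (K 0) (K 1) (K 2) H => /eqP; rewrite addr_eq0 => /eqP ->; rewrite opprK.
Qed.

(** * The reference triangle and the affine maps to it *)

Definition Kr : tri := [ffun i : 'I_3 => if i == 0 then (0, 0) else if i == 1 then (1, 0) else (0, 1)].
Lemma Kr0 : Kr 0 = (0, 0). Proof. by rewrite ffunE. Qed.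
Lemma Kr1 : Kr 1 = (1, 0). Proof. by rewrite ffunE. Qed.
Lemma Kr2 : Kr 2 = (0, 1). Proof. by rewrite ffunE. Qed.
Lemma crossKr : crossK Kr = 1.
Proof. by rewrite /crossK Kr0 Kr1 Kr2 /cross3 /pcross /psub /=; ring. Qed.
Lemma nondeg_Kr : nondeg Kr. Proof. by rewrite nondegE crossKr oner_eq0. Qed.
Hint Resolve nondeg_Kr : core.
Lemma closedKr z : closedTri Kr z <-> [/\ 0 <= z.1, 0 <= z.2 & z.1 + z.2 <= 1].
Proof.
rewrite closedTri3 tri3E; last by rewrite -/(crossK Kr) crossKr oner_eq0.
rewrite -/(crossK Kr) crossKr Kr0 Kr1 Kr2 /cross3 /pcross /psub /=.
by split=> [[h1 h2 h3]|[h1 h2 h3]]; split; lra.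
Qed.

Lemma baryE K i z : nondeg K -> ev (baryP K i) z =
  pcross (psub (K (nx i)) z) (psub (K (nx2 i)) z) / crossK K.
Proof.
move=> nK; rewrite /baryP ev_aff.
have -> : pcross (psub (K (nx i)) (K i)) (psub (K (nx2 i)) (K i)) = crossK K.
  move: i; apply: I3_ind; rewrite !nxE /crossK /cross3 /pcross /psub /=; ring.
by rewrite /pcross /psub /=; ring.
Qed.
Lemma bary_sum K z : nondeg K -> \sum_(i < 3) ev (baryP K i) z = 1.
Proof.
move=> nK; rewrite sum3 !baryE // !nxE -!mulrDl; move: nK; rewrite nondegE /crossK.
by rewrite /cross3 /pcross /psub /= => nz; field.
Qed.
Lemma bary_pt K z : nondeg K -> bary_comb K (fun i => ev (baryP K i) z) = z.
Proof.
move=> nK; rewrite [RHS]surjective_pairing /bary_comb !sum3 !baryE // !nxE; move: nK; rewrite nondegE /crossK.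
by rewrite /cross3 /pcross /psub /= => nz; congr pair; field.
Qed.
Lemma bary_ev K l i : nondeg K -> \sum_(i < 3) l i = 1 -> ev (baryP K i) (bary_comb K l) = l i.
Proof.
move=> nK; rewrite baryE // /bary_comb !sum3 => hl.
have -> : l 0 = 1 - l 1 - l 2 by rewrite -hl; ring.
move: i; apply: I3_ind; rewrite !nxE; move: nK; rewrite nondegE /crossK;
 rewrite /cross3 /pcross /psub /= => nz.
- have -> : l 0 = 1 - l 1 - l 2 by rewrite -hl; ring.
  by field.
- by field.
- by field.
Qed.
Lemma closedTriP K z : nondeg K -> closedTri K z <-> (forall i, 0 <= ev (baryP K i) z).
Proof.
move=> nK; split=> [[l [l0 l1 ->]] i|h]; first by rewrite bary_ev.
by exists (fun i => ev (baryP K i) z); rewrite bary_sum // bary_pt.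
Qed.
Lemma openTriP K z : nondeg K -> openTri K z <-> (forall i, 0 < ev (baryP K i) z).
Proof.
move=> nK; split=> [[l [l0 l1 ->]] i|h]; first by rewrite bary_ev.
by exists (fun i => ev (baryP K i) z); rewrite bary_sum // bary_pt.
Qed.

(** Composition with the affine map from [K] to [Kr], whose components are the last two barycentric
    coordinates; [pull] composes with the inverse map. *)
Definition push K f : P2 := sub2 (baryP K 1) (baryP K 2) f.
Definition pull K f : P2 :=
  sub2 (affP (K 0).1 ((K 1).1 - (K 0).1) ((K 2).1 - (K 0).1))
       (affP (K 0).2 ((K 1).2 - (K 0).2) ((K 2).2 - (K 0).2)) f.
Lemma ev_push K f z : ev (push K f) z = ev f (ev (baryP K 1) z, ev (baryP K 2) z).
Proof. by rewrite /push ev_sub2. Qed.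
Lemma push_pull K f : nondeg K -> push K (pull K f) = f.
Proof.
move=> nK; apply: ev_ext => z; rewrite ev_push /pull ev_sub2 (ev_aff (K 0).1) (ev_aff (K 0).2) /=; congr ev.
rewrite -[RHS](bary_pt z nK) /bary_comb !sum3.
have -> : ev (baryP K 0) z = 1 - ev (baryP K 1) z - ev (baryP K 2) z.
  by rewrite -(bary_sum z nK) sum3; ring.
by congr pair; ring.
Qed.
Lemma deg2le_pull n K f : deg2le n f -> deg2le n (pull K f).
Proof. by apply: deg2le_sub2; apply: deg2le_aff. Qed.
Lemma deg2le_bary K i : deg2le 1 (baryP K i).
Proof. exact: deg2le_aff. Qed.

Lemma push_seg K i j f : nondeg K -> segP (K i, K j) (push K f) = segP (Kr i, Kr j) f.
Proof.
move=> nK; apply: horner_ext => t; rewrite !segPE ev_push; congr ev.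
have v i' j' : ev (baryP K j') (K i') = (j' == i')%:R.
  rewrite baryE //; move: nK; rewrite nondegE /crossK /cross3 /pcross /psub /= => nz.
  by move: i' j'; apply: I3_ind; apply: I3_ind; rewrite !nxE /=; field.
have aff l : ev (baryP K l) (seg_pt (K i, K j) t) = (1 - t) * (l == i)%:R + t * (l == j)%:R.
  by rewrite -!v /baryP !ev_aff /seg_pt /=; ring.
rewrite !aff /seg_pt /=.
have kr l : Kr l = ((1 == l)%:R, (2 == l)%:R).
  by move: l; apply: I3_ind; rewrite ?Kr0 ?Kr1 ?Kr2.
by rewrite !kr /=; congr pair; ring.
Qed.

Lemma dX_bary K i : dX (baryP K i) = cst2 (((K (nx i)).2 - (K (nx2 i)).2) / pcross (psub (K (nx i)) (K i)) (psub (K (nx2 i)) (K i))).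
Proof. by rewrite /baryP dX_aff. Qed.
Lemma dY_bary K i : dY (baryP K i) = cst2 (- ((K (nx i)).1 - (K (nx2 i)).1) / pcross (psub (K (nx i)) (K i)) (psub (K (nx2 i)) (K i))).
Proof. by rewrite /baryP dY_aff. Qed.

Lemma crossK_cyc K i : pcross (psub (K (nx i)) (K i)) (psub (K (nx2 i)) (K i)) = crossK K.
Proof. move: i; apply: I3_ind; rewrite !nxE /crossK /cross3 /pcross /psub /=; ring. Qed.

Lemma grad_push K f : nondeg K ->
  dX (push K f) = push K (dX f) * cst2 (((K 2).2 - (K 0).2) / crossK K) +
     push K (dY f) * cst2 (((K 0).2 - (K 1).2) / crossK K) /\
  dY (push K f) = push K (dX f) * cst2 (((K 0).1 - (K 2).1) / crossK K) +
     push K (dY f) * cst2 (((K 1).1 - (K 0).1) / crossK K).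
Proof.
move=> nK; split.
  by rewrite /push dX_sub2 !dX_bary !crossK_cyc !nxE.
by rewrite /push dY_sub2 !dY_bary !crossK_cyc !nxE !opprB.
Qed.

(* The change of variables formula is read off from Green's formula on both
   triangles, in the direction [K 2 - K 0] that pulls back to [d/dy]. *)
Lemma IK_push K f : nondeg K -> IK K (push K f) = `|crossK K| * IK Kr f.
Proof.
move=> nK; have [G <-] := dY_surj f.
have [eX eY] := grad_push G nK.
have -> : push K (dY G) = cst2 ((K 2).1 - (K 0).1) * dX (push K G) + cst2 ((K 2).2 - (K 0).2) * dY (push K G).
  apply: ev_ext => z; rewrite eX eY !evD !evM !evD !evM !ev_cst; move: nK.
  by rewrite nondegE /crossK /cross3 /pcross /psub /= => nz; field.
rewrite IKD // !IKZ // IK_dX // !IK_dY // crossKr sgr1 /circY /circ !push_seg //.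
rewrite Kr0 Kr1 Kr2 /= normrEsg.
set s := Num.sg _; rewrite /crossK /cross3 /pcross /psub /=.
ring.
Qed.

Lemma IKr_dY G : IK Kr (dY G) = J (evs 'X (1 - 'X) G - evs 'X 0 G).
Proof.
rewrite IK_dY // crossKr sgr1 /circ Kr0 Kr1 Kr2 /= JB.
have -> : evs 'X 0 G = segP ((0, 0), (1, 0)) G.
  by apply: horner_ext => t; rewrite segPE horner_evs hornerX horner0 /seg_pt /=; congr ev; congr pair; ring.
have -> : evs 'X (1 - 'X) G = segP ((0, 1), (1, 0)) G.
  apply: horner_ext => t; rewrite segPE horner_evs hornerD hornerN hornerX hornerC /seg_pt /=.
  by congr ev; congr pair; ring.
by rewrite (segP_rev (0, 1)) J_rev; ring.
Qed.

Definition vsl (x : R) p : {poly R} := map_poly (horner_eval x) p.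
Lemma vslE x p y : (vsl x p).[y] = ev p (x, y).
Proof.
rewrite /ev /vsl /= -[RHS]/(horner_eval x p.[y%:P]) -horner_map /=.
by rewrite /horner_eval hornerC.
Qed.
Lemma vsl_dY x p : vsl x (dY p) = (vsl x p)^`(). Proof. by rewrite /vsl deriv_map. Qed.

(** One-dimensional definiteness, twice: the slice integrals [H] are nonnegative with integral zero,
    hence vanish identically, and then each slice of the integrand vanishes. *)
Lemma IKr_eq0 f : (forall z, closedTri Kr z -> 0 <= ev f z) -> IK Kr f = 0 -> f = 0.
Proof.
have [G <-] := dY_surj f => fge0; rewrite IKr_dY.
set H := (X in J X).
have HE s : H.[s] = (vsl s G).[1 - s] - (vsl s G).[0].
  by rewrite !vslE hornerD hornerN !horner_evs hornerD hornerN hornerX hornerC horner0.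
have dge0 s : 0 <= s <= 1 -> forall y, 0 <= y <= 1 - s -> 0 <= ((vsl s G)^`()).[y].
  move=> /andP[s0 s1] y /andP[y0 y1]; rewrite -vsl_dY vslE; apply: fge0.
  by apply/closedKr; split=> //=; lra.
have Hge0 s : 0 <= s <= 1 -> 0 <= H.[s].
  move=> hs; rewrite HE subr_ge0; apply: (@ler_hornerW _ 0 (1 - s)).
  - move=> y; rewrite in_itv /= => /andP[y0 y1]; apply: dge0 => //; rewrite !ltW //.
  - by rewrite in_itv /= lexx /=; lra.
  - by rewrite in_itv /= lexx andbT; lra.
  - by lra.
move=> /(J_eq0 Hge0) H0.
(* Abscissae up to [1 / 2] keep the slices nondegenerate. A slice that vanishes as a polynomial does
   so at every ordinate, which covers the points of the rectangle outside the triangle. *)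
apply: (@ev_eq0_rect _ 0 (1 / 2) 0 1); [lra|lra|] => z hz1 _.
rewrite [z]surjective_pairing -vslE vsl_dY.
have -> : (vsl z.1 G)^`() = 0; last by rewrite horner0.
apply: (@deriv_ge0_const _ 0 (1 - z.1)); first lra.
  by apply: dge0; lra.
by apply/eqP; rewrite -subr_eq0 -HE H0 horner0.
Qed.

(** * The bubble weight, norm equivalence and the inverse inequality *)

Definition bKr : P2 := px R * py R * (1 - px R - py R).
Lemma bKr_ge0 z : closedTri Kr z -> 0 <= ev bKr z <= 1.
Proof.
move/closedKr => [h1 h2 h3]; rewrite /bKr !evM !evB ev1 ev_px ev_py.
rewrite !mulr_ge0 //=; last lra.
rewrite mulr_ile1 ?mulr_ge0 ?mulr_ile1 //; lra.
Qed.

Lemma ev_le_coef n f M : deg2le n f -> (forall i j, `|f`_i`_j| <= M) ->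
  forall z, closedTri Kr z -> `|ev f z| <= n.+1%:R ^+ 2 * M.
Proof.
move=> df hM z /closedKr [z1 z2 z3].
have M0 : 0 <= M by rewrite (le_trans _ (hM 0%N 0%N)).
rewrite [f]P2_sumE ev_sum (le_trans (ler_norm_sum _ _ _)) //.
apply: (@le_trans _ _ (\sum_(i < size f) n.+1%:R * M)).
  apply: ler_sum => i _; rewrite ev_sum (le_trans (ler_norm_sum _ _ _)) //.
  apply: (@le_trans _ _ (\sum_(j < size f`_i) M)).
    apply: ler_sum => j _; rewrite !evM ev_cst !evX ev_px ev_py !normrM !normrX.
    rewrite (ger0_norm z1) (ger0_norm z2) -mulrA -[leRHS]mulr1 ler_pM ?mulr_ge0 ?exprn_ge0 //.
    rewrite mulr_ile1 ?exprn_ge0 // exprn_ile1 //; lra.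
  rewrite sumr_const card_ord -[leLHS]mulr_natl ler_wpM2r // ler_nat.
  by rewrite (leq_trans (deg2le_sizei i df)) // leq_subr.
rewrite sumr_const card_ord -[leLHS]mulr_natl expr2 -mulrA ler_wpM2r ?mulr_ge0 ?ler0n //.
by rewrite ler_nat deg2le_size.
Qed.

(** Gram bound for the form weighted by [bKr], which is still definite: [bKr] is a nonzero
    polynomial, nonnegative on [Kr], and the ring has no zero divisors. *)
Lemma Kr_coef_bound n : exists2 C, 0 < C & forall f, deg2le n f ->
  forall i j, f`_i`_j ^+ 2 <= C * IK Kr (bKr * f ^+ 2).
Proof.
(* A square box of exponents, larger than the degree bound requires but a product type. *)
pose X := ('I_n.+1 * 'I_n.+1)%type.
pose phi (k : 'I_#|{: X}|) : P2 := px R ^+ (enum_val k).2 * py R ^+ (enum_val k).1.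
pose F (a : P2) := IK Kr (bKr * a).
have iotaE c : (polyC \o polyC) c = cst2 c :> P2 by [].
have Fge0 (a : P2) : 0 <= F (a ^+ 2).
  by apply: IK_ge0 => z /bKr_ge0 /andP[hb _]; rewrite evM evX mulr_ge0 // sqr_ge0.
have bnz : bKr != 0.
  apply/eqP => h; have := congr1 (fun q => ev q (1 / 4, 1 / 4)) h.
  rewrite /= /bKr !evM !evB ev1 ev_px ev_py ev0 /=; lra.
have coefphi (c : 'I_#|{: X}| -> R) (x : X) :
   (\sum_k cst2 (c k) * phi k)`_(x.1)`_(x.2) = c (enum_rank x).
  rewrite !coef_sum (bigD1 (enum_rank x)) //= /phi enum_rankK.
  rewrite big1 ?addr0 => [|k kx].
    rewrite mulrA -rmorphXn /= /cst2 -polyCM coefCM coefXn eqxx mulr1 coefCM coefXn eqxx mulr1 //.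
  rewrite mulrA -rmorphXn /= /cst2 -polyCM coefCM coefXn.
  case: eqP => [e1|_]; last by rewrite mulr0 coef0.
  rewrite mulr1 coefCM coefXn; case: eqP => [e2|_]; last by rewrite mulr0.
  move/eqP: kx; case; apply: enum_val_inj; rewrite enum_rankK.
  by rewrite [RHS]surjective_pairing [LHS]surjective_pairing; congr pair; apply/val_inj.
have [||||C C0 hC] := @gram_coef_bound R P2 (polyC \o polyC) F #|{: X}| phi.
- by move=> a b; rewrite /F mulrDr IKD.
- by move=> c a; change (F (cst2 c * a) = c * F a); rewrite /F mulrCA IKZ.
- by move=> c; apply: Fge0.
- move=> c; move=> h0.
  have /eqP : bKr * (\sum_k cst2 (c k) * phi k) ^+ 2 = 0.
    by apply: IKr_eq0 => // z /bKr_ge0 /andP[hb _]; rewrite evM evX mulr_ge0 // sqr_ge0.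
  rewrite mulf_eq0 (negbTE bnz) sqrf_eq0 /= => /eqP h k.
  have := coefphi c (enum_val k); rewrite h enum_valK !coef0 => <- //.
exists C => // f df i j.
have fE : f = \sum_(k : 'I_#|{: X}|) cst2 (f`_((enum_val k).1)`_((enum_val k).2)) * phi k.
  apply/polyP => i'; apply/polyP => j'.
  have [ij|ij] := boolP ((i' < n.+1) && (j' < n.+1))%N.
    have /andP[hi hj] := ij.
    have := coefphi (fun k : 'I_#|{: X}| => f`_((enum_val k).1)`_((enum_val k).2)) (Ordinal hi, Ordinal hj).
    by rewrite /= enum_rankK /= => ->.
  have -> : f`_i'`_j' = 0.
    apply/eqP/negPn/negP => /df h; move/negP: ij; apply.
    by rewrite !ltnS (leq_trans _ h) ?leq_addr //= (leq_trans _ h) ?leq_addl.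
  rewrite !coef_sum big1 // => k _.
  rewrite /phi mulrA -rmorphXn /= /cst2 -polyCM coefCM coefXn.
  case: eqP => [e1|_]; last by rewrite mulr0 coef0.
  rewrite mulr1 coefCM coefXn; case: eqP => [e2|_]; last by rewrite mulr0.
  by move/negP: ij; case; rewrite e1 e2 !ltn_ord.
have [hij|hij] := boolP ((i < n.+1) && (j < n.+1))%N.
  have /andP[hi hj] := hij.
  have := hC (fun k : 'I_#|{: X}| => f`_((enum_val k).1)`_((enum_val k).2)) (enum_rank (Ordinal hi, Ordinal hj)).
  by rewrite enum_rankK /= -fE.
have -> : f`_i`_j = 0.
  apply/eqP/negPn/negP => /df h; move/negP: hij; apply.
  by rewrite !ltnS (leq_trans _ h) ?leq_addr //= (leq_trans _ h) ?leq_addl.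
by rewrite expr0n /= mulr_ge0 ?(ltW C0) //; apply: Fge0.
Qed.


(** Since [0 <= bKr <= 1] on [Kr], bounding by the weighted norm serves both the bubble estimate and
    the inverse inequality. *)
Lemma Kr_sup_bound n : exists2 C, 0 < C & forall f, deg2le n f ->
  forall z, closedTri Kr z ->
  [/\ ev f z ^+ 2 <= C * IK Kr (bKr * f ^+ 2),
      ev (dX f) z ^+ 2 <= C * IK Kr (bKr * f ^+ 2) &
      ev (dY f) z ^+ 2 <= C * IK Kr (bKr * f ^+ 2)].
Proof.
have [C C0 hC] := Kr_coef_bound n.
(* The square [n.+1 ^ 2] bounds the number of monomials; the further [n.+1] bounds the factor that
   differentiation puts on a coefficient. *)
exists (C * (n.+1%:R ^+ 2 * n.+1%:R) ^+ 2) => [|f df z Kz].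
  by rewrite mulr_gt0 // exprn_gt0 // mulr_gt0 ?exprn_gt0 ?ltr0n.
set I0 := IK Kr _.
have I0ge : 0 <= I0.
  by apply: IK_ge0 => y /bKr_ge0 /andP[hb _]; rewrite evM evX mulr_ge0 // sqr_ge0.
pose s := Num.sqrt (C * I0).
have s0 : 0 <= s := sqrtr_ge0 _.
have ss : s ^+ 2 = C * I0 by rewrite sqr_sqrtr // mulr_ge0 // ltW.
have n1 : 1 <= n.+1%:R :> R by rewrite ler1n.
have cf i j : `|f`_i`_j| <= s.
  by rewrite -(ler_pXn2r (n := 2)) ?nnegrE ?normr_ge0 // ss real_normK ?num_real // hC.
have key g : deg2le n g -> (forall i j, `|g`_i`_j| <= n.+1%:R * s) ->
    ev g z ^+ 2 <= C * (n.+1%:R ^+ 2 * n.+1%:R) ^+ 2 * I0.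
  move=> dg hg; rewrite mulrAC -ss -exprMn -[ev g z ^+ 2]real_normK ?num_real //.
  rewrite ler_pXn2r ?nnegrE ?normr_ge0 ?mulr_ge0 ?exprn_ge0 ?ler0n //.
  apply: le_trans (ev_le_coef dg hg Kz) _.
  by rewrite le_eqVlt; apply/orP; left; apply/eqP; ring.
split; apply: key => //.
- by move=> i j; rewrite (le_trans (cf i j)) // ler_peMl.
- by apply: (@deg2le_sub _ n.-1); [exact: leq_pred|exact: deg2le_dX].
- move=> i j; rewrite coef_dX coef_deriv -[X in `|X|]mulr_natl normrM normr_nat.
  have [->|nz] := eqVneq f`_i`_j.+1 0; first by rewrite normr0 mulr0 mulr_ge0 ?ler0n.
  by rewrite ler_pM ?normr_ge0 ?ler0n // ler_nat; have := df _ _ nz; lia.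
- by apply: (@deg2le_sub _ n.-1); [exact: leq_pred|exact: deg2le_dY].
- move=> i j; rewrite coef_deriv coefMn -[X in `|X|]mulr_natl normrM normr_nat.
  have [->|nz] := eqVneq f`_i.+1`_j 0; first by rewrite normr0 mulr0 mulr_ge0 ?ler0n.
  by rewrite ler_pM ?normr_ge0 ?ler0n // ler_nat; have := df _ _ nz; lia.
Qed.

Definition bK K : P2 := \prod_(i < 3) baryP K i.
Lemma prod3 (A : comNzRingType) (F : 'I_3 -> A) : \prod_(i < 3) F i = F 0 * F 1 * F 2.
Proof.
rewrite !big_ord_recl big_ord0 mulr1 mulrA; congr (F _ * F _ * F _); exact/val_inj.
Qed.
Lemma bK_push K : nondeg K -> bK K = push K bKr.
Proof.
move=> nK; apply: ev_ext => z; rewrite ev_push /bK ev_prod prod3 /bKr !evM !evB ev1 ev_px ev_py /=.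
have -> : ev (baryP K 0) z = 1 - ev (baryP K 1) z - ev (baryP K 2) z.
  by rewrite -(bary_sum z nK) sum3; ring.
by ring.
Qed.
Lemma deg2le_bK K : deg2le 3 (bK K).
Proof.
rewrite /bK prod3.
have h1 := deg2leM (@deg2le_bary K 0) (@deg2le_bary K 1).
have h2 := deg2leM h1 (@deg2le_bary K 2).
exact: h2.
Qed.
Lemma ref_pt K z : nondeg K -> closedTri K z ->
  closedTri Kr (ev (baryP K 1) z, ev (baryP K 2) z).
Proof.
move=> nK /(closedTriP _ nK) h; apply/closedKr; split=> //=.
by have := bary_sum z nK; have := h 0; rewrite sum3; lra.
Qed.
Lemma bK_ge0 K z : nondeg K -> closedTri K z -> 0 <= ev (bK K) z <= 1.
Proof. by move=> nK Kz; rewrite bK_push // ev_push; apply/bKr_ge0/ref_pt. Qed.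

Lemma pushM K f g : push K (f * g) = push K f * push K g.
Proof. by apply: ev_ext => z; rewrite evM !ev_push evM. Qed.
Lemma pushX K f n : push K (f ^+ n) = push K f ^+ n.
Proof. by apply: ev_ext => z; rewrite evX !ev_push evX. Qed.

Lemma IK1 K : nondeg K -> IK K 1 <= `|crossK K|.
Proof.
move=> nK; have -> : 1 = push K 1 by apply: ev_ext => z; rewrite ev_push !ev1.
rewrite IK_push // -[leRHS]mulr1 ler_wpM2l ?normr_ge0 //.
have -> : (1 : P2) = dY (py R) by rewrite dY_py.
rewrite IKr_dY JB.
have -> : evs 'X 0 (py R) = 0 by apply: horner_ext => t; rewrite horner_evs ev_py !horner0.
have -> : evs 'X (1 - 'X) (py R) = 1 - 'X by apply: horner_ext => t; rewrite horner_evs ev_py.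
rewrite raddf0 subr0 -subr_ge0.
have -> : 1 - J (1 - 'X) = J ('X : {poly R}).
  have J1 : J (1 : {poly R}) = 1 by rewrite -(derivX R) J_deriv !hornerX subr0.
  by rewrite JB J1; ring.
by apply: J_ge0 => x /andP[]; rewrite hornerX.
Qed.
Lemma IK_sup K p M : nondeg K -> (forall z, closedTri K z -> ev p z <= M) -> 0 <= M ->
  IK K p <= M * `|crossK K|.
Proof.
move=> nK h M0; apply: (@le_trans _ _ (IK K (cst2 M * 1))).
  by apply: IK_le => // z Kz; rewrite evM ev_cst ev1 mulr1 h.
by rewrite IKZ // ler_wpM2l // IK1.
Qed.

Lemma IK_eq0 K p : nondeg K -> IK K (p ^+ 2) = 0 -> p = 0.
Proof.
move=> nK; rewrite -[p](push_pull _ nK) -pushX IK_push // => /eqP.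
rewrite mulf_eq0 normr_eq0; have /negbTE -> : crossK K != 0 by [].
move=> /eqP h.
have /eqP : pull K p ^+ 2 = 0 by apply: IKr_eq0 h => z _; rewrite evX sqr_ge0.
by rewrite sqrf_eq0 => /eqP ->; apply: ev_ext => z; rewrite ev_push !ev0.
Qed.

(** Both integrals acquire the same factor [|crossK K|] on [Kr], so the reference constant serves
    every triangle. *)
Lemma K_bubble_bound n : exists2 C, 0 < C & forall K p, nondeg K -> deg2le n p ->
  IK K (p ^+ 2) <= C * IK K (bK K * p ^+ 2).
Proof.
have [C C0 hC] := Kr_sup_bound n; exists C => // K p nK dp.
rewrite -[p](push_pull _ nK) bK_push // -pushX -pushM !IK_push // mulrCA.
rewrite ler_wpM2l ?normr_ge0 //.
have := @IK_sup Kr (pull K p ^+ 2) (C * IK Kr (bKr * pull K p ^+ 2)) nondeg_Kr.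
rewrite crossKr normr1 mulr1; apply.
  by move=> z Kz; rewrite evX; have [] := hC _ (@deg2le_pull n K p dp) z Kz.
apply: mulr_ge0; first exact: ltW.
by apply: IK_ge0 => y /bKr_ge0 /andP[hb _]; rewrite evM evX mulr_ge0 // sqr_ge0.
Qed.

Lemma grad_bound (a b c d s t h X : R) : a ^+ 2 + c ^+ 2 <= h -> b ^+ 2 + d ^+ 2 <= h ->
  s ^+ 2 <= X -> t ^+ 2 <= X ->
  (s * a + t * b) ^+ 2 + (s * c + t * d) ^+ 2 <= 4 * X * h.
Proof.
move=> h1 h2 h3 h4.
have e1 : s ^+ 2 * (a ^+ 2 + c ^+ 2) <= X * h by rewrite ler_pM ?sqr_ge0 ?addr_ge0 ?sqr_ge0.
have e2 : t ^+ 2 * (b ^+ 2 + d ^+ 2) <= X * h by rewrite ler_pM ?sqr_ge0 ?addr_ge0 ?sqr_ge0.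
have := sqr_ge0 (s * a - t * b); have := sqr_ge0 (s * c - t * d); lra.
Qed.

(** Gradients of [push K f] carry a factor of size [h / |crossK K|]. The denominator is kept on the
    left, so that shape regularity enters only where the inequality is applied. *)
Lemma inverse_ineq n : exists2 C, 0 < C & forall K p (h : R), nondeg K -> deg2le n p ->
  (forall i j, pdist (K i) (K j) <= h) -> 0 <= h ->
  IK K (dX p ^+ 2 + dY p ^+ 2) * crossK K ^+ 2 <= C * h ^+ 2 * IK K (p ^+ 2).
Proof.
have [C C0 hC] := Kr_sup_bound n; exists (4 * C); first by rewrite mulr_gt0.
move=> K p h nK dp hh h0; set f := pull K p.
have pf : p = push K f by rewrite push_pull.
set D := crossK K; set I0 := IK Kr (bKr * f ^+ 2).
have D0 : D != 0 by [].
have D2 : 0 < D ^+ 2 by rewrite exprn_even_gt0.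
have I0ge : 0 <= I0.
  by apply: IK_ge0 => y /bKr_ge0 /andP[hb _]; rewrite evM evX mulr_ge0 // sqr_ge0.
have I0le : I0 <= IK Kr (f ^+ 2).
  apply: IK_le => // z /bKr_ge0 /andP[b0 b1].
  by rewrite evM ler_piMl // evX sqr_ge0.
have ip : IK K (p ^+ 2) = `|D| * IK Kr (f ^+ 2) by rewrite pf -pushX IK_push.
have dist i j : ((K i).1 - (K j).1) ^+ 2 + ((K i).2 - (K j).2) ^+ 2 <= h ^+ 2.
  have := hh i j; rewrite /pdist /pnorm /pdot /psub /= => hij.
  rewrite !expr2 -!expr2 -[leLHS]sqr_sqrtr ?addr_ge0 ?sqr_ge0 //.
  by rewrite ler_pXn2r ?nnegrE ?sqrtr_ge0 // !expr2.
have := @IK_sup K (dX p ^+ 2 + dY p ^+ 2) (4 * C * h ^+ 2 * I0 / D ^+ 2) nK.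
have M0 : 0 <= 4 * C * h ^+ 2 * I0 / D ^+ 2.
  by rewrite divr_ge0 ?sqr_ge0 // !mulr_ge0 ?sqr_ge0 ?ler0n ?(ltW C0).
move=> H; have {}H : IK K (dX p ^+ 2 + dY p ^+ 2) <= 4 * C * h ^+ 2 * I0 / D ^+ 2 * `|D|.
  apply: H => // z Kz; rewrite evD !evX.
  have [eX eY] := grad_push f nK.
  have [_ hX hY] := hC _ (@deg2le_pull n K p dp) _ (ref_pt nK Kz).
  rewrite -/f -/I0 in hX hY.
  rewrite pf eX eY !evD !evM !ev_cst !ev_push -/D.
  set fs := ev _ _ in hX *; set ft := ev (dY f) _ in hY *.
  have d1 := dist 2 0; have d2 := dist 0 1.
  rewrite [X in X <= _](_ : _ = ((fs * ((K 2).2 - (K 0).2) + ft * ((K 0).2 - (K 1).2)) ^+ 2 +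
     (fs * - ((K 2).1 - (K 0).1) + ft * - ((K 0).1 - (K 1).1)) ^+ 2) / D ^+ 2); last by field.
  rewrite ler_pM2r ?invr_gt0 //.
  rewrite [leRHS](_ : _ = 4 * (C * I0) * h ^+ 2); last by ring.
  by apply: grad_bound; rewrite // sqrrN addrC.
rewrite -(ler_pM2r D2) in H; apply: le_trans H _.
rewrite -/D ip.
have -> : 4 * C * h ^+ 2 * I0 / D ^+ 2 * `|D| * D ^+ 2 = (4 * C * h ^+ 2 * `|D|) * I0 by field.
rewrite -[leRHS]mulrA [h ^+ 2 * _]mulrA [leRHS]mulrA [4 * C * (h^+2 * _)]mulrA.
by rewrite ler_wpM2l // !mulr_ge0 ?sqr_ge0 // ltW.
Qed.

End Triangle.

(** * Edges, Green's formula and Lagrange functions *)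

Section Edges.
Variable R : realType.
Notation P2 := (P2 R).
Notation pt := (pt R).
Notation tri := (tri R).
Implicit Types (p q G f u w : P2) (z a b : pt) (K : tri).

Lemma mkedgeP a b : mkedge a b = (a, b) \/ mkedge a b = (b, a).
Proof. by rewrite /mkedge; case: ifP => _; [left|right]. Qed.
Lemma lexle_anti a b : lexle a b -> lexle b a -> a = b.
Proof.
case: a b => [a1 a2] [b1 b2]; rewrite /lexle /= => /orP[h1|/andP[/eqP -> h1]].
  by move=> /orP[h2|/andP[/eqP h2 _]]; [have := lt_trans h1 h2|move: h1; rewrite h2]; rewrite ltxx.
by rewrite ltxx eqxx /= => h2; congr pair; apply/le_anti; rewrite h1.
Qed.
Lemma lexle_total a b : lexle a b || lexle b a.
Proof.
case: a b => [a1 a2] [b1 b2]; rewrite /lexle /=.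
by case: (ltgtP a1 b1) => //= _; exact: le_total.
Qed.
Lemma mkedgeC a b : mkedge a b = mkedge b a.
Proof.
rewrite /mkedge; case: ifP => h1; case: ifP => h2 //.
  by rewrite (lexle_anti h1 h2).
by have := lexle_total a b; rewrite h1 h2.
Qed.
Lemma pdistC a b : pdist a b = pdist b a.
Proof. by rewrite /pdist /pnorm; congr Num.sqrt; rewrite /pdot /psub /=; ring. Qed.
Lemma pdist_mkedge a b : pdist (mkedge a b).1 (mkedge a b).2 = pdist a b.
Proof. by case: (mkedgeP a b) => -> //=; rewrite pdistC. Qed.
Lemma J_mkedge a b p : J (segP (mkedge a b) p) = J (segP (a, b) p).
Proof. by case: (mkedgeP a b) => -> //=; rewrite segP_rev J_rev. Qed.
Lemma seg_pt_rev a b (t : R) : seg_pt (b, a) t = seg_pt (a, b) (1 - t).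
Proof. by rewrite /seg_pt /=; congr pair; ring. Qed.
Lemma openSeg_rev a b z : openSeg (b, a) z <-> openSeg (a, b) z.
Proof.
have key (u v : pt) : openSeg (u, v) z -> openSeg (v, u) z; last by split; apply: key.
move=> [t /andP[t0 t1] ->]; exists (1 - t); last by rewrite [RHS]seg_pt_rev; congr seg_pt; ring.
by apply/andP; split; lra.
Qed.
Lemma openSeg_mkedge a b z : openSeg (mkedge a b) z <-> openSeg (a, b) z.
Proof. by case: (mkedgeP a b) => -> //; apply: openSeg_rev. Qed.

Definition dn K i u : P2 := cst2 (nK K i).1 * dX u + cst2 (nK K i).2 * dY u.
Lemma ev_dn K i u z : ev (dn K i u) z = pdot (grad u z) (nK K i).
Proof. by rewrite /dn evD !evM !ev_cst /pdot /grad /=; ring. Qed.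
Lemma deg2le_dn K i n u : deg2le n u -> deg2le n.-1 (dn K i u).
Proof. by move=> h; apply: deg2leD; apply: deg2leZ; [apply: deg2le_dX|apply: deg2le_dY]. Qed.

Lemma pnorm_gt0 z : z != (0, 0) -> 0 < pnorm z.
Proof.
move=> nz; rewrite /pnorm sqrtr_gt0 /pdot lt_def addr_ge0 -?expr2 ?sqr_ge0 // andbT.
rewrite paddr_eq0 ?sqr_ge0 // !sqrf_eq0; apply: contra nz => /andP[/eqP h1 /eqP h2].
by rewrite [z]surjective_pairing h1 h2.
Qed.

Lemma edge_neq K i j : nondeg K -> i != j -> K i != K j.
Proof.
move=> nK ij; apply: contraNneq ij => e.
have := bary_ev (l := fun l => (l == i)%:R) i nK; have := bary_ev (l := fun l => (l == j)%:R) i nK.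
have s1 l : \sum_(i0 < 3) (i0 == l)%:R = 1 :> R.
  by rewrite (bigD1 l) //= eqxx big1 ?addr0 // => m /negbTE ->.
have bc l : bary_comb K (fun l' => (l' == l)%:R) = K l.
  rewrite /bary_comb [RHS]surjective_pairing; congr pair;
  by rewrite (bigD1 l) //= eqxx mul1r big1 ?addr0 // => m /negbTE ->; rewrite mul0r.
by rewrite !s1 !bc -e => -> // /(_ erefl) /eqP; rewrite eqxx eqr_nat; case: (i =P j).
Qed.

Lemma nxi_neq (i : 'I_3) : [/\ nx i != i, nx2 i != i & nx i != nx2 i].
Proof. by move: i; apply: I3_ind; rewrite !nxE; split. Qed.

(** Edge length times unit normal is the edge vector turned by a right angle, so the square roots
    disappear from Green's formula; the sign test in the definition of the normal amounts to the
    orientation of [K]. *)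
Lemma nK_E K i : nondeg K ->
  let e := psub (K (nx2 i)) (K (nx i)) in
  pnorm e * (nK K i).1 = Num.sg (crossK K) * e.2 /\
  pnorm e * (nK K i).2 = - Num.sg (crossK K) * e.1.
Proof.
move=> nK e.
have [_ _ nn] := nxi_neq i.
have e0 : 0 < pnorm e.
  apply: pnorm_gt0; rewrite /e /psub; apply: contraNneq (edge_neq nK nn) => -[h1 h2].
  by rewrite [K (nx i)]surjective_pairing [K (nx2 i)]surjective_pairing;
    apply/eqP; congr pair; apply/eqP; rewrite eq_sym -subr_eq0 ?h1 ?h2.
have ce : e.1 * (K i).2 - e.1 * (K (nx i)).2 - e.2 * (K i).1 + e.2 * (K (nx i)).1 = crossK K.
  rewrite /e; move: i {nn e e0}; apply: I3_ind; rewrite !nxE /crossK /cross3 /pcross /psub /=; ring.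
rewrite /Defs.nK; cbv zeta; rewrite -/e; move: ce e0; clearbody e => ce e0.
have -> : pdot (e.2 / pnorm e, - e.1 / pnorm e) (psub (K i) (K (nx i))) = - crossK K / pnorm e.
  by rewrite /pdot /psub /= -ce; ring.
rewrite pmulr_llt0 ?invr_gt0 // oppr_lt0; have : crossK K != 0 by [].
have nz : pnorm e != 0 by rewrite gt_eqF.
by case: ltrgtP => // hc _ /=; rewrite ?(gtr0_sg hc) ?(ltr0_sg hc); split; field.
Qed.

(** The product rule writes the integrand as the divergence of [w grad u] minus [lapP u * w]. The
    canonical orientation of an edge affects neither its length nor [J], so the boundary terms of
    [IK_dX] and [IK_dY] match edge by edge. *)
Lemma green K u w : nondeg K ->
  IK K (dX u * dX w + dY u * dY w) = - IK K (lapP u * w) +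
   \sum_(i < 3) pdist (tedge K i).1 (tedge K i).2 * J (segP (tedge K i) (dn K i u * w)).
Proof.
move=> nK.
have -> : dX u * dX w + dY u * dY w = dX (w * dX u) + dY (w * dY u) - lapP u * w.
  by rewrite dXM dYM /lapP; ring.
rewrite IKB // IKD // addrC; congr (_ + _).
rewrite IK_dX // IK_dY //.
have term i : pdist (tedge K i).1 (tedge K i).2 * J (segP (tedge K i) (dn K i u * w)) =
   Num.sg (crossK K) * (((K (nx2 i)).2 - (K (nx i)).2) * J (segP (K (nx i), K (nx2 i)) (w * dX u))
     - ((K (nx2 i)).1 - (K (nx i)).1) * J (segP (K (nx i), K (nx2 i)) (w * dY u))).
  rewrite /tedge pdist_mkedge J_mkedge pdistC.
  have [h1 h2] := nK_E i nK.
  have -> : dn K i u * w = cst2 (Defs.nK K i).1 * (w * dX u) + cst2 (Defs.nK K i).2 * (w * dY u).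
    by rewrite /dn; ring.
  rewrite segPD !segPM !segP_cst !mul_polyC JD !JZ -!segPM mulrDr !mulrA.
  rewrite -/(pnorm (psub (K (nx2 i)) (K (nx i)))) /pdist h1 h2 /psub /=; ring.
under eq_bigr => i _ do rewrite term.
rewrite sum3 !nxE /circ /circY; ring.
Qed.

Lemma segP_bary K i j l : nondeg K -> forall t,
  ev (baryP K l) (seg_pt (K i, K j) t) = (1 - t) * (l == i)%:R + t * (l == j)%:R.
Proof.
move=> nK t.
have v i' j' : ev (baryP K j') (K i') = (j' == i')%:R.
  rewrite baryE //; move: nK; rewrite nondegE /crossK /cross3 /pcross /psub /= => nz.
  by move: i' j'; apply: I3_ind; apply: I3_ind; rewrite !nxE /=; field.
by rewrite -!v /baryP !ev_aff /seg_pt /=; ring.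
Qed.

Lemma openSegP K i z : nondeg K -> openSeg (tedge K i) z <->
  [/\ ev (baryP K i) z = 0, 0 < ev (baryP K (nx i)) z & 0 < ev (baryP K (nx2 i)) z].
Proof.
move=> nK; rewrite /tedge openSeg_mkedge; have [n1 n2 n3] := nxi_neq i; split.
  move=> [t /andP[t0 t1] ->]; rewrite !segP_bary // !eqxx.
  rewrite eq_sym (negbTE n1) eq_sym (negbTE n2) (negbTE n3) eq_sym (negbTE n3) !mulr0 !mulr1 !addr0 add0r.
  by split; lra.
move=> [h0 h1 h2]; have := bary_sum z nK; rewrite (bigD1 i) //= h0 add0r.
rewrite (bigD1 (nx i)) //= (bigD1 (nx2 i)) /=; last by rewrite n2 eq_sym n3.
rewrite big1 ?addr0 => [hs|l /andP[/andP[hl1 hl2] hl3]]; last first.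
  by move: hl1 hl2 hl3 {h0 h1 h2 n1 n2 n3}; move: i l; apply: I3_ind; apply: I3_ind; rewrite !nxE.
exists (ev (baryP K (nx2 i)) z); first by apply/andP; split; lra.
rewrite -[LHS](bary_pt z nK) /bary_comb /seg_pt /=.
congr pair; rewrite (bigD1 i) //= h0 mul0r add0r (bigD1 (nx i)) //= (bigD1 (nx2 i)) /=; rewrite ?n2 1?eq_sym ?n3 //.
  rewrite big1 ?addr0 => [|l /andP[/andP[hl1 hl2] hl3]].
    have -> : ev (baryP K (nx i)) z = 1 - ev (baryP K (nx2 i)) z by lra.
    ring.
  by move: hl1 hl2 hl3 {h0 h1 h2 n1 n2 n3 hs}; move: i l; apply: I3_ind; apply: I3_ind; rewrite !nxE.
rewrite big1 ?addr0 => [|l /andP[/andP[hl1 hl2] hl3]].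
  have -> : ev (baryP K (nx i)) z = 1 - ev (baryP K (nx2 i)) z by lra.
  ring.
by move: hl1 hl2 hl3 {h0 h1 h2 n1 n2 n3 hs}; move: i l; apply: I3_ind; apply: I3_ind; rewrite !nxE.
Qed.

End Edges.

(** * Equidistant nodes and Lagrange polynomials on one triangle *)

Section Lagrange.
Variable R : realType.
Notation P2 := (P2 R).
Notation pt := (pt R).
Notation tri := (tri R).
Implicit Types (p q G f u w : P2) (z N : pt) (K : tri).

(** On the lowest grid line the restriction of [f] has more zeros than its degree, so the linear
    factor of that line divides [f]; the quotient has degree one less and vanishes on the remaining
    lines. *)
Lemma unisolvent_grid n (xs ys : nat -> R) f : injective xs -> injective ys -> deg2le n f ->
  (forall i j, (i + j <= n)%N -> ev f (xs i, ys j) = 0) -> f = 0.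
Proof.
move=> xi; elim: n ys f => [|n IH] ys f yi df hf.
- apply: ev_ext => z; rewrite ev0 -(hf 0%N 0%N) // [f]P2_sumE !ev_sum.
  apply: eq_bigr => i _; rewrite !ev_sum; apply: eq_bigr => j _.
  have [->|/df] := eqVneq f`_i`_j 0; first by rewrite cst20 !mul0r !ev0.
  rewrite leqn0 addn_eq0 => /andP[/eqP i0 /eqP j0].
  by rewrite !evM !evX !ev_cst j0 i0 !expr0.
have rt : root f (ys 0%N)%:P.
  rewrite rootE; apply/eqP; set r := f.[_].
  have sr : (size r <= n.+2)%N.
    rewrite /r horner_coef; apply: (leq_trans (size_sum _ _ _)); apply/bigmax_leqP => i _.
    rewrite -polyC_exp mulrC mul_polyC (leq_trans (size_scale_leq _ _)) //.
    by rewrite (leq_trans (deg2le_sizei i df)) // leq_subr.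
  apply: (poly_eq0_inj xi sr) => i; rewrite ltnS => hi.
  by apply: (hf i 0%N); rewrite addn0.
have [g fE] := factor_theorem _ _ rt.
have gE i : g`_i = f`_i.+1 + (ys 0%N)%:P * g`_i.+1.
  by rewrite fE mulrBr coefB coefMX coefMC /= mulrC subrK.
have dg : deg2le n g.
  (* Descending induction on the coefficient index [i], through [gE], starting at the size of [g]
     where the coefficients are zero. *)
  have main m i : (size g <= i + m)%N -> forall j, g`_i`_j != 0 -> (i + j <= n)%N.
    elim: m i => [|m IHm] i hi j.
      by have -> : g`_i = 0; [apply: nth_default; rewrite -(addn0 i)|rewrite coef0 eqxx].
    rewrite gE coefD coefCM leqNgt => nz; apply/negP => hij.
    have e1 : f`_i.+1`_j = 0.
      by apply/eqP/negPn/negP => /df; rewrite addSn ltnS leqNgt hij.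
    have e2 : g`_i.+1`_j = 0.
      apply/eqP/negPn/negP => h; have := IHm i.+1 _ j h.
      by rewrite addSnnS => /(_ hi); lia.
    by move: nz; rewrite e1 e2 mulr0 addr0 eqxx.
  by move=> i j; apply: (main (size g)); rewrite leq_addl.
suff g0 : g = 0 by rewrite fE g0 mul0r.
apply: (IH (fun j => ys j.+1)) => //; first by move=> i j /yi [].
move=> i j hij; have := hf i j.+1; rewrite addnS ltnS hij => /(_ isT).
rewrite fE evM => /eqP; rewrite mulf_eq0 => /orP[/eqP //|].
have -> : ev ('X - (ys 0%N)%:P%:P) (xs i, ys j.+1) = ys j.+1 - ys 0%N.
  by rewrite evB -/(py R) ev_py -[X in ev X]/(cst2 (ys 0%N)) ev_cst.
by rewrite subr_eq0 => /eqP /yi.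
Qed.

Variable n : nat.
Hypothesis n0 : (0 < n)%N.
(** A finite type of triples, so that sums over nodes are finite sums; [isidx] selects the triples
    that index nodes. *)
Definition idx := {ffun 'I_3 -> 'I_n.+1}.
Implicit Types (al be : idx).
Definition isidx al := (\sum_(i < 3) al i == n)%N.
Definition node K al : pt := bary_comb K (fun i => (al i)%:R / n%:R).
Let nR0 : n%:R != 0 :> R. Proof. by rewrite pnatr_eq0 -lt0n. Qed.

Lemma sum3n (F : 'I_3 -> nat) : (\sum_(i < 3) F i = F 0%R + F 1%R + F 2%R)%N.
Proof. exact: (@sum3 nat F). Qed.

Lemma idx_sum al : isidx al -> \sum_(i < 3) (al i)%:R / n%:R = 1 :> R.
Proof. by move=> /eqP h; rewrite -mulr_suml -natr_sum h divff. Qed.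

Lemma bary_node K al i : nondeg K -> isidx al -> ev (baryP K i) (node K al) = (al i)%:R / n%:R.
Proof. by move=> nK ha; rewrite /node bary_ev ?idx_sum. Qed.

Lemma closed_node K al : isidx al -> closedTri K (node K al).
Proof.
move=> ha; exists (fun i => (al i)%:R / n%:R); split=> //.
exact: idx_sum.
Qed.

Lemma isNodeP (T : mesh R) N : isNode n T N <-> exists K al, [/\ K \in T, isidx al & N = node K al].
Proof.
split=> [[K KT [a [ha ->]]]|[K [al [KT /eqP ha ->]]]]; last first.
  by exists K => //; exists (fun i => al i : nat); split.
have ai i : (a i < n.+1)%N by rewrite ltnS -ha (bigD1 i) //= leq_addr.
exists K, [ffun i => Ordinal (ai i)]; split=> //.
  by rewrite /isidx; apply/eqP; rewrite -[RHS]ha; apply: eq_bigr => i _; rewrite ffunE.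
by rewrite /node; congr pair; apply: eq_bigr => i _; rewrite ffunE.
Qed.

Lemma unisolvent K p : nondeg K -> deg2le n p ->
  (forall al, isidx al -> ev p (node K al) = 0) -> p = 0.
Proof.
move=> nK dp hp; rewrite -[p](push_pull _ nK).
suff -> : pull K p = 0 by apply: ev_ext => z; rewrite ev_push !ev0.
apply: (@unisolvent_grid n (fun i => i%:R / n%:R) (fun i => i%:R / n%:R)).
- by move=> i j /mulIf; rewrite invr_eq0 => /(_ nR0) /eqP; rewrite eqr_nat => /eqP.
- by move=> i j /mulIf; rewrite invr_eq0 => /(_ nR0) /eqP; rewrite eqr_nat => /eqP.
- exact: deg2le_pull.
move=> i j hij.
have [al [ha h0 h1 h2]] : exists al, [/\ isidx al, al 0 = (n - i - j)%N :> nat, al 1 = i :> nat & al 2 = j :> nat].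
  exists [ffun l : 'I_3 => inord (if l == 0 then (n - i - j)%N else if l == 1 then i else j)].
  have e0 : (n - i - j < n.+1)%N by lia.
  have e1 : (i < n.+1)%N by lia.
  have e2 : (j < n.+1)%N by lia.
  rewrite /isidx sum3n !ffunE /= !inordK //; split=> //; apply/eqP; lia.
rewrite -(hp _ ha) /pull ev_sub2 !ev_aff /node /bary_comb !sum3 h0 h1 h2 /=; congr ev.
have -> : (n - i - j)%:R = n%:R - i%:R - j%:R :> R by rewrite !natrB //; lia.
by congr pair; field.
Qed.

(** The product of [(n l - m) / (a - m)] over [m < a]: it is [1] where [l = a / n] and [0] where
    [l = b / n] with [b < a]. Products of three such factors are the Lagrange polynomials. *)
Definition lag1 (a : nat) (l : P2) : P2 :=
  \prod_(m < a) ((cst2 n%:R * l - cst2 m%:R) * cst2 ((a - m)%:R^-1)).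
Definition Lag K al : P2 := \prod_(i < 3) lag1 (al i) (baryP K i).

Lemma ev_lag1 a l z : ev (lag1 a l) z = \prod_(m < a) ((n%:R * ev l z - m%:R) / (a - m)%:R).
Proof. by rewrite /lag1 ev_prod; apply: eq_bigr => m _; rewrite evM evB evM !ev_cst. Qed.

Lemma lag1_node a b l z : ev l z = b%:R / n%:R -> (b < a)%N -> ev (lag1 a l) z = 0.
Proof.
move=> lz ba; rewrite ev_lag1 (bigD1 (Ordinal ba)) //= lz mulrCA divff // mulr1 subrr.
by rewrite mul0r mul0r.
Qed.
Lemma lag1_self a l z : ev l z = a%:R / n%:R -> ev (lag1 a l) z = 1.
Proof.
move=> lz; rewrite ev_lag1 big1 // => m _; rewrite lz mulrCA divff // mulr1.
by rewrite natrB ?(ltnW (ltn_ord m)) // divff // subr_eq0 eqr_nat gtn_eqF.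
Qed.

(** Two distinct triples with the same sum have a component where [be] is smaller than [al]; the
    corresponding factor vanishes at the node. *)
Lemma Lag_node K al be : nondeg K -> isidx al -> isidx be ->
  ev (Lag K al) (node K be) = (al == be)%:R.
Proof.
move=> nK ha hb; rewrite /Lag ev_prod.
have [<-|ab] := eqVneq al be.
  by rewrite big1 // => i _; apply: lag1_self; rewrite bary_node.
have [i hi] : exists i, (be i < al i)%N.
  apply: contrapT => hn.
  have le i : (al i <= be i)%N by rewrite leqNgt; apply/negP => h; apply: hn; exists i.
  move/eqP: ab; apply; apply/ffunP => i; apply/val_inj => /=.
  have [_] := @leqif_sum _ xpredT (fun i => al i == be i :> nat) (fun i => al i : nat) (fun i => be i : nat) (fun i _ => leqif_eq (le i)).
  by rewrite (eqP ha) (eqP hb) eqxx => /esym/forallP /(_ i) /= /eqP.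
rewrite (bigD1 i) //= (_ : ev (lag1 _ _) _ = 0) ?mul0r //.
by apply: (@lag1_node _ (be i)) => //; apply: bary_node.
Qed.

Lemma deg2le_Lag K al : isidx al -> deg2le n (Lag K al).
Proof.
move=> /eqP <-; rewrite /Lag prod3 sum3n.
have d1 a l : deg2le 1 l -> deg2le a (lag1 a l).
  move=> dl; rewrite /lag1; suff h c b : deg2le b (\prod_(m < b) ((cst2 n%:R * l - cst2 m%:R) * cst2 ((c - m)%:R^-1))) by exact: h.
  elim: b => [|b IH]; first by rewrite big_ord0 -cst21; apply: deg2le_cst.
  rewrite big_ord_recr /= -[b.+1]addn1; apply: deg2leM; first exact: IH.
  rewrite mulrC; apply: deg2leZ; apply: deg2leD; first exact: deg2leZ.
  by apply: deg2leN; apply: deg2le_cst.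
by apply: deg2leM; [apply: deg2leM|]; apply: d1; apply: deg2le_aff.
Qed.

(** There are [n] linear factors in all, each with numerator at most [n] in modulus and denominator
    at least [1]. *)
Lemma Lag_bound K al z : nondeg K -> isidx al -> closedTri K z -> `|ev (Lag K al) z| <= n%:R ^+ n.
Proof.
move=> nK ha Kz; rewrite /Lag ev_prod normr_prod.
have nge1 : 1 <= n%:R :> R by rewrite ler1n.
have -> : n%:R ^+ n = \prod_(i < 3) n%:R ^+ (al i) :> R by rewrite -{2}(eqP ha) prod3 sum3n !exprD.
apply: ler_prod => i _; rewrite normr_ge0 /= ev_lag1 normr_prod.
have l0 := (closedTriP _ nK).1 Kz i.
have l1 : ev (baryP K i) z <= 1.
  rewrite -(bary_sum z nK) (bigD1 i) //= lerDl sumr_ge0 // => j _.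
  exact: (closedTriP _ nK).1 Kz j.
rewrite -[X in _ <= _ ^+ X]card_ord -prodr_const; apply: ler_prod => m _; rewrite normr_ge0 /=.
have mn : m%:R <= n%:R :> R by rewrite ler_nat; have := ltn_ord m; have := ltn_ord (al i); lia.
have am : 1 <= (al i - m)%:R :> R by rewrite ler1n subn_gt0.
have am0 : 0 < (al i - m)%:R :> R by apply: lt_le_trans am.
rewrite normrM normfV (ger0_norm (ltW am0)) ler_pdivrMr //.
apply: (@le_trans _ _ n%:R); last by rewrite ler_peMr.
rewrite ler_norml; apply/andP; split.
  have e1 : 0 <= n%:R * ev (baryP K i) z by rewrite mulr_ge0.
  have : - n%:R <= n%:R * ev (baryP K i) z - m%:R by lra.
  by [].
have : n%:R * ev (baryP K i) z <= n%:R by rewrite ler_piMr.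
have : 0 <= m%:R :> R by []. lra.
Qed.

(** Nodal values are prescribed by a function of the point, not of triangle and index, so
    neighbouring triangles share the values at common nodes. *)
Definition gl (c : pt -> R) : bfun R := fun K => \sum_(al | isidx al) cst2 (c (node K al)) * Lag K al.
Lemma gl_node c K be : nondeg K -> isidx be -> ev (gl c K) (node K be) = c (node K be).
Proof.
move=> nK hb; rewrite /gl ev_sum (bigD1 be) //= evM ev_cst Lag_node // eqxx mulr1.
by rewrite big1 ?addr0 // => al /andP[ha ab]; rewrite evM Lag_node // (negbTE ab) mulr0.
Qed.
Lemma deg2le_gl c K : deg2le n (gl c K).
Proof. by apply: deg2le_sum => al ha; apply: deg2leZ; apply: deg2le_Lag. Qed.

Lemma node2 K (j j' : 'I_3) (a b : nat) : j != j' -> (a + b)%N = n ->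
  exists be, isidx be /\ node K be = seg_pt (K j, K j') (b%:R / n%:R).
Proof.
move=> jj' ab.
have ha : (a < n.+1)%N by lia.
have hb : (b < n.+1)%N by lia.
exists [ffun l => inord (if l == j then a else if l == j' then b else 0%N)].
have ae : a%:R = n%:R - b%:R :> R by rewrite -ab natrD addrK.
have val l : nat_of_ord (([ffun l => inord (if l == j then a else if l == j' then b else 0%N)] : idx) l) =
    (if l == j then a else if l == j' then b else 0%N).
  by rewrite ffunE inordK //; do 2! case: ifP => // _.
have j'j : j' != j by rewrite eq_sym.
split.
  rewrite /isidx; under eq_bigr => l _ do rewrite val.
  rewrite (bigD1 j) //= eqxx (bigD1 j') //= (negbTE j'j) eqxx big1 ?addn0 ?ab //.
  by move=> l /andP[/negbTE -> /negbTE ->].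
rewrite /node /bary_comb /seg_pt /=.
by congr pair; under eq_bigr => l _ do rewrite val;
  rewrite (bigD1 j) //= eqxx (bigD1 j') //= (negbTE j'j) eqxx big1 ?addr0;
  try (by move=> l /andP[/negbTE -> /negbTE ->]; rewrite !mul0r);
  rewrite ae; field.
Qed.

End Lagrange.

(** * Conforming meshes *)

Section Conf.
Variable R : realType.
Notation P2 := (P2 R).
Notation pt := (pt R).
Notation tri := (tri R).
Implicit Types (p q G f u w : P2) (z N : pt) (K : tri) (F : edge R).

Lemma bary_vertex K (i l : 'I_3) : nondeg K -> ev (baryP K l) (K i) = (l == i)%:R.
Proof.
move=> nK; have := segP_bary i i l nK 0; rewrite subr0 mul1r mul0r addr0 => <-.
by congr ev; rewrite /seg_pt /= !mul0r !addr0 -surjective_pairing.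
Qed.
Lemma openSeg_idx K i j z : nondeg K -> openSeg (tedge K i) z -> ev (baryP K j) z = 0 -> j = i.
Proof.
move=> nK /(openSegP i z nK) [h0 h1 h2] hj; apply/eqP; apply: contraT => ji.
suff : 0 < ev (baryP K j) z by rewrite hj ltxx.
by move: ji h1 h2 {h0 hj}; move: i j; apply: I3_ind; apply: I3_ind; rewrite !nxE.
Qed.
Lemma openSeg_uniq K i j z : nondeg K -> openSeg (tedge K i) z -> openSeg (tedge K j) z -> i = j.
Proof.
by move=> nK h1 /(openSegP j z nK) [h0 _ _]; rewrite (openSeg_idx nK h1 h0).
Qed.
Lemma openSeg_half F : openSeg F (seg_pt F (1 / 2)).
Proof. by exists (1 / 2) => //; apply/andP; split; lra. Qed.
Lemma tedge_inj K i j : nondeg K -> tedge K i = tedge K j -> i = j.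
Proof.
move=> nK e; apply: (openSeg_uniq nK (openSeg_half (tedge K i))).
by rewrite -e; apply: openSeg_half.
Qed.
Lemma openSeg_closed K i z : nondeg K -> openSeg (tedge K i) z -> closedTri K z.
Proof.
move=> nK /(openSegP i z nK) [h0 h1 h2]; apply/closedTriP => // j.
have [->|] := eqVneq j i; first by rewrite h0.
move: h1 h2 {h0}; move: i j; apply: I3_ind; apply: I3_ind; rewrite !nxE => h1 h2; first [by rewrite eqxx|by move=> _; apply: ltW].
Qed.
Lemma tedge_of K (b b' : 'I_3) : b != b' -> exists j, tedge K j = mkedge (K b) (K b').
Proof.
move: b b'; apply: I3_ind; apply: I3_ind => // _.
- by exists 2; rewrite /tedge !nxE.
- by exists 1; rewrite /tedge !nxE mkedgeC.
- by exists 2; rewrite /tedge !nxE mkedgeC.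
- by exists 0; rewrite /tedge !nxE.
- by exists 1; rewrite /tedge !nxE.
- by exists 0; rewrite /tedge !nxE mkedgeC.
Qed.
Lemma vertex_not_openSeg K i l : nondeg K -> ~ openSeg (tedge K i) (K l).
Proof.
move=> nK /(openSegP i _ nK); rewrite !bary_vertex //; have [n1 n2 n3] := nxi_neq i.
move=> [_]; case: eqP => [<-|_]; last by rewrite ltxx.
by rewrite eq_sym (negbTE n3) ltxx.
Qed.

Variables (Om : set pt) (T : mesh R).
Hypothesis hc : conforming Om T.

Lemma conf_nd K : K \in T -> nondeg K. Proof. by case: hc => _ h _ _ _; apply: h. Qed.
Lemma conf_uniq : uniq T. Proof. by case: hc => /andP[]. Qed.

Lemma conf_cases K1 K2 z : K1 \in T -> K2 \in T -> closedTri K1 z -> closedTri K2 z ->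
  [\/ K1 = K2, (exists i j, K1 i = K2 j /\ z = K1 i) |
   exists i i' j j', [/\ [/\ i != i', j != j', K1 i = K2 j & K1 i' = K2 j'] &
      exists2 t, 0 <= t <= 1 & z = seg_pt (K1 i, K1 i') t]].
Proof.
move=> T1 T2 h1 h2; have [->|ne] := eqVneq K1 K2; first by constructor 1.
case: hc => _ _ _ _ /(_ K1 K2 T1 T2 ne) /= [S0|[i [j [e S1]]]|[i [i' [j [j' [ii e e' S2]]]]]].
- by have : set0 z by rewrite -S0.
- by constructor 2; exists i, j; split=> //; have : [set K1 i] z by rewrite -S1.
constructor 3; exists i, i', j, j'; split; last first.
  by have : closedSeg (K1 i, K1 i') z by rewrite -S2.
split=> //; apply: contraNneq (edge_neq (conf_nd T1) ii) => jj.
by rewrite e e' jj.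
Qed.

(** Excludes hanging nodes: the point is no vertex, so it lies on an edge common to both triangles,
    and the barycentric coordinate that vanishes on that edge must be the [i]-th one. *)
Lemma edge_of_pt K1 K2 i z : K1 \in T -> K2 \in T -> openSeg (tedge K1 i) z -> closedTri K2 z ->
  exists j, tedge K2 j = tedge K1 i.
Proof.
move=> T1 T2 h1 h2; have nK1 := conf_nd T1.
case: (conf_cases T1 T2 (openSeg_closed nK1 h1) h2) => [<-|[l [j [e zl]]]|].
- by exists i.
- by exfalso; apply: (@vertex_not_openSeg K1 i l); rewrite // -zl.
move=> [a [a' [b [b' [[aa bb e e'] [t t01 zt]]]]]].
have [j je] := tedge_of K2 bb; exists j; rewrite je -e -e'.
have zero l : l != a -> l != a' -> l = i.
  move=> la la'; apply: (openSeg_idx nK1 h1); rewrite zt segP_bary //.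
  by rewrite (negbTE la) (negbTE la') !mulr0 addr0.
have [l la la'] : exists2 l, l != a & l != a'.
  move: aa {zero e e' zt}; move: a a'; apply: I3_ind; apply: I3_ind => // _;
   by [exists 0|exists 1|exists 2].
have li := zero l la la'.
rewrite -li /tedge.
move: aa la la' {zero e e' zt li}; move: a a' l; apply: I3_ind; apply: I3_ind; apply: I3_ind;
  rewrite ?nxE // mkedgeC //.
Qed.

Lemma vertex_not_edge K1 K2 i l : K1 \in T -> K2 \in T -> ~ openSeg (tedge K1 i) (K2 l).
Proof.
move=> T1 T2 h; have nK2 := conf_nd T2.
have Kl : closedTri K2 (K2 l).
  by apply/closedTriP => // j; rewrite bary_vertex.
have [j je] := edge_of_pt T1 T2 h Kl.
by apply: (@vertex_not_openSeg K2 j l); rewrite ?je.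
Qed.

Lemma edge_uniq K1 K2 i j z : K1 \in T -> K2 \in T ->
  openSeg (tedge K1 i) z -> openSeg (tedge K2 j) z -> tedge K1 i = tedge K2 j.
Proof.
move=> T1 T2 h1 h2; have nK2 := conf_nd T2.
have [l le] := edge_of_pt T1 T2 h1 (openSeg_closed nK2 h2).
rewrite -le; congr tedge; apply: (openSeg_uniq nK2 (z := z)) => //.
by rewrite le.
Qed.

Lemma open_uniq K1 K2 z : K1 \in T -> K2 \in T -> openTri K1 z -> closedTri K2 z -> K1 = K2.
Proof.
move=> T1 T2 h1 h2; have nK1 := conf_nd T1.
have pos := (openTriP _ nK1).1 h1.
have h1' : closedTri K1 z by apply/closedTriP => // i; apply: ltW.
case: (conf_cases T1 T2 h1' h2) => // [[l [j [_ zl]]]|].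
  have [m lm] : exists m, m != l.
    by move: l {zl}; apply: I3_ind; [exists 1|exists 0|exists 0].
  by have := pos m; rewrite zl bary_vertex // (negbTE lm) ltxx.
move=> [a [a' [b [b' [[aa _ _ _] [t _ zt]]]]]].
have [l la la'] : exists2 l, l != a & l != a'.
  move: aa {zt}; move: a a'; apply: I3_ind; apply: I3_ind => // _;
   by [exists 0|exists 1|exists 2].
by have := pos l; rewrite zt segP_bary // (negbTE la) (negbTE la') !mulr0 addr0 ltxx.
Qed.

Lemma edgesTP F : reflect (exists K i, K \in T /\ F = tedge K i) (F \in edgesT T).
Proof.
rewrite /edgesT mem_undup; apply: (iffP allpairsPdep) => [[K [i [KT _ ->]]]|[K [i [KT ->]]]].
  by exists K, i.
by exists K, i; rewrite mem_enum.
Qed.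

(** The witness is the midpoint of the common edge moved slightly towards the apex of [K1]; with
    both apices on the same side it stays inside [K2]. *)
Lemma two_coords_same_side (K1 K2 : tri) (i j : 'I_3) : nondeg K1 -> nondeg K2 ->
  tedge K1 i = tedge K2 j -> let F := tedge K1 i in
  0 < cross3 F.1 F.2 (K1 i) * cross3 F.1 F.2 (K2 j) ->
  exists2 z, openTri K1 z & closedTri K2 z.
Proof.
move=> nK1 nK2 e F; set a := F.1; set b := F.2; set c1 := K1 i; set c2 := K2 j.
set d1 := cross3 a b c1; set d2 := cross3 a b c2 => dd.
have d20 : d2 != 0 by apply: contraTneq dd => ->; rewrite mulr0 ltxx.
have d10 : d1 != 0 by apply: contraTneq dd => ->; rewrite mul0r ltxx.
have r0 : 0 < d1 / d2.
  have -> : d1 / d2 = d1 * d2 / d2 ^+ 2 by field.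
  by rewrite divr_gt0 // exprn_even_gt0.
(* [la], [lb] and [d1 / d2] are the coordinates of the apex [c1] with respect to the triangle [a],
   [b], [c2]. The step [tau] is chosen small against [la] and [lb], so that [mu + tau la] and
   [mu + tau lb] remain positive. *)
pose la := cross3 c1 b c2 / d2; pose lb := cross3 a c1 c2 / d2.
pose M := 1 + 2 * `|la| + 2 * `|lb|.
have M1 : 1 <= M by rewrite /M -addrA lerDl addr_ge0 // mulr_ge0.
pose tau := (2 * M)^-1.
have tau0 : 0 < tau by rewrite invr_gt0; lra.
have Mn0 : M != 0 by rewrite gt_eqF // (lt_le_trans ltr01).
have tM : tau * M = 1 / 2 by rewrite /tau invfM -mulrA mulVf // mulr1 div1r.
have tla : - (tau * `|la|) <= tau * la by rewrite -mulrN ler_wpM2l ?(ltW tau0) // lerNl -normrN ler_norm.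
have tlb : - (tau * `|lb|) <= tau * lb by rewrite -mulrN ler_wpM2l ?(ltW tau0) // lerNl -normrN ler_norm.
have tlap : 0 <= tau * `|la| by rewrite mulr_ge0 // ltW.
have tlbp : 0 <= tau * `|lb| by rewrite mulr_ge0 // ltW.
have tMe : tau + 2 * (tau * `|la|) + 2 * (tau * `|lb|) = 1 / 2 by rewrite -tM /M; ring.
pose mu := (1 - tau) / 2.
pose z : pt := (mu * a.1 + mu * b.1 + tau * c1.1, mu * a.2 + mu * b.2 + tau * c1.2).
have tri3_of (K : tri) l : nondeg K -> forall (x : pt) (m n o : R), 0 < m -> 0 < n -> 0 < o -> m + n + o = 1 ->
     x = (m * (tedge K l).1.1 + n * (tedge K l).2.1 + o * (K l).1, m * (tedge K l).1.2 + n * (tedge K l).2.2 + o * (K l).2) -> openTri K x.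
  move=> nK x m n o m0 n0' o0 s1 ->.
  case: (mkedgeP (K (nx l)) (K (nx2 l))); rewrite -/(tedge K l) => -> /=.
  - exists (fun q : 'I_3 => if q == nx l then m else if q == nx2 l then n else o).
    split.
    + by move=> q; do 2! case: ifP => // _.
    + by rewrite sum3; move: l; apply: I3_ind; rewrite ?nxE /=; lra.
    + by rewrite /bary_comb !sum3; move: l; apply: I3_ind; rewrite ?nxE /=; congr pair; ring.
  - exists (fun q : 'I_3 => if q == nx2 l then m else if q == nx l then n else o).
    split.
    + by move=> q; do 2! case: ifP => // _.
    + by rewrite sum3; move: l; apply: I3_ind; rewrite ?nxE /=; lra.
    + by rewrite /bary_comb !sum3; move: l; apply: I3_ind; rewrite ?nxE /=; congr pair; ring.
exists z.
  have h := tri3_of K1 i nK1.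
  by apply: (h z mu mu tau); rewrite // /mu; lra.
suff : openTri K2 z.
  by move=> /(openTriP _ nK2) h; apply/closedTriP => // l; apply: ltW.
have h := tri3_of K2 j nK2.
rewrite -e -/F -/a -/b -/c2 in h.
apply: (h z (mu + tau * la) (mu + tau * lb) (tau * (d1 / d2))).
- rewrite /mu; lra.
- rewrite /mu; lra.
- by rewrite mulr_gt0.
- have -> : d1 / d2 = 1 - la - lb.
    by move: d20; rewrite /la /lb /d1 /d2 /cross3 /pcross /psub /= => d20; field.
  by rewrite /mu; field.
- by move: d20; rewrite /z /la /lb /d1 /d2 /cross3 /pcross /psub /= => d20; congr pair; field.
Qed.

(* Two triangles on the same side of a common edge overlap, so an edge belongs
   to at most one triangle on each side. *)
Lemma edge_mult F (x : tri -> 'I_3 -> R) (M : R) : 0 <= M ->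
  (forall K i, K \in T -> tedge K i = F -> x K i <= M) ->
  \sum_(K <- T) \sum_(i < 3 | tedge K i == F) x K i <= 2 * M.
Proof.
move=> M0 hx.
(* [K] has the edge [F] with its apex on the side of sign [s]; at most one triangle of the mesh does
   so for each of the two signs. *)
pose P s K := [exists i, (tedge K i == F) && (Num.sg (cross3 F.1 F.2 (K i)) == s)].
have cr K i : nondeg K -> tedge K i = F -> cross3 F.1 F.2 (K i) != 0.
  move=> nK <-; have : crossK K != 0 by [].
  case: (mkedgeP (K (nx i)) (K (nx2 i))); rewrite -/(tedge K i) => -> /=.
    suff -> : cross3 (K (nx i)) (K (nx2 i)) (K i) = crossK K by [].
    by move: i; apply: I3_ind; rewrite !nxE /crossK /cross3 /pcross /psub /=; ring.
  suff -> : cross3 (K (nx2 i)) (K (nx i)) (K i) = - crossK K by rewrite oppr_eq0.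
  by move: i; apply: I3_ind; rewrite !nxE /crossK /cross3 /pcross /psub /=; ring.
have cnt s : s != 0 -> (count (P s) T <= 1)%N.
  move=> s0; rewrite -size_filter; case e : [seq K <- T | P s K] => [|K1 [|K2 r]] //.
  have : uniq [seq K <- T | P s K] by rewrite filter_uniq // conf_uniq.
  have K1i : K1 \in [seq K <- T | P s K] by rewrite e inE eqxx.
  have K2i : K2 \in [seq K <- T | P s K] by rewrite e !inE eqxx orbT.
  rewrite e /= !inE !negb_or => /andP[/andP[/eqP ne _] _]; case: ne.
  move: K1i K2i; rewrite !mem_filter => /andP[/existsP[i /andP[/eqP hi /eqP si]] T1].
  move=> /andP[/existsP[j /andP[/eqP hj /eqP sj]] T2].
  have H := @two_coords_same_side K1 K2 i j (conf_nd T1) (conf_nd T2) (etrans hi (esym hj)).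
  have [|z h1 h2] := H.
    rewrite hi -sgr_gt0 sgrM si sj -expr2 exprn_even_gt0 //.
  exact: open_uniq h1 h2.
apply: (@le_trans _ _ (\sum_(K <- T) ((P 1 K)%:R * M + (P (-1) K)%:R * M))).
  rewrite big_seq [leRHS]big_seq; apply: ler_sum => K KT; have nK := conf_nd KT.
  have [i hi|hn] := pickP (fun i => tedge K i == F); last first.
    by rewrite big_pred0 // addr_ge0 // mulr_ge0.
  rewrite (big_pred1 i) => [|j]; last first.
    apply/eqP/eqP => [h|->]; last exact/eqP.
    by apply: (tedge_inj nK); rewrite h (eqP hi).
  apply: (le_trans (hx K i KT (eqP hi))).
  have := cr K i nK (eqP hi); rewrite -sgr_eq0.
  have Psg : P (Num.sg (cross3 F.1 F.2 (K i))) K by apply/existsP; exists i; rewrite hi eqxx.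
  move: Psg; case: sgrP => [_ _ /eqP //|_ -> _|_ -> _]; rewrite mul1r.
    by rewrite lerDl mulr_ge0.
  by rewrite lerDr mulr_ge0.
have sumP s : s != 0 -> \sum_(K <- T) ((P s K)%:R * M) <= M.
  move=> s0; rewrite -mulr_suml -[leRHS]mul1r ler_wpM2r //.
  have -> : \sum_(i <- T) (P s i)%:R = (count (P s) T)%:R :> R.
    rewrite -sum1_count natr_sum [RHS]big_mkcond /=; apply: eq_bigr => i _.
    by case: (P s i).
  by rewrite (ler_nat R _ 1) cnt.
rewrite big_split /= mulr_natl mulr2n lerD // sumP ?oppr_eq0 ?oner_eq0 //.
Qed.

End Conf.

(** * Spans of Lagrange functions and edge bubbles *)

Section Spans.
Variable R : realType.
Notation P2 := (P2 R).
Notation pt := (pt R).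
Notation tri := (tri R).
Notation bfun := (bfun R).
Implicit Types (p q G f u w : P2) (z N : pt) (K : tri) (F : edge R) (c : pt -> R).
Variables (Om : set pt) (T : mesh R).
Hypothesis hc : conforming Om T.
Let nd K : K \in T -> nondeg K := @conf_nd R Om T hc K.

(** * Lagrange interpolants on the mesh and their spans *)

Section LagSpan.
Variable n : nat.
Hypothesis n0 : (0 < n)%N.
Let nR0 : n%:R != 0 :> R. Proof. by rewrite pnatr_eq0 -lt0n. Qed.

(** A node shared with another triangle is a vertex or lies on a common edge, and the equidistant
    nodes of an edge are the same from both sides. *)
Lemma node_transfer K1 K2 (al : idx n) : K1 \in T -> K2 \in T -> isidx al ->
  closedTri K2 (node K1 al) -> exists be : idx n, isidx be /\ node K1 al = node K2 be.
Proof.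
move=> T1 T2 ha h2; have h1 := closed_node n0 K1 ha.
have nK1 := nd T1.
case: (conf_cases hc T1 T2 h1 h2) => [<-|[l [j [e zl]]]|]; first by exists al.
  have [j' jj'] : exists j', j != j'.
    by move: j {e}; apply: I3_ind; [exists 1|exists 0|exists 0].
  have [be [hb e']] := node2 n0 K2 jj' (addn0 n); exists be; split=> //.
  by rewrite zl e' e /seg_pt /= !mul0r !addr0 -surjective_pairing.
move=> [i [i' [j [j' [[ii jj e e'] [t t01 zt]]]]]].
have ti : 1 - t = (al i)%:R / n%:R.
  by rewrite -(bary_node n0 i nK1 ha) zt segP_bary // eqxx (negbTE ii) mulr0 addr0 mulr1.
have ti' : t = (al i')%:R / n%:R.
  by rewrite -(bary_node n0 i' nK1 ha) zt segP_bary // eqxx eq_sym (negbTE ii) mulr0 add0r mulr1.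
have s : (al i + al i' = n)%N.
  apply/eqP; rewrite -(eqr_nat R) natrD; apply/eqP.
  have : ((al i)%:R / n%:R + (al i')%:R / n%:R) * n%:R = n%:R :> R.
    by rewrite -ti -ti' subrK mul1r.
  by rewrite -mulrDl divfK.
have [be [hb e'']] := node2 n0 K2 jj s; exists be; split=> //.
by rewrite zt e'' -ti' e e'.
Qed.

Lemma segP_eq_nodes F p q : deg2le n p -> deg2le n q ->
  (forall b, (b <= n)%N -> ev p (seg_pt F (b%:R / n%:R)) = ev q (seg_pt F (b%:R / n%:R))) ->
  segP F p = segP F q.
Proof.
move=> dp dq h; apply/eqP; rewrite -subr_eq0; apply/eqP.
apply: (poly_eq0_nodes n0).
  by rewrite (leq_trans (size_polyD _ _)) // geq_max size_polyN !size_segP.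
by move=> b bn; rewrite hornerD hornerN !segPE h // subrr.
Qed.

(** Along a common edge both restrictions have degree at most [n] and the same values at its [n + 1]
    nodes. *)
Lemma gl_conf c K1 K2 z : K1 \in T -> K2 \in T -> closedTri K1 z -> closedTri K2 z ->
  ev (gl n c K1) z = ev (gl n c K2) z.
Proof.
move=> T1 T2 h1 h2.
have vert K l : K \in T -> ev (gl n c K) (K l) = c (K l).
  move=> KT; have [l' ll'] : exists l', l != l'.
    by move: l; apply: I3_ind; [exists 1|exists 0|exists 0].
  have [be [hb e']] := node2 n0 K ll' (addn0 n).
  have <- : node K be = K l by rewrite e' /seg_pt /= !mul0r !addr0 -surjective_pairing.
  by rewrite gl_node //; apply: nd.
case: (conf_cases hc T1 T2 h1 h2) => [<- //|[l [j [e ->]]]|].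
  by rewrite vert // e vert.
move=> [i [i' [j [j' [[ii jj e e'] [t t01 ->]]]]]].
have H : segP (K1 i, K1 i') (gl n c K1) = segP (K1 i, K1 i') (gl n c K2).
  apply: segP_eq_nodes; [exact: deg2le_gl|exact: deg2le_gl|].
  move=> b bn; have ab : (n - b + b = n)%N by rewrite subnK.
  have [be1 [hb1 e1]] := node2 n0 K1 ii ab; have [be2 [hb2 e2]] := node2 n0 K2 jj ab.
  have -> : ev (gl n c K1) (seg_pt (K1 i, K1 i') (b%:R / n%:R)) = c (node K1 be1).
    by rewrite -e1; apply: gl_node => //; apply: nd.
  rewrite e1 e e' -e2; symmetry.
  by apply: gl_node => //; apply: nd.
by rewrite -(segPE _ (gl n c K1)) H segPE.
Qed.

Lemma gl_lagrange N : lagrangeB n T N (gl n (fun M => (M == N)%:R)).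
Proof.
split; first by split=> [K KT|K1 K2 T1 T2 z]; [apply: deg2le_gl|apply: gl_conf].
move=> N' /isNodeP [K1 [al [T1 ha ->]]] K KT h.
have [be [hb ->]] := node_transfer T1 KT ha h.
by rewrite gl_node //; [case: eqP|apply: nd].
Qed.

Lemma gl_unisolvent c K p : K \in T -> deg2le n p ->
  (forall al : idx n, isidx al -> ev p (node K al) = c (node K al)) -> p = gl n c K.
Proof.
move=> KT dp hp; apply/eqP; rewrite -subr_eq0; apply/eqP.
apply: (unisolvent n0 (nd KT)); first by apply: deg2leD => //; apply: deg2leN; apply: deg2le_gl.
by move=> al ha; rewrite evB hp // gl_node ?subrr //; apply: nd.
Qed.

(** A normal form for the Lagrange spans: interpolants of nodal values supported in [P]. Membership
    becomes a question about nodal values, and linear combinations become pointwise. *)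
Lemma spanLagP (P : pt -> Prop) (v : bfun) :
  inSpanLag n T P v <-> exists c, (forall N, c N != 0 -> P N) /\ forall K, K \in T -> v K = gl n c K.
Proof.
split=> [[s [c [b [hs hv]]]]|[c [hP hv]]].
  exists (fun M => \sum_(N <- s) c N * (M == N)%:R); split=> [M nz|K KT].
    have /hasP[N Ns /eqP MN] : has (fun N => M == N) s.
      apply: contraNT nz => /hasPn h; rewrite big_seq big1 // => N /h /negbTE ->.
      by rewrite mulr0.
    by rewrite MN; have [] := hs N Ns.
  apply: gl_unisolvent => //.
    rewrite hv // big_seq; apply: deg2le_sum => N Ns; apply: deg2leZ.
    by have [_ _ [[hb _] _]] := hs N Ns; apply: hb.
  move=> al ha; rewrite hv // ev_sum big_seq [RHS]big_seq; apply: eq_bigr => N Ns.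
  rewrite evM ev_cst; have [_ _ [_ hb]] := hs N Ns.
  rewrite hb //; [by case: eqP|by apply/isNodeP => //; exists K, al|exact: closed_node].
pose s := [seq N <- undup [seq node K al | K <- T, al <- enum (idx n)] | c N != 0
  & `[< isNode n T N >]].
exists s, c, (fun N => gl n (fun M => (M == N)%:R)); split.
  move=> N; rewrite mem_filter => /andP[/andP[cN /asboolP nN] _].
  split; [exact: nN|exact: hP|exact: gl_lagrange].
move=> K KT; rewrite hv //; symmetry; apply: gl_unisolvent => //.
  by apply: deg2le_sum => N _; apply: deg2leZ; apply: deg2le_gl.
move=> al ha; rewrite ev_sum.
have eN N : ev (cst2 (c N) * gl n (fun M => (M == N)%:R) K) (node K al) = c N * (node K al == N)%:R.
  by rewrite evM ev_cst gl_node //; apply: nd.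
under eq_bigr => N _ do rewrite eN.
have us : uniq s by rewrite filter_uniq // undup_uniq.
have [Ms|Ms] := boolP (node K al \in s).
  rewrite (bigD1_seq (node K al)) //= eqxx mulr1 big1 ?addr0 // => N NM.
  by rewrite eq_sym (negbTE NM) mulr0.
rewrite big_seq big1 => [|N Ns]; last first.
  by case: eqP => [e|_]; [move: Ms; rewrite e Ns|rewrite mulr0].
apply/eqP; rewrite eq_sym; apply: contraNT Ms => nz; rewrite mem_filter nz /= mem_undup.
apply/andP; split; first by apply/asboolP/isNodeP => //; exists K, al.
by apply/allpairsPdep; exists K, al; rewrite mem_enum.
Qed.

Lemma spanLag_lin (P : pt -> Prop) (a : R) (v1 v2 v : bfun) : inSpanLag n T P v1 -> inSpanLag n T P v2 ->
  (forall K, K \in T -> v K = cst2 a * v1 K + v2 K) -> inSpanLag n T P v.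
Proof.
move=> /spanLagP[c1 [h1 e1]] /spanLagP[c2 [h2 e2]] hv; apply/spanLagP.
exists (fun N => a * c1 N + c2 N); split=> [N|K KT].
  by have [->|/h1 //] := eqVneq (c1 N) 0; rewrite mulr0 add0r; apply: h2.
rewrite hv // e1 // e2 // /gl mulr_sumr -big_split /=; apply: eq_bigr => al _.
by rewrite cst2D cst2M; ring.
Qed.
Lemma spanLag0 (P : pt -> Prop) : inSpanLag n T P (fun=> 0).
Proof.
apply/spanLagP; exists (fun=> 0); split=> [N|K _]; first by rewrite eqxx.
by rewrite /gl big1 // => al _; rewrite cst20 mul0r.
Qed.

Lemma gl_bound c K z M : K \in T -> closedTri K z ->
  (forall al : idx n, isidx al -> `|c (node K al)| <= M) ->
  `|ev (gl n c K) z| <= #|{: idx n}|%:R * n%:R ^+ n * M.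
Proof.
move=> KT Kz hM; rewrite /gl ev_sum (le_trans (ler_norm_sum _ _ _)) //.
have bnd (al : idx n) : isidx al -> `|ev (cst2 (c (node K al)) * Lag K al) z| <= n%:R ^+ n * M.
  move=> ha; rewrite evM ev_cst normrM mulrC ler_pM ?normr_ge0 ?hM //.
  by apply: Lag_bound => //; apply: nd.
apply: (le_trans (ler_sum _ bnd)).
rewrite sumr_const -[leLHS]mulr_natl -mulrA.
(* Some node index is needed to know that [M] is nonnegative. *)
have [/existsP[al ha]|/existsPn h] := boolP [exists al : idx n, isidx al].
  apply: ler_wpM2r; last by rewrite ler_nat max_card.
  by rewrite mulr_ge0 ?exprn_ge0 // (le_trans (normr_ge0 _) (hM _ ha)).
have h01 : (0 : 'I_3) != 1 by [].
have [be [hb _]] := node2 n0 K h01 (addn0 n).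
by have := h be; rewrite hb.
Qed.

End LagSpan.

Lemma edge_ends (F : edge R) : F \in edgesT T -> F.1 != F.2.
Proof.
move=> /edgesTP[K [i [KT ->]]]; have [_ _ nn] := nxi_neq i.
have := edge_neq (nd KT) nn; case: (mkedgeP (K (nx i)) (K (nx2 i))); rewrite -/(tedge K i) => -> //=.
by rewrite eq_sym.
Qed.

(** Orthogonal projection to the line of [F]: a total function that recovers the parameter of a
    point of the edge. *)
Definition tpar (F : edge R) N : R := pdot (psub N F.1) (psub F.2 F.1) / pdot (psub F.2 F.1) (psub F.2 F.1).
Lemma tpar_seg F t : F.1 != F.2 -> tpar F (seg_pt F t) = t.
Proof.
move=> ne; rewrite /tpar; have -> : pdot (psub (seg_pt F t) F.1) (psub F.2 F.1) = t * pdot (psub F.2 F.1) (psub F.2 F.1).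
  by rewrite /pdot /psub /seg_pt /=; ring.
rewrite mulfK //; have : 0 < pnorm (psub F.2 F.1).
  apply: pnorm_gt0; apply: contraNneq ne => -[/eqP h1 /eqP h2]; move: h1 h2; rewrite !subr_eq0 => /eqP h1 /eqP h2.
  by rewrite [F.1]surjective_pairing [F.2]surjective_pairing h1 h2.
by rewrite /pnorm sqrtr_gt0 => h; rewrite gt_eqF.
Qed.

(** * Lagrange functions with prescribed traces on edges *)

Section EdgeFun.
Variables (k : nat) (E : seq (edge R)) (e : edge R -> {poly R}).
Hypotheses (k0 : (0 < k)%N) (uE : uniq E) (sE : {subset E <= edgesT T}).
Hypotheses (e_size : forall F, F \in E -> (size (e F) <= k.+1)%N)
  (e0 : forall F, F \in E -> (e F).[0] = 0) (e1 : forall F, F \in E -> (e F).[1] = 0).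

(** At most one edge contains [N] in its relative interior, so the sum has at most one nonzero term;
    it is zero at vertices and inside triangles. *)
Definition ecoef N : R := \sum_(F <- E) (if `[< openSeg F N >] then (e F).[tpar F N] else 0).

Lemma ecoef_on K i N : K \in T -> openSeg (tedge K i) N ->
  ecoef N = if tedge K i \in E then (e (tedge K i)).[tpar (tedge K i) N] else 0.
Proof.
move=> KT h; rewrite /ecoef.
have other F : F \in E -> openSeg F N -> F = tedge K i.
  move=> FE hF; have /edgesTP[K' [i' [KT' eF]]] := sE FE; rewrite eF.
  by apply: (edge_uniq hc KT' KT (z := N)); rewrite // -eF.
case: ifP => hE.
  rewrite (bigD1_seq (tedge K i)) //= asboolT // big1_seq ?addr0 // => F /andP[FK FE].
  by case: asboolP => // /(other F FE) /eqP; rewrite (negbTE FK).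
rewrite big1_seq // => F /andP[_ FE]; case: asboolP => // /(other F FE) FK.
by move: hE; rewrite -FK FE.
Qed.

Lemma ecoef_vertex K l : K \in T -> ecoef (K l) = 0.
Proof.
move=> KT; rewrite /ecoef big1_seq // => F /andP[_ FE]; case: asboolP => // h.
have /edgesTP[K' [i' [KT' eF]]] := sE FE.
by exfalso; apply: (vertex_not_edge hc (i := i') KT' KT (l := l)); rewrite -eF.
Qed.

Lemma ecoef_supp N : ecoef N != 0 -> inEdgesInt E N.
Proof.
move=> nz; apply: contrapT => h; move/eqP: nz; apply; rewrite /ecoef big1_seq // => F /andP[_ FE].
by case: asboolP => // hF; exfalso; apply: h; exists F.
Qed.

Lemma ecoef_bound K (M : R) (al : idx k) : K \in T -> isidx al -> 0 <= M ->
  (forall i, tedge K i \in E -> forall t, 0 <= t <= 1 -> `|(e (tedge K i)).[t]| <= M) ->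
  `|ecoef (node K al)| <= M.
Proof.
move=> KT ha M0 hM.
have [|/ecoef_supp [F FE hF]] := eqVneq (ecoef (node K al)) 0; first by move->; rewrite normr0.
have /edgesTP[K' [i' [KT' eF]]] := sE FE.
have [j je] : exists j, tedge K j = tedge K' i'.
  by apply: (edge_of_pt hc KT' KT (z := node K al)); [rewrite -eF|apply: closed_node].
rewrite -eF in je.
have hj : openSeg (tedge K j) (node K al) by rewrite je.
rewrite (ecoef_on KT hj) je FE; case: hF => t /andP[t0 t1] ->.
rewrite tpar_seg; last exact/edge_ends/sE.
by rewrite -je hM ?je //; apply/andP; split; apply: ltW.
Qed.

(** The nodal values on an edge are those of [e F], including the zero values at the vertices
    because [e F] vanishes at both ends; degree at most [k] then forces equality. *)
Lemma ecoef_trace K i : K \in T ->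
  segP (tedge K i) (gl k ecoef K) = if tedge K i \in E then e (tedge K i) else 0.
Proof.
move=> KT; have nK := nd KT.
apply/eqP; rewrite -subr_eq0; apply/eqP; apply: (poly_eq0_nodes k0).
  rewrite (leq_trans (size_polyD _ _)) // geq_max size_polyN size_segP; last exact: deg2le_gl.
  by case: ifP => [/e_size //|_]; rewrite size_poly0.
move=> b bk; rewrite hornerD hornerN segPE.
have [_ _ nn] := nxi_neq i; have nn' : nx2 i != nx i by rewrite eq_sym.
have ab : (k - b + b = k)%N by rewrite subnK.
have [be [hb eb]] : exists be : idx k, isidx be /\ node K be = seg_pt (tedge K i) (b%:R / k%:R).
  case: (mkedgeP (K (nx i)) (K (nx2 i))); rewrite -/(tedge K i) => ->.
    exact: node2 nn ab.
  exact: node2 nn' ab.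
rewrite -eb gl_node // eb.
have ends : forall t : R, (t == 0) || (t == 1) -> exists l, seg_pt (tedge K i) t = K l.
  have s0 (F : edge R) : seg_pt F 0 = F.1 by rewrite /seg_pt !mul0r !addr0 -surjective_pairing.
  have s1 (F : edge R) : seg_pt F 1 = F.2.
    by rewrite /seg_pt !mul1r (addrC F.1.1) (addrC F.1.2) !subrK -surjective_pairing.
  move=> t /orP[/eqP ->|/eqP ->]; case: (mkedgeP (K (nx i)) (K (nx2 i)));
   rewrite -/(tedge K i) => ->; rewrite ?s0 ?s1 /=; by [exists (nx i)|exists (nx2 i)].
have [t01|t01] := boolP ((b%:R / k%:R == 0 :> R) || (b%:R / k%:R == 1 :> R)).
  have [l ->] := ends _ t01; rewrite ecoef_vertex // sub0r.
  case: ifP => [hE|_]; last by rewrite horner0 oppr0.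
  by case/orP: t01 => /eqP ->; rewrite ?e0 ?e1 ?oppr0.
have kp : 0 < k%:R :> R by rewrite ltr0n.
have h : openSeg (tedge K i) (seg_pt (tedge K i) (b%:R / k%:R)).
  exists (b%:R / k%:R) => //; move: t01; rewrite negb_or => /andP[t0 t1].
  rewrite lt_def t0 divr_ge0 //= lt_neqAle t1 ler_pdivrMr // mul1r ler_nat //.
rewrite (ecoef_on KT h); case: ifP => [hE|_]; last by rewrite horner0 subrr.
by rewrite tpar_seg ?subrr //; apply/edge_ends/sE.
Qed.

End EdgeFun.

(** * Element bubbles and Crouzeix-Raviart spans *)

Lemma lap_coef n u i j : deg2le n u -> (lapP u)`_i`_j != 0 -> (i + j + 2 <= n)%N.
Proof.
move=> du; rewrite /lapP coefD coefD; apply: contraNT; rewrite -ltnNge => hij.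
have z a b : (n < a + b)%N -> u`_a`_b = 0.
  by move=> h; apply/eqP/negPn/negP => /du; rewrite leqNgt h.
by rewrite /dY !coef_dX ?(coef_deriv, coefMn) (z i j.+2) ?(z i.+2 j) ?mul0rn ?addr0 //; lia.
Qed.
Lemma deg2le_lap n u : deg2le n u -> deg2le n (lapP u).
Proof. by move=> du i j /(lap_coef du); lia. Qed.
(** The cubic bubble raises the degree by three and the Laplacian lowers it by two, which is why the
    element part has degree [k + 1]; for [n < 2] the Laplacian is zero. *)
Lemma deg2le_bK_lap n K u : deg2le n u -> deg2le n.+1 (bK K * lapP u).
Proof.
move=> du; case: (ltnP n 2) => hn.
  have -> : lapP u = 0.
    apply/polyP => i; apply/polyP => j; rewrite !coef0; apply/eqP/negPn/negP => /(lap_coef du); lia.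
  by rewrite mulr0; apply: deg2le0.
have -> : n.+1 = (3 + (n - 2))%N by lia.
apply: deg2leM; first exact: deg2le_bK.
by move=> i j /(lap_coef du); lia.
Qed.

(** The bubble vanishes on the boundary of each triangle, so only nodes in open triangles have
    nonzero values, and each such node lies in a single triangle of the mesh. *)
Lemma bubble_span k (a : R) (u : bfun) : (forall K, K \in T -> deg2le k (u K)) ->
  inSpanLag k.+1 T (inTriInt T) (fun K => cst2 a * (bK K * lapP (u K))).
Proof.
move=> du; pose v K := cst2 a * (bK K * lapP (u K)).
apply/spanLagP => //; exists (fun N => \sum_(K <- T) (if `[< openTri K N >] then ev (v K) N else 0)); split.
  move=> N nz; apply: contrapT => h; move/eqP: nz; apply; rewrite big1_seq // => K /andP[_ KT].
  by case: asboolP => // hK; exfalso; apply: h; exists K.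
move=> K KT; have nK := nd KT; apply: gl_unisolvent => //.
  by apply: deg2leZ; apply: deg2le_bK_lap; apply: du.
move=> al ha; set N := node K al.
have KN : closedTri K N by apply: closed_node.
have other K' : K' \in T -> openTri K' N -> K' = K.
  by move=> KT' h; apply: (open_uniq hc KT' KT h KN).
have uT := conf_uniq hc.
have [h|h] := pselect (openTri K N).
  rewrite (bigD1_seq K) //= asboolT // big1_seq ?addr0 // => K' /andP[KK KT'].
  by case: asboolP => // /(other K' KT') /eqP; rewrite (negbTE KK).
rewrite [RHS]big1_seq => [|K' /andP[_ KT']]; last first.
  by case: asboolP => // h'; exfalso; apply: h; rewrite -(other K' KT' h').
have [i hi] : exists i, ev (baryP K i) N = 0.
  apply: contrapT => hn; apply: h; apply/openTriP => // i.
  rewrite lt_def (closedTriP _ nK).1 // andbT; apply/eqP => hi; by apply: hn; exists i.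
by rewrite evM evM /bK ev_prod (bigD1 i) //= hi !mul0r mulr0.
Qed.

Lemma spanNCP k (E : seq (edge R)) (v : bfun) : uniq E ->
  inSpanNC k T E v <-> exists m : edge R -> R, forall K, K \in T -> v K = \sum_(F <- E) cst2 (m F) * bubble k F K.
Proof.
move=> uE; split=> [[s [m [sE hv]]]|[m hv]]; last by exists E, m; split.
exists (fun F => m F * (count_mem F s)%:R) => K KT; rewrite hv //.
elim: s sE {hv} => [|F s IH] sE.
  by rewrite big_nil big1 // => F _; rewrite mulr0 cst20 mul0r.
rewrite big_cons IH; last by move=> x xs; apply: sE; rewrite inE xs orbT.
have FE : F \in E by apply: sE; rewrite inE eqxx.
rewrite (bigD1_seq F) //= [RHS](bigD1_seq F) //= eqxx natrD mulrDr mulr1 cst2D mulrDl -!addrA.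
congr (_ + (_ + _)); apply: eq_bigr => F' /negbTE FF.
by rewrite eq_sym FF.
Qed.
Lemma spanNC_lin k E (a : R) (v1 v2 v : bfun) : uniq E -> inSpanNC k T E v1 -> inSpanNC k T E v2 ->
  (forall K, K \in T -> v K = cst2 a * v1 K + v2 K) -> inSpanNC k T E v.
Proof.
move=> uE /(spanNCP _ _ uE) [m1 h1] /(spanNCP _ _ uE) [m2 h2] hv; apply/(spanNCP _ _ uE).
exists (fun F => a * m1 F + m2 F) => K KT; rewrite hv // h1 // h2 // mulr_sumr -big_split /=.
by apply: eq_bigr => F _; rewrite cst2D cst2M; ring.
Qed.

Lemma nc_local k E (m : edge R -> R) K : uniq E -> K \in T ->
  \sum_(F <- E) cst2 (m F) * bubble k F K =
  \sum_(i < 3 | tedge K i \in E) cst2 (m (tedge K i)) * comp2 (legendre R k) (1 - cst2 2 * baryP K i).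
Proof.
move=> uE KT; rewrite /bubble.
under eq_bigr => F _ do rewrite mulr_sumr big_mkcond /=.
rewrite exchange_big /= [RHS]big_mkcond; apply: eq_bigr => i _.
case: ifP => h.
  rewrite (bigD1_seq (tedge K i)) //= eqxx big1 ?addr0 // => F /negbTE.
  by rewrite eq_sym => ->.
rewrite big1_seq // => F /andP[_ FE]; case: eqP => // e.
by move: h; rewrite e FE.
Qed.

End Spans.

(** * The lifting *)

Section Lift.
Variable R : realType.
Notation P2 := (P2 R).
Notation pt := (pt R).
Notation tri := (tri R).
Notation bfun := (bfun R).
Notation edge := (edge R).
Implicit Types (p q f w : P2) (z : pt) (K : tri) (F : edge).

Lemma leg_parity n (x : R) : (legendre R n).[- x] = (-1) ^+ n * (legendre R n).[x].
Proof.
suff [] : (legendre R n).[- x] = (-1) ^+ n * (legendre R n).[x] /\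
   (legendre R n.+1).[- x] = (-1) ^+ n.+1 * (legendre R n.+1).[x] by [].
elim: n => [|n [IA IB]].
  by split; rewrite /legendre /= !hornerE; ring.
split=> //; rewrite leg_rec !hornerZ !hornerD !hornerN !hornerZ !hornerM !hornerX IA IB !exprS.
ring.
Qed.

Lemma bary_opp K i t : nondeg K -> ev (baryP K i) (seg_pt (tedge K i) t) = 0.
Proof.
move=> nK; have [] := nxi_neq i; rewrite eq_sym => n1; rewrite eq_sym => n2 _.
case: (mkedgeP (K (nx i)) (K (nx2 i))); rewrite -/(tedge K i) => ->;
by rewrite segP_bary // (negbTE n1) (negbTE n2) !mulr0 addr0.
Qed.

(** * Forms and norms as sums of polynomial integrals *)

Lemma L2T_IK (T : mesh R) (x y : bfun) : L2T T x y = \sum_(K <- T) IK K (x K * y K).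
Proof. by apply: eq_bigr => K _; apply: IK_ext => z; rewrite evM. Qed.
Lemma ah_IK (T : mesh R) (x y : bfun) :
  ah T x y = \sum_(K <- T) IK K (dX (x K) * dX (y K) + dY (x K) * dY (y K)).
Proof. by apply: eq_bigr => K _; apply: IK_ext => z; rewrite evD !evM. Qed.
Lemma lapNorm_IK (T : mesh R) (x : bfun) :
  lapNorm T x = \sum_(K <- T) IK K (cst2 (meshsize T ^+ 2) * lapP (x K) ^+ 2).
Proof. by apply: eq_bigr => K _; apply: IK_ext => z; rewrite evM ev_cst evX exprMn. Qed.

Definition flP (T : mesh R) (u : bfun) F : {poly R} :=
  \sum_(K <- T) \sum_(i < 3 | tedge K i == F) segP F (dn K i (u K)).
Lemma flux_flP (T : mesh R) (u : bfun) F t : flux T u F (seg_pt F t) = (flP T u F).[t].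
Proof.
rewrite /flux /flP horner_sum; apply: eq_bigr => K _; rewrite horner_sum.
by apply: eq_bigr => i _; rewrite segPE ev_dn.
Qed.
(** The squared norm of the flux on [F], weighted by the mesh size: one summand of the jump form or
    of the boundary term. *)
Definition SF (T : mesh R) (u : bfun) F : R :=
  pdist F.1 F.2 * (meshsize T * J (flP T u F ^+ 2)).
Lemma Jh_SF Om (T : mesh R) (u : bfun) : Jh Om T u u = \sum_(F <- edgesI Om T) SF T u F.
Proof.
apply: eq_bigr => F _.
rewrite (@intF_J _ _ _ (meshsize T *: flP T u F ^+ 2)) ?JZ // => t.
by rewrite hornerZ horner_exp flux_flP expr2 mulrA.
Qed.
Lemma bdry_SF Om G0 (T : mesh R) (u : bfun) :
  meshsize T * bdryG0 Om G0 T u = \sum_(F <- edgesG0 Om G0 T) SF T u F.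
Proof.
rewrite mulr_sumr; apply: eq_bigr => F _.
rewrite (@intF_J _ _ _ (flP T u F ^+ 2)); first by rewrite /SF mulrCA.
by move=> t; rewrite horner_exp flux_flP.
Qed.

Lemma meshsize_ge0 (T : mesh R) : 0 <= meshsize T.
Proof. by rewrite /meshsize; elim/big_ind : _ => // [x y x0 _|K _]; rewrite le_max ?x0 // /pdist /pnorm sqrtr_ge0. Qed.
Lemma SF_ge0 (T : mesh R) (u : bfun) F : 0 <= SF T u F.
Proof.
rewrite /SF !mulr_ge0 ?sqrtr_ge0 ?meshsize_ge0 //.
by apply: J_ge0 => x _; rewrite horner_exp sqr_ge0.
Qed.

Lemma size_flP k (T : mesh R) (u : bfun) F : (0 < k)%N -> (forall K, K \in T -> deg2le k (u K)) ->
  (size (flP T u F) <= k)%N.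
Proof.
move=> k0 du; rewrite /flP big_seq.
elim/big_ind : _ => [|p q hp hq|K KT]; first by rewrite size_poly0.
  by rewrite (leq_trans (size_polyD _ _)) // geq_max hp.
elim/big_ind : _ => [|p q hp hq|i _]; first by rewrite size_poly0.
  by rewrite (leq_trans (size_polyD _ _)) // geq_max hp.
by rewrite -[X in (_ <= X)%N](prednK k0); apply/size_segP/deg2le_dn/du.
Qed.

(** * The test function and its Green identity *)

Section Test.
Variables (k : nat) (Om : set pt) (T : mesh R) (u : bfun).
Hypotheses (k0 : (0 < k)%N) (kodd : odd k) (hc : conforming Om T)
  (du : forall K, K \in T -> deg2le k (u K)).
Let h := meshsize T.
Let nd K : K \in T -> nondeg K := @conf_nd R Om T hc K.

(* [e_F + m_F = g_F + c_F LL] is the polynomial of degree [k] with equal values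
   [m_F] at both end points whose projection on degree [< k] is [g_F]; equal end
   values are possible because [LL k] changes sign, i.e. because [k] is odd. *)
Definition gF F : {poly R} := h *: flP T u F.
Definition mF F : R := ((gF F).[0] + (gF F).[1]) / 2.
Definition cF F : R := ((gF F).[1] - (gF F).[0]) / 2.
Definition eF F : {poly R} := gF F + cF F *: LL R k - (mF F)%:P.

Lemma eF0 F : (eF F).[0] = 0.
Proof. by rewrite /eF !(hornerD, hornerN) hornerC (hornerZ (cF F)) LL0 /cF /mF; field. Qed.
Lemma eF1 F : (eF F).[1] = 0.
Proof.
rewrite /eF !(hornerD, hornerN) hornerC (hornerZ (cF F)) LL1 -signr_odd kodd expr1 /cF /mF.
by field.
Qed.
Lemma size_LL : (size (LL R k) <= k.+1)%N.
Proof.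
rewrite /LL.
apply: leq_trans (size_comp_poly_leq _ _) _; rewrite ltnS.
have s2 : (size ((1 - 2%:P * 'X)%R : {poly R}) <= 2)%N.
  rewrite (leq_trans (size_polyD _ _)) // geq_max size_polyN size_poly1 /= mul_polyC.
  by rewrite (leq_trans (size_scale_leq _ _)) // size_polyX.
rewrite -[X in (_ <= X)%N]muln1 leq_mul //.
  by have := size_leg R k; case: (size (legendre R k)).
by move: s2; case: (size _) => [|[|[]]].
Qed.
Lemma size_eF F : (size (eF F) <= k.+1)%N.
Proof.
have s1 : (size (gF F) <= k.+1)%N.
  by rewrite (leq_trans (size_scale_leq _ _)) // (leq_trans (size_flP _ k0 du)).
rewrite /eF (leq_trans (size_polyD _ _)) // geq_max size_polyN.
rewrite (leq_trans (size_polyD _ _)) ?geq_max ?s1 //=.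
  by rewrite (leq_trans (size_polyC_leq1 _)).
by rewrite (leq_trans (size_scale_leq _ _)) // size_LL.
Qed.

Definition vE (E : seq edge) : bfun := gl k (ecoef E eF).
Definition vNC (E : seq edge) : bfun := fun K => \sum_(F <- E) cst2 (mF F) * bubble k F K.
(** The minus sign makes the volume term of Green's formula positive; the scale [h^2] matches the
    norm of [h Delta u]. *)
Definition vB (al : R) : bfun := fun K => cst2 (- (al * h ^+ 2)) * (bK K * lapP (u K)).

Lemma vE_cat E1 E2 K : vE (E1 ++ E2) K = vE E1 K + vE E2 K.
Proof.
rewrite /vE /gl -big_split /=; apply: eq_bigr => al _.
by rewrite /ecoef big_cat /= cst2D mulrDl.
Qed.
Lemma vNC_cat E1 E2 K : vNC (E1 ++ E2) K = vNC E1 K + vNC E2 K.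
Proof. by rewrite /vNC big_cat. Qed.

Variable (E : seq edge).
Hypotheses (uE : uniq E) (sE : {subset E <= edgesT T}).
Definition wE : bfun := fun K => vE E K + vNC E K.

(** On its own edge a bubble is the constant [P_k(1) = 1], which restores the mean value removed in
    [eF]; on the two other edges of the triangle it is plus or minus [LL]. The claim covers edges
    outside [E] too, where only such multiples remain. *)
Lemma trace_wE K j : K \in T -> exists zt : R,
  segP (tedge K j) (wE K) =
    (if tedge K j \in E then eF (tedge K j) + (mF (tedge K j))%:P else 0) + zt *: LL R k.
Proof.
move=> KT; have nK := nd KT.
have leg_seg i : i != j -> exists s : R,
    segP (tedge K j) (comp2 (legendre R k) (1 - cst2 2 * baryP K i)) = s *: LL R k.
  move=> ij; have [n1 n2 n3] := nxi_neq j; have n3' : nx2 j != nx j by rewrite eq_sym.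
  have i2 : (i == nx j) || (i == nx2 j).
    by move: ij {n1 n2 n3 n3'}; move: i j; apply: I3_ind; apply: I3_ind; rewrite !nxE.
  (* [b] records whether the coordinate grows or decreases along the canonical orientation of the
     edge; parity of [P_k] turns the decreasing case into a sign. *)
  have [b hb] : exists b : bool, forall t, ev (baryP K i) (seg_pt (tedge K j) t) = if b then t else 1 - t.
    case: (mkedgeP (K (nx j)) (K (nx2 j))); rewrite -/(tedge K j) => ->; case/orP: i2 => /eqP ->.
    - by exists false => t; rewrite segP_bary // eqxx (negbTE n3) mulr0 mulr1 addr0.
    - by exists true => t; rewrite segP_bary // eqxx (negbTE n3') mulr0 mulr1 add0r.
    - by exists true => t; rewrite segP_bary // eqxx (negbTE n3) mulr0 mulr1 add0r.
    - by exists false => t; rewrite segP_bary // eqxx (negbTE n3') mulr0 mulr1 addr0.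
  exists (if b then 1 else -1); apply: horner_ext => t.
  rewrite segPE ev_comp2 evB ev1 evM ev_cst hb hornerZ LL_at; case: (b); first by rewrite mul1r.
  have -> : 1 - 2 * (1 - t) = - (1 - 2 * t) by ring.
  by rewrite leg_parity -signr_odd kodd expr1.
have leg_self : segP (tedge K j) (comp2 (legendre R k) (1 - cst2 2 * baryP K j)) = 1.
  apply: horner_ext => t; rewrite segPE ev_comp2 evB ev1 evM ev_cst hornerC.
  by rewrite bary_opp // mulr0 subr0 leg1.
have [zt hz] : exists zt : R,
   \sum_(i < 3 | (tedge K i \in E) && (i != j)) segP (tedge K j) (cst2 (mF (tedge K i)) * comp2 (legendre R k) (1 - cst2 2 * baryP K i)) = zt *: LL R k.
  elim/big_rec : _ => [|i x /andP[_ ij] [zt ->]]; first by exists 0; rewrite scale0r.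
  have [s hs] := leg_seg i ij.
  by exists (mF (tedge K i) * s + zt); rewrite segPM segP_cst hs mul_polyC scalerA scalerDl.
exists zt; rewrite /wE segPD /vE (ecoef_trace hc k0 uE sE) //; last 3 first.
- by move=> F _; apply: size_eF.
- by move=> F _; apply: eF0.
- by move=> F _; apply: eF1.
rewrite /vNC (@nc_local R T k E _ K uE KT) segP_sum.
case: ifP => hE.
  by rewrite (bigD1 j) //= segPM segP_cst leg_self mulr1 addrA hz.
rewrite -hz !add0r; apply: eq_bigl => i.
by case: eqP => [->|]; rewrite ?hE ?andbT ?andbF.
Qed.

Lemma deg_wE K : K \in T -> deg2le k (wE K).
Proof.
move=> KT; apply: deg2leD; first exact: deg2le_gl.
rewrite /vNC (@nc_local R T k E _ K uE KT); apply: deg2le_sum => i _; apply: deg2leZ.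
apply: deg2le_sum => j _; apply: deg2leZ.
apply: (@deg2le_sub _ (j * 1)%N); first by rewrite muln1 -ltnS (leq_trans (ltn_ord j)) // size_leg.
apply: deg2leX; apply: deg2leD; first by rewrite -cst21; apply: deg2le_cst.
by apply: deg2leN; apply: deg2leZ; apply: deg2le_bary.
Qed.

(** The one-sided normal derivative already has degree below [k], so it is orthogonal to [LL] on
    each triangle separately; [gF] is all that remains of the trace, and only on edges of [E]. *)
Lemma green_test K (al : R) : K \in T ->
  IK K (dX (u K) * dX (vB al K + wE K) + dY (u K) * dY (vB al K + wE K)) =
  al * h ^+ 2 * IK K (bK K * lapP (u K) ^+ 2) - IK K (lapP (u K) * wE K) +
  \sum_(i < 3 | tedge K i \in E) pdist (tedge K i).1 (tedge K i).2 *
     J (segP (tedge K i) (dn K i (u K)) * gF (tedge K i)).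
Proof.
move=> KT; have nK := nd KT; rewrite green //; congr (_ + _).
  rewrite mulrDr IKD // opprD; congr (_ - _).
  have -> : lapP (u K) * vB al K = cst2 (- (al * h ^+ 2)) * (bK K * lapP (u K) ^+ 2).
    by rewrite /vB expr2; ring.
  by rewrite IKZ // mulNr opprK.
rewrite [RHS]big_mkcond /=; apply: eq_bigr => i _.
have orth : J (LL R k * segP (tedge K i) (dn K i (u K))) = 0.
  apply: J_orth; rewrite -[X in (_ <= X)%N](prednK k0).
  by apply/size_segP/deg2le_dn/du.
have tB : segP (tedge K i) (vB al K) = 0.
  apply: horner_ext => t; rewrite segPE horner0 /vB !evM /bK ev_prod (bigD1 i) //=.
  by rewrite bary_opp // !mul0r mulr0.
have [zt ht] := trace_wE i KT.
rewrite segPM segPD tB add0r ht; case: ifP => hE.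
  congr (_ * _); rewrite /eF subrK.
  set d := segP _ _ in orth *.
  have -> : d * (gF (tedge K i) + cF (tedge K i) *: LL R k + zt *: LL R k) =
     d * gF (tedge K i) + (cF (tedge K i) + zt) *: (LL R k * d).
    by rewrite -!mul_polyC polyCD; ring.
  by rewrite JD JZ orth mulr0 addr0.
by rewrite add0r -scalerAr JZ mulrC [X in J X]mulrC orth mulr0 mul0r.
Qed.

Lemma sum_edges (x : tri -> 'I_3 -> R) (y : edge -> R) :
  \sum_(K <- T) \sum_(i < 3 | tedge K i \in E) x K i * y (tedge K i) =
  \sum_(F <- E) (\sum_(K <- T) \sum_(i < 3 | tedge K i == F) x K i) * y F.
Proof.
under [RHS]eq_bigr => F _ do rewrite mulr_suml.
rewrite [RHS]exchange_big /=; apply: eq_bigr => K _.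
under [RHS]eq_bigr => F _ do rewrite big_mkcond /= mulr_suml.
rewrite [RHS]exchange_big /= big_mkcond /=; apply: eq_bigr => i _.
case: ifP => hE.
  rewrite (bigD1_seq (tedge K i)) //= eqxx big1 ?addr0 // => F /negbTE.
  by rewrite eq_sym => ->; rewrite mul0r.
rewrite big1_seq // => F /andP[_ FE]; case: eqP => [e|_]; last by rewrite mul0r.
by move: hE; rewrite e FE.
Qed.

(** [gF] is the same seen from both sides, so the one-sided normal derivatives add up to the flux,
    whose product with [gF] is [h] times its square. *)
Lemma flux_sum :
  \sum_(K <- T) \sum_(i < 3 | tedge K i \in E) pdist (tedge K i).1 (tedge K i).2 *
     J (segP (tedge K i) (dn K i (u K)) * gF (tedge K i)) = \sum_(F <- E) SF T u F.
Proof.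
have -> : \sum_(F <- E) SF T u F = \sum_(F <- E) \sum_(K <- T) \sum_(i < 3 | tedge K i == F)
    pdist F.1 F.2 * J (segP F (dn K i (u K)) * gF F).
  apply: eq_bigr => F _; rewrite /SF.
  have -> : meshsize T * J (flP T u F ^+ 2) = J (flP T u F * gF F).
    by rewrite /gF -scalerAr JZ expr2.
  rewrite {1}/flP mulr_suml raddf_sum mulr_sumr; apply: eq_bigr => K _.
  by rewrite mulr_suml raddf_sum mulr_sumr.
rewrite [RHS]exchange_big /=; apply: eq_bigr => K _.
under [RHS]eq_bigr => F _ do rewrite big_mkcond /=.
rewrite [RHS]exchange_big /= big_mkcond /=; apply: eq_bigr => i _.
case: ifP => hE.
  rewrite (bigD1_seq (tedge K i)) //= eqxx big1 ?addr0 // => F /negbTE.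
  by rewrite eq_sym => ->.
rewrite big1_seq // => F /andP[_ FE]; case: eqP => [e|//].
by move: hE; rewrite e FE.
Qed.

(** The part of the edge norm seen by [K]: the edge function on [K] depends only on the fluxes
    through its own edges. Summed over triangles, each edge counts at most twice. *)
Definition XK K : R := \sum_(i < 3 | tedge K i \in E) SF T u (tedge K i).
Lemma XK_ge0 K : 0 <= XK K.
Proof. by apply: sumr_ge0 => i _; apply: SF_ge0. Qed.
Lemma sum_XK : \sum_(K <- T) XK K <= 2 * \sum_(F <- E) SF T u F.
Proof.
have -> : \sum_(K <- T) XK K = \sum_(K <- T) \sum_(i < 3 | tedge K i \in E) 1 * SF T u (tedge K i).
  by apply: eq_bigr => K _; apply: eq_bigr => i _; rewrite mul1r.
rewrite sum_edges mulr_sumr; apply: ler_sum => F _.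
rewrite ler_wpM2r ?SF_ge0 //.
have := @edge_mult R Om T hc F (fun _ _ => 1) 1 ler01; rewrite mulr1; apply.
by move=> *; exact: lexx.
Qed.

End Test.

(** * Size of the lifting under shape regularity *)

Lemma cross_le (x y : pt) : `|pcross x y| <= pnorm x * pnorm y.
Proof.
rewrite -(ler_pXn2r (n := 2)) ?nnegrE ?normr_ge0 ?mulr_ge0 ?sqrtr_ge0 //.
rewrite real_normK ?num_real // exprMn /pnorm !sqr_sqrtr /pdot -?expr2 ?addr_ge0 ?sqr_ge0 //.
rewrite -subr_ge0 /pcross; have -> : (x.1 ^+ 2 + x.2 ^+ 2) * (y.1 ^+ 2 + y.2 ^+ 2) - (x.1 * y.2 - x.2 * y.1) ^+ 2 =
  (x.1 * y.1 + x.2 * y.2) ^+ 2 by ring.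
exact: sqr_ge0.
Qed.

Lemma cross_edge K i : `|crossK K| <= pdist (tedge K i).1 (tedge K i).2 * pdist (K i) (K (nx i)).
Proof.
rewrite /tedge pdist_mkedge (pdistC (K (nx i))); apply: le_trans (cross_le _ _).
rewrite le_eqVlt; apply/orP; left; apply/eqP; congr (`|_|).
move: i; apply: I3_ind; rewrite !nxE /crossK /cross3 /pcross /psub /=; ring.
Qed.

(** Shape regularity and quasi-uniformity in one condition: every triangle has twice its area
    comparable to the square of the global mesh size. *)
Definition shaped (kap : R) (T : mesh R) := forall K, K \in T ->
  (forall i j, pdist (K i) (K j) <= meshsize T) /\ kap * meshsize T ^+ 2 <= `|crossK K|.

(** Twice the area is at most an edge length times a second side, and that side is at most [h]. *)
Lemma edge_len kap (T : mesh R) K i : shaped kap T -> 0 < meshsize T -> K \in T ->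
  kap * meshsize T <= pdist (tedge K i).1 (tedge K i).2.
Proof.
move=> sh h0 KT; have [hd hk] := sh K KT.
rewrite -(ler_pM2r h0) -mulrA -expr2 (le_trans hk) // (le_trans (cross_edge K i)) //.
by rewrite ler_wpM2l ?sqrtr_ge0.
Qed.

Lemma LL_bound k : exists2 C, 0 <= C & forall t : R, 0 <= t <= 1 -> `|(LL R k).[t]| <= C.
Proof.
have [C C0 hC] := @J_sup_bound R (size (LL R k)).
exists (Num.sqrt (C * J (LL R k ^+ 2))) => [|t ht]; first exact: sqrtr_ge0.
rewrite -sqrtr_sqr ler_sqrt ?hC //.
by rewrite mulr_ge0 ?(ltW C0) //; apply: J_ge0 => x _; rewrite horner_exp sqr_ge0.
Qed.

Lemma wE_sup k (kap : R) : (0 < k)%N -> odd k -> 0 < kap -> exists2 Cw, 0 < Cw &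
  forall Om (T : mesh R) (u : bfun) (E : seq edge), conforming Om T -> (forall K, K \in T -> deg2le k (u K)) ->
   uniq E -> {subset E <= edgesT T} -> shaped kap T -> 0 < meshsize T ->
   forall K z, K \in T -> closedTri K z -> ev (wE k T u E K) z ^+ 2 <= Cw * XK T u E K.
Proof.
move=> k0 kodd kap0; have [CJ CJ0 hCJ] := @J_sup_bound R k; have [CL CL0 hCL] := LL_bound k.
(* The first summand bounds the Lagrange interpolant with edge data up to [(2 + CL) s], the second
   the at most three bubbles that meet [K]. *)
pose Ct : R := #|{: idx k}|%:R * k%:R ^+ k * (2 + CL) + 3 * CL.
have Ct0 : 0 <= Ct by rewrite addr_ge0 // ?mulr_ge0 ?exprn_ge0 ?addr_ge0.
exists ((1 + Ct ^+ 2) * (CJ / kap)) => [|Om T u E hc du uE sE sh h0 K z KT Kz].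
  by rewrite mulr_gt0 ?divr_gt0 // ltr_pwDl // sqr_ge0.
have nK := conf_nd hc KT; set h := meshsize T in h0 *.
set X := XK T u E K; have X0 : 0 <= X := XK_ge0 T u E K.
pose s := Num.sqrt (CJ / kap * X).
have s0 : 0 <= s := sqrtr_ge0 _.
have ss : s ^+ 2 = CJ / kap * X by rewrite sqr_sqrtr // mulr_ge0 // divr_ge0 // ltW.
(* [J_sup_bound] yields [CJ h^2] times the mean square of the flux; one factor [h] is exchanged for
   the edge length by [edge_len], which leaves [SF]. *)
have gb i t : tedge K i \in E -> 0 <= t <= 1 -> `|(gF T u (tedge K i)).[t]| <= s.
  move=> hE ht; rewrite -(ler_pXn2r (n := 2)) ?nnegrE ?normr_ge0 // ss real_normK ?num_real //.
  have sg : (size (gF T u (tedge K i)) <= k)%N.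
    by rewrite (leq_trans (size_scale_leq _ _)) // size_flP.
  apply: (le_trans (hCJ _ sg _ ht)); rewrite -mulrA ler_wpM2l ?(ltW CJ0) //.
  have SX : SF T u (tedge K i) <= X.
    by rewrite /X /XK (bigD1 i) //= lerDl sumr_ge0 // => j _; apply: SF_ge0.
  rewrite mulrC ler_pdivlMr //; apply: le_trans SX.
  have -> : J (gF T u (tedge K i) ^+ 2) = h ^+ 2 * J (flP T u (tedge K i) ^+ 2).
    by rewrite /gF exprZn JZ.
  rewrite /SF -/h mulrC mulrA expr2 !mulrA -[leRHS]mulrA -[X in X <= _]mulrA.
  rewrite ler_wpM2r //; last exact: (edge_len i sh h0 KT).
  by rewrite mulr_ge0 ?(ltW h0) //; apply: J_ge0 => x _; rewrite horner_exp sqr_ge0.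
have i01 : 0 <= (0 : R) <= 1 by rewrite lexx ler01.
have i11 : 0 <= (1 : R) <= 1 by rewrite lexx ler01.
have mb i : tedge K i \in E -> `|mF T u (tedge K i)| <= s.
  move=> hE; rewrite /mF normrM (ger0_norm (_ : 0 <= 2^-1)) ?invr_ge0 // ler_pdivrMr //.
  rewrite (le_trans (ler_normD _ _)) //; have := gb i 0 hE i01; have := gb i 1 hE i11; lra.
have cb i : tedge K i \in E -> `|cF T u (tedge K i)| <= s.
  move=> hE; rewrite /cF normrM (ger0_norm (_ : 0 <= 2^-1)) ?invr_ge0 // ler_pdivrMr //.
  rewrite (le_trans (ler_normB _ _)) //; have := gb i 0 hE i01; have := gb i 1 hE i11; lra.
have eb i : tedge K i \in E -> forall t, 0 <= t <= 1 -> `|(eF k T u (tedge K i)).[t]| <= (2 + CL) * s.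
  move=> hE t ht; rewrite /eF !(hornerD, hornerN) hornerC (hornerZ (cF T u _)).
  rewrite (le_trans (ler_normB _ _)) // (_ : (2 + CL) * s = s + s * CL + s); last by ring.
  rewrite lerD ?mb // (le_trans (ler_normD _ _)) // lerD ?gb // normrM.
  by rewrite ler_pM ?normr_ge0 ?cb ?hCL.
have vEb : `|ev (vE k T u E K) z| <= #|{: idx k}|%:R * k%:R ^+ k * ((2 + CL) * s).
  apply: (gl_bound hc k0 KT Kz) => al ha.
  apply: (ecoef_bound hc) => //; first by rewrite mulr_ge0 ?addr_ge0.
have vNCb : `|ev (vNC k T u E K) z| <= 3 * CL * s.
  rewrite /vNC (@nc_local R T k E _ K uE KT) ev_sum (le_trans (ler_norm_sum _ _ _)) //.
  apply: (@le_trans _ _ (\sum_(i < 3 | tedge K i \in E) (s * CL))).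
    apply: ler_sum => i hE; rewrite evM ev_cst ev_comp2 evB ev1 evM ev_cst normrM -LL_at.
    rewrite ler_pM ?normr_ge0 ?mb //; apply: hCL.
    have hb := (closedTriP _ nK).1 Kz; rewrite hb /=.
    rewrite -(bary_sum z nK) (bigD1 i) //= lerDl; apply: sumr_ge0 => j _.
    exact: hb.
  rewrite sumr_const -[leLHS]mulr_natl -mulrA (mulrC CL) ler_wpM2r ?mulr_ge0 // ler_nat.
  by rewrite (leq_trans (max_card _)) // card_ord.
have tot : `|ev (wE k T u E K) z| <= Ct * s.
  rewrite /wE evD (le_trans (ler_normD _ _)) // /Ct (mulrDl _ _ s) -(mulrA (_ * _)) lerD //.
rewrite -[ev _ z ^+ 2]real_normK ?num_real //.
apply: (@le_trans _ _ ((Ct * s) ^+ 2)).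
  by rewrite ler_pXn2r ?nnegrE ?normr_ge0 ?mulr_ge0.
rewrite exprMn ss -[leRHS]mulrA ler_wpM2r //; last by rewrite lerDr ler01.
by rewrite mulr_ge0 // divr_ge0 // ltW.
Qed.

Lemma lifting k (kap Hm : R) : (0 < k)%N -> odd k -> 0 < kap -> 0 < Hm ->
  exists al C2 : R, 0 < C2 /\
  forall Om (T : mesh R) (u : bfun) (E : seq edge), conforming Om T -> (forall K, K \in T -> deg2le k (u K)) ->
   uniq E -> {subset E <= edgesT T} -> shaped kap T -> 0 < meshsize T -> meshsize T <= Hm ->
   let w : bfun := fun K => vB T u al K + wE k T u E K in
   let S := \sum_(F <- E) SF T u F in
   (S + lapNorm T u) / 2 <= ah T u w /\ H1T T w w <= C2 * (S + lapNorm T u).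
Proof.
move=> k0 kodd kap0 Hm0; have [Cw Cw0 hCw] := wE_sup k0 kodd kap0.
have [Cb Cb0 hCb] := K_bubble_bound R k; have [Ci Ci0 hCi] := inverse_ineq R k.+1.
(* [Cb] undoes the bubble weight; of the resulting [Cw + 1/2], the part [Cw] absorbs the cross term
   with the edge function and [1/2] survives. *)
pose al : R := Cb * (Cw + 1 / 2).
have al0 : 0 <= al by rewrite mulr_ge0 ?(ltW Cb0) // addr_ge0 ?(ltW Cw0) //; lra.
(* [Hm ^+ 2] comes from the [L^2] norm, [Ci / kap ^+ 2] from the inverse inequality, and [4 Cw] is
   [2 Cw] times the two triangles at an edge. *)
pose C2 : R := (Hm ^+ 2 + Ci / kap ^+ 2) * (2 * al ^+ 2 + 4 * Cw).
exists al, C2; split.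
  rewrite mulr_gt0 //; first by rewrite ltr_pwDl ?exprn_gt0 // divr_ge0 ?sqr_ge0 // ltW.
  by rewrite ltr_wpDl ?mulr_gt0 // mulr_ge0 // sqr_ge0.
move=> Om T u E hc du uE sE sh h0 hH w S.
have nd K : K \in T -> nondeg K := @conf_nd R Om T hc K.
set h := meshsize T in h0 hH *.
pose L K := h ^+ 2 * IK K (lapP (u K) ^+ 2).
have L0 K : 0 <= L K by rewrite mulr_ge0 ?sqr_ge0 // IK_sqr_ge0.
have lapE : lapNorm T u = \sum_(K <- T) L K.
  by rewrite lapNorm_IK big_seq [RHS]big_seq; apply: eq_bigr => K KT; rewrite IKZ //; apply: nd.
have X0 K := XK_ge0 T u E K.
have sX : \sum_(K <- T) XK T u E K <= 2 * S by exact: (sum_XK u hc uE).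
have S0 : 0 <= S by apply: sumr_ge0 => F _; apply: SF_ge0.
have h20 : 0 < h ^+ 2 by rewrite exprn_gt0.
have crle K : K \in T -> `|crossK K| <= h ^+ 2.
  move=> KT; have [hd _] := sh K KT; apply: (le_trans (cross_edge K 0)).
  by rewrite expr2 ler_pM ?sqrtr_ge0 // /tedge pdist_mkedge.
have wE2 K : K \in T -> IK K (wE k T u E K ^+ 2) <= Cw * XK T u E K * h ^+ 2.
  move=> KT; have nK := nd K KT.
  apply: (@le_trans _ _ (Cw * XK T u E K * `|crossK K|)); last first.
    by rewrite ler_wpM2l ?crle // mulr_ge0 // ltW.
  apply: IK_sup => //; last by rewrite mulr_ge0 // ltW.
  by move=> z Kz; rewrite evX (hCw Om).
split.
- have -> : ah T u w = \sum_(K <- T) (al * h ^+ 2 * IK K (bK K * lapP (u K) ^+ 2) - IK K (lapP (u K) * wE k T u E K))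
     + S.
    rewrite ah_IK /S -(flux_sum T u uE) // -big_split /= big_seq [RHS]big_seq; apply: eq_bigr => K KT.
    by rewrite (green_test k0 kodd hc du uE sE).
  have loc K : K \in T -> L K / 2 - XK T u E K / 4 <=
     al * h ^+ 2 * IK K (bK K * lapP (u K) ^+ 2) - IK K (lapP (u K) * wE k T u E K).
    move=> KT; have nK := nd K KT.
    have e1 : (Cw + 1 / 2) * L K <= al * h ^+ 2 * IK K (bK K * lapP (u K) ^+ 2).
      rewrite /al /L (_ : Cb * (Cw + 1 / 2) * h ^+ 2 * IK K (bK K * lapP (u K) ^+ 2) =
        (Cw + 1 / 2) * (h ^+ 2 * (Cb * IK K (bK K * lapP (u K) ^+ 2)))); last by ring.
      have cw : 0 <= Cw + 1 / 2 by have := ltW Cw0; lra.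
      apply: ler_wpM2l => //.
      by rewrite ler_wpM2l ?(ltW h20) // hCb //; apply/deg2le_lap/du.
    (* Young's inequality with weight [Cw h^2], chosen so that the bound [wE2] leaves exactly
       [XK / 4]; summed over triangles this takes at most half of [S]. *)
    have e2 : IK K (lapP (u K) * wE k T u E K) <= Cw * L K + XK T u E K / 4.
      have : IK K (lapP (u K) * wE k T u E K) <=
          IK K (cst2 (Cw * h ^+ 2) * lapP (u K) ^+ 2 + cst2 (1 / (4 * (Cw * h ^+ 2))) * wE k T u E K ^+ 2).
        apply: IK_le => // z _; rewrite evD !(evX, evM) !ev_cst.
        set a := ev _ z; set b := ev _ z; set th := Cw * h ^+ 2.
        have th0 : 0 < th by rewrite mulr_gt0.
        rewrite -subr_ge0 (_ : _ - _ = (2 * th * a - b) ^+ 2 / (4 * th)); last first.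
          by field; rewrite gt_eqF.
        by rewrite divr_ge0 ?sqr_ge0 // mulr_ge0 // ltW.
      rewrite IKD // !IKZ // => H; apply: (le_trans H); rewrite /L -mulrA lerD2l.
      have c0 : 0 <= 1 / (4 * (Cw * h ^+ 2)) by rewrite divr_ge0 ?mulr_ge0 // ltW.
      apply: (le_trans (ler_wpM2l c0 (wE2 K KT))).
      rewrite le_eqVlt; apply/orP; left; apply/eqP; field.
      by rewrite !gt_eqF.
    have := lerB e1 e2; lra.
  apply: (@le_trans _ _ (\sum_(K <- T) (L K / 2 - XK T u E K / 4) + S)).
    by rewrite sumrB -!mulr_suml -lapE; lra.
  by rewrite lerD2r big_seq [leRHS]big_seq; apply: ler_sum => K KT; apply: loc.
- have loc K : K \in T -> IK K (w K * w K) + IK K (dX (w K) * dX (w K) + dY (w K) * dY (w K)) <=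
     (Hm ^+ 2 + Ci / kap ^+ 2) * (2 * al ^+ 2 * L K + 2 * Cw * XK T u E K).
    move=> KT; have nK := nd K KT; have [hd hk] := sh K KT.
    have dw : deg2le k.+1 (w K).
      apply: deg2leD; first by apply: deg2leZ; apply: deg2le_bK_lap; apply: du.
      by apply: (@deg2le_sub _ k) => //; exact: (@deg_wE k T u E uE K KT).
    have v2 : IK K (vB T u al K ^+ 2) <= al ^+ 2 * h ^+ 2 * L K.
      have : IK K (vB T u al K ^+ 2) <= IK K (cst2 (al ^+ 2 * h ^+ 2 * h ^+ 2) * lapP (u K) ^+ 2).
        apply: IK_le => // z Kz; rewrite /vB !(evX, evM) !ev_cst.
        have /andP[b0 b1] := bK_ge0 nK Kz.
        have -> : (- (al * h ^+ 2) * (ev (bK K) z * ev (lapP (u K)) z)) ^+ 2 =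
          ev (bK K) z ^+ 2 * (al ^+ 2 * h ^+ 2 * h ^+ 2 * ev (lapP (u K)) z ^+ 2) by ring.
        by rewrite ler_piMl ?exprn_ile1 // -!exprMn sqr_ge0.
      by rewrite IKZ // /L !mulrA.
    have w2 : IK K (w K ^+ 2) <= h ^+ 2 * (2 * al ^+ 2 * L K + 2 * Cw * XK T u E K).
      have : IK K ((vB T u al K + wE k T u E K) ^+ 2) <= IK K (cst2 2 * vB T u al K ^+ 2 + cst2 2 * wE k T u E K ^+ 2).
        move: (vB T u al K) (wE k T u E K) => p q.
        apply: IK_le => // z _; rewrite evD !(evX, evM) !ev_cst evD.
        have := sqr_ge0 (ev p z - ev q z); lra.
      rewrite IKD // !IKZ // => H; apply: (le_trans H); have := wE2 K KT; have := v2; lra.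
    have B0 : 0 <= 2 * al ^+ 2 * L K + 2 * Cw * XK T u E K.
      have a20 := sqr_ge0 al; have c20 := ltW Cw0.
      by apply: addr_ge0; (apply: mulr_ge0; [apply: mulr_ge0|]).
    set B := 2 * al ^+ 2 * L K + _ in w2 B0 *.
    rewrite -!expr2 mulrDl lerD //.
      apply: (le_trans w2); rewrite ler_wpM2r // ler_pXn2r ?nnegrE // ltW //.
    have D2 : kap ^+ 2 * h ^+ 2 * h ^+ 2 <= crossK K ^+ 2.
      rewrite -[leRHS]real_normK ?num_real // (_ : _ * _ = (kap * h ^+ 2) ^+ 2); last by ring.
      by rewrite ler_pXn2r ?nnegrE ?mulr_ge0 ?normr_ge0 ?sqr_ge0 // ltW.
    have P0 : 0 < kap ^+ 2 * h ^+ 2 * h ^+ 2 by rewrite !mulr_gt0 // exprn_gt0.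
    have I0 : 0 <= IK K (dX (w K) ^+ 2 + dY (w K) ^+ 2).
      by apply: IK_ge0 => z _; rewrite evD !evX addr_ge0 ?sqr_ge0.
    rewrite -(ler_pM2r P0); apply: (le_trans (ler_wpM2l I0 D2)).
    apply: (le_trans (hCi K (w K) h nK dw hd (ltW h0))).
    have -> : Ci / kap ^+ 2 * B * (kap ^+ 2 * h ^+ 2 * h ^+ 2) = Ci * h ^+ 2 * (h ^+ 2 * B).
      by field; rewrite gt_eqF.
    by rewrite ler_wpM2l // mulr_ge0 ?(ltW Ci0) ?(ltW h20).
  rewrite /H1T L2T_IK ah_IK -big_split /=.
  apply: (@le_trans _ _ (\sum_(K <- T) (Hm ^+ 2 + Ci / kap ^+ 2) * (2 * al ^+ 2 * L K + 2 * Cw * XK T u E K))).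
    by rewrite big_seq [leRHS]big_seq; apply: ler_sum => K KT; apply: loc.
  rewrite -mulr_sumr /C2 -mulrA ler_wpM2l ?addr_ge0 ?divr_ge0 ?sqr_ge0 ?(ltW Ci0) //.
  have s1 : \sum_(K <- T) 2 * al ^+ 2 * L K = 2 * al ^+ 2 * lapNorm T u by rewrite lapE mulr_sumr.
  have s2 : \sum_(K <- T) 2 * Cw * XK T u E K = 2 * Cw * \sum_(K <- T) XK T u E K by rewrite mulr_sumr.
  rewrite big_split /= s1 s2.
  have l0 : 0 <= lapNorm T u by rewrite lapE sumr_ge0.
  have a1 : 0 <= 4 * Cw * lapNorm T u by rewrite !mulr_ge0 // ltW.
  have a2 : 0 <= 2 * al ^+ 2 * S.
    by apply: mulr_ge0 => //; apply: mulr_ge0 => //; exact: sqr_ge0.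
  have a3 : 2 * Cw * \sum_(K <- T) XK T u E K <= 2 * Cw * (2 * S).
    by rewrite ler_wpM2l // mulr_ge0 // ltW.
  lra.
Qed.

End Lift.

(** * Inf-sup estimates *)

Section Final.
Variable R : realType.
Notation P2 := (P2 R).
Notation pt := (pt R).
Notation tri := (tri R).
Notation bfun := (bfun R).
Notation edge := (edge R).
Implicit Types (p q f : P2) (z : pt) (K : tri) (F : edge).

(** * Geometry of regular mesh families *)

Lemma pdist_ge_coord (x y : pt) : `|x.1 - y.1| <= pdist x y /\ `|x.2 - y.2| <= pdist x y.
Proof.
rewrite /pdist /pnorm /pdot /psub /= -!expr2; split.
  by rewrite -sqrtr_sqr ler_sqrt ?addr_ge0 ?sqr_ge0 // lerDl sqr_ge0.
by rewrite -sqrtr_sqr ler_sqrt ?addr_ge0 ?sqr_ge0 // lerDr sqr_ge0.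
Qed.
Lemma pdist_le_coord (x y : pt) : pdist x y <= `|x.1 - y.1| + `|x.2 - y.2|.
Proof.
rewrite /pdist /pnorm /pdot /psub /= -!expr2.
rewrite -[leRHS]ger0_norm ?addr_ge0 // -sqrtr_sqr ler_sqrt ?sqr_ge0 //.
rewrite [leRHS]sqrrD !real_normK ?num_real //.
have := mulr_ge0 (normr_ge0 (x.1 - y.1)) (normr_ge0 (x.2 - y.2)); lra.
Qed.
Lemma pdist_ge0 (x y : pt) : 0 <= pdist x y. Proof. exact: sqrtr_ge0. Qed.

Lemma diam_le_mesh (T : mesh R) K : K \in T -> diamT K <= meshsize T.
Proof.
rewrite /meshsize; elim: T => // K' T IH; rewrite inE big_cons le_max => /orP[/eqP ->|/IH ->].
  by rewrite lexx.
by rewrite orbT.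
Qed.
Lemma pdist_diam K i j : pdist (K i) (K j) <= diamT K.
Proof.
have d0 l : pdist (K l) (K l) = 0.
  by rewrite /pdist /pnorm /pdot /psub /= !subrr !mul0r addr0 sqrtr0.
have g0 : 0 <= diamT K by rewrite /diamT le_max pdist_ge0.
move: i j; apply: I3_ind; apply: I3_ind; rewrite ?d0 // /diamT !le_max ?lexx ?orbT //.
- by rewrite (pdistC (K 0) (K 2)) lexx ?orbT.
- by rewrite (pdistC (K 1) (K 0)) lexx ?orbT.
- by rewrite (pdistC (K 2) (K 1)) lexx ?orbT.
Qed.
Lemma pdist_gt0 (x y : pt) : x != y -> 0 < pdist x y.
Proof.
move=> xy; apply: pnorm_gt0; apply: contraNneq xy => -[/eqP h1 /eqP h2].
move: h1 h2; rewrite !subr_eq0 => /eqP h1 /eqP h2.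
by rewrite [x]surjective_pairing [y]surjective_pairing h1 h2.
Qed.

(** Inradius times perimeter is twice the area, so [diam^2 <= diam * perimeter <= sig |crossK K|];
    quasi-uniformity replaces the diameter by [c h]. *)
Lemma shaped_of_regular Om (T : mesh R) (sig c : R) : conforming Om T -> 0 < sig -> 0 < c ->
  (forall K, K \in T -> diamT K <= sig * inradius K) ->
  (forall K, K \in T -> c * meshsize T <= diamT K) -> shaped (c ^+ 2 / sig) T.
Proof.
move=> hc sig0 c0 hs hq K KT; have nK := conf_nd hc KT; split.
  by move=> i j; rewrite (le_trans (pdist_diam K i j)) ?diam_le_mesh.
have e01 : 0 < pdist (K 0) (K 1) by apply/pdist_gt0/edge_neq.
have p12 := pdist_ge0 (K 1) (K 2); have p20 := pdist_ge0 (K 2) (K 0).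
have P0 : 0 < perimT K by rewrite /perimT; lra.
have dP : diamT K <= perimT K.
  rewrite /diamT /perimT !ge_max; apply/andP; split; first lra.
  by apply/andP; split; lra.
have dge : 0 <= diamT K by rewrite (le_trans (pdist_ge0 (K 0) (K 1))) // pdist_diam.
have := hs K KT; rewrite /inradius (_ : 2 * areaT K = `|crossK K|); last first.
  by rewrite /areaT mulrCA divff ?mulr1.
rewrite mulrA ler_pdivlMr // => h1.
have h2 : diamT K ^+ 2 <= sig * `|crossK K|.
  by apply: le_trans h1; rewrite expr2 ler_wpM2l.
rewrite mulrAC ler_pdivrMr // mulrC (mulrC `|_|); apply: le_trans h2.
rewrite mulrC -exprMn ler_pXn2r ?nnegrE ?mulr_ge0 ?(ltW c0) ?meshsize_ge0 //.
exact: hq.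
Qed.

Lemma conf_nonempty Om (T : mesh R) : conforming Om T -> exists K, K \in T.
Proof. by case=> /andP[+ _] _ _ _ _; case: T => // K T _; exists K; rewrite inE eqxx. Qed.

Lemma meshsize_gt0 Om (T : mesh R) : conforming Om T -> 0 < meshsize T.
Proof.
move=> hc; have [K KT] := conf_nonempty hc; have nK := conf_nd hc KT.
have n01 : (0 : 'I_3) != 1 by [].
apply: lt_le_trans (diam_le_mesh KT); apply: lt_le_trans (pdist_diam K 0 1).
exact/pdist_gt0/edge_neq.
Qed.

(** Bounds the [L^2] part of the lifting, which scales like [h^2]. Vertices lie in the closure of
    [Om], hence within distance [1] of a point of [Om]; the [4] counts two coordinates of two
    vertices. *)
Lemma meshsize_bound Om (T : mesh R) (M : R) : conforming Om T -> (forall z, Om z -> pnorm z <= M) ->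
  meshsize T <= 4 * (`|M| + 1).
Proof.
move=> hc hM; have H0 : 0 <= 4 * (`|M| + 1) by rewrite mulr_ge0 // addr_ge0.
have vb K l : K \in T -> `|(K l).1| <= `|M| + 1 /\ `|(K l).2| <= `|M| + 1.
  move=> KT; have cl : eclosure Om (K l).
    case: (hc) => _ _ -> _ _; exists K => //.
    have nK := conf_nd hc KT; apply/(closedTriP _ nK) => j.
    by rewrite bary_vertex // ler0n.
  have [y [Oy dy]] := cl 1 ltr01; have yM := hM y Oy.
  have [d1 d2] := pdist_ge_coord (K l) y.
  have [y1 y2] : `|y.1| <= `|M| /\ `|y.2| <= `|M|.
    have := pdist_ge_coord y (0, 0); rewrite /= !subr0.
    have -> : pdist y (0, 0) = pnorm y by rewrite /pdist /psub /= !subr0 -surjective_pairing.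
    by move=> [a1 a2]; split; rewrite (le_trans _ (ler_norm M)) // (le_trans _ yM).
  have tr (a b : R) : `|a| <= `|b| + `|a - b|.
    by rewrite -{1}(subrK b a) addrC ler_normD.
  split.
    have := tr (K l).1 y.1; lra.
  have := tr (K l).2 y.2; lra.
rewrite /meshsize big_seq; elim/big_ind : _ => // [x y hx hy|K KT]; first by rewrite ge_max hx.
have d i j : pdist (K i) (K j) <= 4 * (`|M| + 1).
  have [a1 a2] := vb K i KT; have [b1 b2] := vb K j KT.
  apply: (le_trans (pdist_le_coord _ _)).
  have := ler_normB (K i).1 (K j).1; have := ler_normB (K i).2 (K j).2; lra.
by rewrite /diamT !ge_max !d.
Qed.

(** * Algebra of the bilinear forms *)

Section Forms.
Variables (Om : set pt) (T : mesh R).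
Hypothesis hc : conforming Om T.
Implicit Types (x y u v w lam : bfun).
Let nd K : K \in T -> nondeg K := @conf_nd R Om T hc K.

Lemma ahC x y : ah T x y = ah T y x.
Proof. by rewrite !ah_IK; apply: eq_bigr => K _; congr IK; ring. Qed.
Lemma ah_lin x y1 y2 (a b : R) : ah T x (fun K => cst2 a * y1 K + cst2 b * y2 K) = a * ah T x y1 + b * ah T x y2.
Proof.
rewrite !ah_IK !mulr_sumr -big_split /= big_seq [RHS]big_seq; apply: eq_bigr => K KT.
have nK := nd KT; rewrite -!IKZ // -IKD //; congr IK.
by rewrite dXD dYD !dXZ !dYZ; ring.
Qed.
Lemma L2T_lin x y1 y2 (a b : R) : L2T T x (fun K => cst2 a * y1 K + cst2 b * y2 K) = a * L2T T x y1 + b * L2T T x y2.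
Proof.
rewrite !L2T_IK !mulr_sumr -big_split /= big_seq [RHS]big_seq; apply: eq_bigr => K KT.
have nK := nd KT; rewrite -!IKZ // -IKD //; congr IK; ring.
Qed.
Lemma H1T_lin x y1 y2 (a b : R) : H1T T x (fun K => cst2 a * y1 K + cst2 b * y2 K) = a * H1T T x y1 + b * H1T T x y2.
Proof. by rewrite /H1T ah_lin L2T_lin; ring. Qed.
Lemma H1TC x y : H1T T x y = H1T T y x.
Proof. by rewrite /H1T ahC !L2T_IK; congr (_ + _); apply: eq_bigr => K _; rewrite mulrC. Qed.
Lemma L2T_ge0 x : 0 <= L2T T x x.
Proof. by rewrite L2T_IK sumr_ge0 // => K _; rewrite -expr2; apply: IK_sqr_ge0. Qed.
Lemma ah_ge0 x : 0 <= ah T x x.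
Proof.
rewrite ah_IK sumr_ge0 // => K _; apply: IK_ge0 => z _.
by rewrite -!expr2 evD !evX addr_ge0 ?sqr_ge0.
Qed.
Lemma H1T_ge0 x : 0 <= H1T T x x.
Proof. by rewrite addr_ge0 ?L2T_ge0 ?ah_ge0. Qed.
Lemma H1T_quad x y (a b : R) :
  H1T T (fun K => cst2 a * x K + cst2 b * y K) (fun K => cst2 a * x K + cst2 b * y K) =
  a ^+ 2 * H1T T x x + 2 * a * b * H1T T x y + b ^+ 2 * H1T T y y.
Proof.
set z := (fun K => _); have e c : H1T T z c = a * H1T T c x + b * H1T T c y.
  by rewrite H1TC /z H1T_lin.
rewrite {2}/z H1T_lin !e (H1TC y x); ring.
Qed.
Lemma L2om_ge0 om x : 0 <= L2om om T x x.
Proof.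
apply: sumr_ge0 => K _; apply: Rintegral_ge0 => z _; rewrite -expr2; exact: sqr_ge0.
Qed.
Lemma lapNorm_ge0 x : 0 <= lapNorm T x.
Proof. by apply: sumr_ge0 => K _; apply: Rintegral_ge0 => z _; apply: sqr_ge0. Qed.

Lemma H1T_eq0 x : H1T T x x = 0 -> forall K, K \in T -> x K = 0.
Proof.
move=> /eqP; rewrite paddr_eq0 ?L2T_ge0 ?ah_ge0 // => /andP[/eqP h _] K KT.
have nK := nd KT; apply: (IK_eq0 nK); move/eqP: h; rewrite L2T_IK.
rewrite psumr_eq0 => [/allP /(_ K KT)|K' _]; last by rewrite -expr2; apply: IK_sqr_ge0.
by rewrite /= expr2 => /eqP.
Qed.

(** The two occurrences of [ah] between [lam] and [u] cancel. As [de * C2 <= 1], the square of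
    [de w] is at most [de * Q], so expanding [H1T] of [lam - de w] bounds the cross term by
    [P / 2 + de * Q / 8]; the [3 / 8] is [1 / 2 - 1 / 8]. *)
Lemma test_estimate u lam w (C2 Q : R) : 0 < C2 -> 0 <= Q -> Q / 2 <= ah T u w -> H1T T w w <= C2 * Q ->
  let de := (1 + C2)^-1 in
  let w' := (fun K => cst2 (-1) * lam K + cst2 de * w K) : bfun in
  let P := (1 / 2) ^+ 2 * H1T T lam lam in let Y := (1 / 2) ^+ 2 * H1T T w' w' in
  [/\ 0 <= P, 0 <= Y, P / 2 + 3 / 8 * de * Q <= ah T lam u + ah T u w' - (1 / 2) ^+ 2 * H1T T lam w',
      Y <= 2 * P + Q & P <= 2 * Y + Q].
Proof.
move=> C20 Q0 haw hW de w' P Y.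
have g0 : 0 <= (1 / 2) ^+ 2 :> R by exact: sqr_ge0.
have de0 : 0 < de by rewrite invr_gt0 addr_gt0.
have dC : de * C2 <= 1.
  by rewrite /de mulrC ler_pdivrMr ?addr_gt0 // mul1r lerDr.
have de1 : de <= 1 by rewrite invf_le1 ?addr_gt0 // lerDl ltW.
have W0 := H1T_ge0 w.
have dW : de ^+ 2 * H1T T w w <= de * Q.
  apply: (@le_trans _ _ (de ^+ 2 * (C2 * Q))); first by rewrite ler_wpM2l ?sqr_ge0.
  rewrite expr2 -!mulrA ler_wpM2l ?(ltW de0) // mulrA -[leRHS]mul1r ler_wpM2r //.
have dQ : de * Q <= Q by rewrite ler_piMl.
have dQ0 : 0 <= de * Q by rewrite mulr_ge0 // ltW.
have Pl0 := H1T_ge0 lam.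
set X := H1T T lam w; set Pl := H1T T lam lam in P Pl0 *; set W := H1T T w w in W0 dW *.
have YE : H1T T w' w' = Pl - 2 * de * X + de ^+ 2 * W by rewrite H1T_quad -/X -/Pl -/W; ring.
(* [q1] gives the bound of [Y] by [P], and [q2] the converse bound of [P] by [Y]. *)
have q1 : 0 <= Pl + 2 * de * X + de ^+ 2 * W.
  by have := H1T_ge0 (fun K => cst2 1 * lam K + cst2 de * w K); rewrite H1T_quad -/X -/Pl -/W; lra.
have q2 : 0 <= Pl - 4 * de * X + 4 * de ^+ 2 * W.
  by have := H1T_ge0 (fun K => cst2 1 * lam K + cst2 (- 2 * de) * w K); rewrite H1T_quad -/X -/Pl -/W; lra.
have Y0 := H1T_ge0 w'; rewrite YE in Y0.
split.
- by rewrite /P mulr_ge0.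
- by rewrite /Y mulr_ge0 // YE.
- rewrite ah_lin H1T_lin (ahC lam u) -/X -/Pl /P.
  have h3 : de * (Q / 2) <= de * ah T u w by rewrite ler_wpM2l // ltW.
  lra.
- rewrite /Y YE /P; lra.
- rewrite /Y YE /P; lra.
Qed.

End Forms.

(** The numerator is at least [de / 4] times the squared norm of the given pair, while the test pair
    has at most twice its norm: hence [de / 8]. The bound of [P] by [Y] keeps the denominator away
    from zero. *)
Lemma infsup_arith (N0 Q P Y A de : R) : 0 <= N0 -> 0 <= Q -> 0 <= P -> 0 <= Y -> 0 < de <= 1 ->
  Y <= 2 * P + Q -> P <= 2 * Y + Q -> N0 + (P / 2 + 3 / 8 * de * Q) <= A ->
  Num.sqrt (N0 + Q + P) != 0 ->
  Num.sqrt (N0 + Q + Y) != 0 /\ de / 8 * Num.sqrt (N0 + Q + P) <= A / Num.sqrt (N0 + Q + Y).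
Proof.
move=> N00 Q0 P0 Y0 /andP[de0 de1] h1 h2 hA nz.
set n2 := N0 + Q + P in nz *; set t2 := N0 + Q + Y.
have n20 : 0 < n2.
  rewrite lt_def !addr_ge0 // andbT; apply: contraNneq nz => ->; by rewrite sqrtr0.
have t20 : 0 < t2 by rewrite /t2; rewrite /n2 in n20; lra.
have st0 : 0 < Num.sqrt t2 by rewrite sqrtr_gt0.
split; first by rewrite gt_eqF.
rewrite ler_pdivlMr //.
have t4 : t2 <= 2 ^+ 2 * n2 by rewrite /t2 /n2; lra.
have st : Num.sqrt t2 <= 2 * Num.sqrt n2.
  by rewrite -[2 in leRHS]ger0_norm // -[`|2|]sqrtr_sqr -sqrtrM ?sqr_ge0 // ler_sqrt // mulr_ge0 ?sqr_ge0 // ltW.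
have dn : de * N0 <= N0 by rewrite ler_piMl.
have dp : de * P <= P by rewrite ler_piMl.
apply: (@le_trans _ _ (de / 8 * Num.sqrt n2 * (2 * Num.sqrt n2))).
  by rewrite ler_wpM2l // mulr_ge0 ?sqrtr_ge0 // divr_ge0 // ltW.
have -> : de / 8 * Num.sqrt n2 * (2 * Num.sqrt n2) = de / 4 * n2.
  by rewrite -[in RHS](sqr_sqrtr (ltW n20)); field.
apply: le_trans hA; have : 0 <= de * Q by rewrite mulr_ge0 // ltW.
rewrite /n2; lra.
Qed.

End Final.


(** * Admissible test pairs, degenerate cases and the conclusion *)

Section Concl.
Variable R : realType.
Notation P2 := (P2 R).
Notation pt := (pt R).
Notation tri := (tri R).
Notation bfun := (bfun R).
Notation edge := (edge R).
Implicit Types (p q f : P2) (z : pt) (K : tri) (F : edge).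

Lemma openTri_interior K z : nondeg K -> openTri K z ->
  exists2 r : R, 0 < r & forall y, pdist z y < r -> closedTri K y.
Proof.
move=> nK /(openTriP _ nK) hz.
pose nb i := exists2 r : R, 0 < r & forall y, pdist z y < r -> 0 <= ev (baryP K i) y.
have key i : nb i.
  have [b [c hbc]] : exists b c : R, forall y,
      ev (baryP K i) z - ev (baryP K i) y = b * (z.1 - y.1) + c * (z.2 - y.2).
    have [a [b [c e]]] : exists a b c : R, baryP K i = affP a b c by do 3!eexists.
    by exists b, c => y; rewrite e !ev_aff; ring.
  have L0 : 0 < `|b| + `|c| + 1 by rewrite ltr_wpDl ?addr_ge0.
  exists (ev (baryP K i) z / (`|b| + `|c| + 1)); first by rewrite divr_gt0.
  move=> y; rewrite ltr_pdivlMr // => hy; have [h1 h2] := pdist_ge_coord z y.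
  have p0 := pdist_ge0 z y.
  have m1 : b * (z.1 - y.1) <= `|b| * pdist z y.
    by rewrite (le_trans (ler_norm _)) // normrM ler_wpM2l.
  have m2 : c * (z.2 - y.2) <= `|c| * pdist z y.
    by rewrite (le_trans (ler_norm _)) // normrM ler_wpM2l.
  have := hbc y; lra.
have [r0 r00 h0] := key 0; have [r1 r10 h1] := key 1; have [r2 r20 h2] := key 2.
exists (Num.min r0 (Num.min r1 r2)); first by rewrite !lt_min r00 r10.
move=> y; rewrite !lt_min => /and3P[d0 d1 d2]; apply/(closedTriP _ nK).
by apply: I3_ind; [exact: h0|exact: h1|exact: h2].
Qed.

Lemma seg_pt_near (a b : pt) (r : R) : 0 < r -> exists2 t, 0 < t < 1 & pdist a (seg_pt (a, b) t) < r.
Proof.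
move=> r0; set d := `|b.1 - a.1| + `|b.2 - a.2|.
have d0 : 0 <= d by rewrite addr_ge0.
have rd : 0 < 2 * (r + d) by rewrite mulr_gt0 // ltr_wpDr.
have t0 : 0 < r / (2 * (r + d)) by rewrite divr_gt0.
exists (r / (2 * (r + d))); first by rewrite t0 ltr_pdivrMr // mul1r; lra.
apply: (le_lt_trans (pdist_le_coord _ _)); rewrite /seg_pt /=.
set t := _ / _ in t0 *.
have -> x y : x - (x + t * (y - x)) = - (t * (y - x)) by ring.
have -> x y : x - (x + t * (y - x)) = - (t * (y - x)) by ring.
rewrite !normrN !(normrM t) (gtr0_norm t0) -mulrDr -/d /t mulrAC ltr_pdivrMr //.
have : 0 <= r * d by rewrite mulr_ge0 // ltW.
have : 0 < r * r by rewrite mulr_gt0.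
lra.
Qed.

Lemma sum3_le0 (a b c : R) : 0 <= a -> 0 <= b -> 0 <= c -> a + b + c <= 0 -> a = 0 /\ c = 0.
Proof. by move=> *; split; lra. Qed.
Lemma pmul_eq0 (a b : R) : 0 < a -> a * b = 0 -> b = 0.
Proof. by move=> a0 /eqP; rewrite mulf_eq0 (gt_eqF a0) => /eqP. Qed.
Lemma ler_shuffle (a b c d e f : R) : f <= c + d - e -> a + b + f <= a + c + b + d - e.
Proof. lra. Qed.
Lemma ltr_sum5 (a b c d e : R) : 0 < a + e -> 0 <= b -> 0 <= c -> 0 <= d -> 0 < a + b + c + d + e.
Proof. lra. Qed.

(** * Membership in the discrete spaces and the two estimates on one mesh *)

Section Mesh.
Variables (Om : set pt) (T : mesh R) (k : nat).
Hypotheses (hc : conforming Om T) (k0 : (0 < k)%N).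
Implicit Types (x y u v w lam : bfun).
Let nd K : K \in T -> nondeg K := @conf_nd R Om T hc K.

Lemma spanLag_lin2 n (P : pt -> Prop) (a b : R) x y : (0 < n)%N ->
  inSpanLag n T P x -> inSpanLag n T P y ->
  inSpanLag n T P (fun K => cst2 a * x K + cst2 b * y K).
Proof.
move=> n0 hx hy; apply: (spanLag_lin hc n0 (a := a) (v1 := x) (v2 := fun K => cst2 b * y K)) => //.
apply: (spanLag_lin hc n0 (a := b) hy (spanLag0 hc n0 P)) => K _; by rewrite addr0.
Qed.
Lemma spanNC0 E : inSpanNC k T E (fun=> 0).
Proof. by exists [::], (fun=> 0); split=> // K _; rewrite big_nil. Qed.
Lemma spanNC_lin2 (E : seq edge) (a b : R) x y : uniq E ->
  inSpanNC k T E x -> inSpanNC k T E y ->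
  inSpanNC k T E (fun K => cst2 a * x K + cst2 b * y K).
Proof.
move=> uE hx hy; apply: (spanNC_lin (a := a) (v1 := x) (v2 := fun K => cst2 b * y K)) => //.
apply: (spanNC_lin (a := b) uE hy (spanNC0 E)) => K _; by rewrite addr0.
Qed.
Lemma vE_span u E : inSpanLag k T (inEdgesInt E) (vE k T u E).
Proof.
apply/(spanLagP hc k0); exists (ecoef E (eF k T u)); split=> // N; exact: ecoef_supp.
Qed.
Lemma vNC_span u E : inSpanNC k T E (vNC k T u E).
Proof. by exists E, (mF T u); split. Qed.

Lemma uniq_edgesI : uniq (edgesI Om T).
Proof. by rewrite filter_uniq // undup_uniq. Qed.
Lemma uniq_edgesG0 G0 : uniq (edgesG0 Om G0 T).
Proof. by rewrite filter_uniq // undup_uniq. Qed.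
Lemma edgesI_sub : {subset edgesI Om T <= edgesT T}.
Proof. by move=> F; rewrite mem_filter => /andP[]. Qed.
Lemma uniq_edges_cp G0 : uniq (edgesI Om T ++ edgesG0 Om G0 T).
Proof.
rewrite cat_uniq uniq_edgesI uniq_edgesG0 andbT /=; apply/hasPn => F.
rewrite !mem_filter => /andP[/asboolP[h _] _]; apply/negP => /andP[/asboolP h' _]; exact: h.
Qed.
Lemma edges_cp_sub G0 : {subset edgesI Om T ++ edgesG0 Om G0 T <= edgesT T}.
Proof. by move=> F; rewrite mem_cat !mem_filter => /orP[] /andP[]. Qed.

Lemma inWh_test u lam (al de : R) : (forall K, K \in T -> deg2le k (u K)) -> inWh k Om T lam ->
  inWh k Om T (fun K => cst2 (-1) * lam K + cst2 de * (vB T u al K + wE k T u (edgesI Om T) K)).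
Proof.
move=> du [a [b [c [ha hb hc' e]]]].
do 3!eexists; split; [apply: (spanLag_lin2 (-1) de _ ha (bubble_span hc (- (al * meshsize T ^+ 2)) du)) => //|
  apply: (spanLag_lin2 (-1) de k0 hb (vE_span u _))|
  apply: (spanNC_lin2 (-1) de uniq_edgesI hc' (vNC_span u _))|].
by move=> K KT /=; rewrite e // /wE /vB; ring.
Qed.

(** Edge coefficients are additive over concatenated edge lists, so the parts of the lifting on
    interior and on Dirichlet edges fall into separate summands of the space. *)
Lemma inV1h_test G0 u lam (al de : R) : (forall K, K \in T -> deg2le k (u K)) -> inV1h k Om G0 T lam ->
  inV1h k Om G0 T (fun K => cst2 (-1) * lam K +
    cst2 de * (vB T u al K + wE k T u (edgesI Om T ++ edgesG0 Om G0 T) K)).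
Proof.
move=> du [a [b [c [d [f [[ha hb] hc' hd hf e]]]]]].
do 5!eexists; split; [split;
  [apply: (spanLag_lin2 (-1) de _ ha (bubble_span hc (- (al * meshsize T ^+ 2)) du)) => //|
  apply: (spanLag_lin2 (-1) de k0 hb (vE_span u _))]|
  apply: (spanLag_lin2 (-1) de k0 hc' (vE_span u _))|
  apply: (spanNC_lin2 (-1) de uniq_edgesI hd (vNC_span u _))|
  apply: (spanNC_lin2 (-1) de (uniq_edgesG0 G0) hf (vNC_span u _))|].
by move=> K KT /=; rewrite e // /wE vE_cat vNC_cat /vB; ring.
Qed.

Lemma inWh0 : inWh k Om T (fun=> 0).
Proof.
do 3!eexists; split; [exact: (spanLag0 hc (ltn0Sn k))|exact: (spanLag0 hc k0)|exact: spanNC0|].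
by move=> K _; rewrite !addr0.
Qed.
Lemma inVh_cst (a : R) : inVh k T (fun=> cst2 a).
Proof.
split=> [K _|K1 K2 _ _ z _ _]; last by [].
exact: deg2le_cst.
Qed.

Lemma L2T_0l x y : (forall K, K \in T -> x K = 0) -> L2T T x y = 0.
Proof. by move=> h; rewrite L2T_IK big_seq big1 // => K KT; rewrite h // mul0r IK0 //; apply: nd. Qed.
Lemma ah_0l x y : (forall K, K \in T -> x K = 0) -> ah T x y = 0.
Proof. by move=> h; rewrite ah_IK big_seq big1 // => K KT; rewrite h // dX0 /dY deriv0 !mul0r addr0 IK0 //; apply: nd. Qed.
Lemma H1T_0l x y : (forall K, K \in T -> x K = 0) -> H1T T x y = 0.
Proof. by move=> h; rewrite /H1T L2T_0l // ah_0l // addr0. Qed.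
Lemma L2om_0l om x y : (forall K, K \in T -> x K = 0) -> L2om om T x y = 0.
Proof.
move=> h; rewrite /L2om big_seq big1 // => K /h ->; rewrite /intK.
under eq_Rintegral do rewrite ev0 mul0r.
by rewrite /Rintegral integral0.
Qed.

Lemma H1T_gt0 x K z : K \in T -> ev (x K) z != 0 -> 0 < H1T T x x.
Proof.
move=> KT nz; rewrite lt_def H1T_ge0 andbT; apply: contraNneq nz => h.
by rewrite (H1T_eq0 hc h KT) ev0.
Qed.
Lemma Jh_ge0 u : 0 <= Jh Om T u u.
Proof. by rewrite Jh_SF sumr_ge0 // => F _; apply: SF_ge0. Qed.
Lemma bdryG0_ge0 G0 u : 0 <= meshsize T * bdryG0 Om G0 T u.
Proof. by rewrite bdry_SF sumr_ge0 // => F _; apply: SF_ge0. Qed.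

Lemma bubble_mid K i : K \in T -> ev (bubble k (tedge K i) K) (seg_pt (tedge K i) (1 / 2)) = 1.
Proof.
move=> KT; have nK := nd KT; rewrite /bubble (big_pred1 i) => [|j /=].
  by rewrite ev_comp2 evB ev1 evM ev_cst bary_opp // mulr0 subr0 leg1.
by apply/eqP/eqP => [/(tedge_inj nK)|->].
Qed.

(** A point of [G0] in a triangle cannot be interior, being on the boundary of [Om], nor lie on an
    open edge; at a vertex the open set [U] would meet an adjacent edge. Hence constants satisfy the
    Dirichlet condition on such a mesh. *)
Lemma no_dirichlet_edge G0 : eopen Om -> (exists U, eopen U /\ G0 = U `&` eboundary Om) ->
  (forall F, F \in edgesT T -> openSeg F `<=` eboundary Om `\` G0) ->
  forall K, K \in T -> forall z, G0 z -> ~ closedTri K z.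
Proof.
move=> oO [U [oU ->]] hF K KT z [Uz [_ Bz]] Kz; have nK := nd KT.
have h := (closedTriP _ nK).1 Kz.
have edgeF i (y : pt) : openSeg (tedge K i) y -> ~ U y.
  move=> hy Uy; have FT : tedge K i \in edgesT T by apply/edgesTP; exists K, i.
  by have [By nG] := hF _ FT y hy; apply: nG.
have vert l : z <> K l.
  move=> zl; have [l' ll] : exists l' : 'I_3, l != l'.
    by move: l {zl}; apply: I3_ind; [exists 1|exists 0|exists 0].
  have [j ej] := tedge_of K ll.
  have [r r0 hr] := oU z Uz; have [t t01 ht] := seg_pt_near (K l) (K l') r0.
  apply: (@edgeF j (seg_pt (K l, K l') t)); last by apply: hr; rewrite zl.
  by rewrite ej; apply/openSeg_mkedge; exists t.
have [/forallP pos|/forallPn [i]] := boolP [forall i, 0 < ev (baryP K i) z].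
  have [r r0 hr] := openTri_interior nK ((openTriP z nK).2 pos).
  apply: Bz; suff : Om z by move/oO.
  case: hc => _ _ _ -> _; exists r => // y /hr hy; by exists K.
rewrite -leNgt => hi; have zi : ev (baryP K i) z = 0 by apply/le_anti; rewrite hi h.
have [n1 n2 n3] := nxi_neq i.
have other (l m : 'I_3) : ev (baryP K i) z = 0 -> ev (baryP K l) z = 0 -> i != l -> i != m -> l != m -> False.
  move=> e1 e2 il im lm; apply: (vert m); rewrite -[LHS](bary_pt z nK).
  have -> : (fun i => ev (baryP K i) z) = fun j => ev (baryP K j) (K m); last by rewrite bary_pt.
  apply: funext => j; rewrite bary_vertex //; have := bary_sum z nK; rewrite sum3.
  move: il im lm e1 e2 {zi hi n1 n2 n3}; move: i l m j; do 4!apply: I3_ind => //=; lra.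
case: (ltrgt0P (ev (baryP K (nx i)) z)) => [p1|n|e1]; last 2 first.
- by have := h (nx i); lra.
- by apply: (other (nx i) (nx2 i)) => //; rewrite eq_sym.
case: (ltrgt0P (ev (baryP K (nx2 i)) z)) => [p2|n|e2].
- by apply: (@edgeF i z) => //; apply/openSegP.
- by have := h (nx2 i); lra.
- by apply: (other (nx2 i) (nx i)) => //; rewrite eq_sym // n3.
Qed.

Lemma infsup_uc om (eps C2 al : R) u lam : 0 < eps -> 0 < C2 ->
  inVh k T u -> inWh k Om T lam ->
  let E := edgesI Om T in let w := (fun K => vB T u al K + wE k T u E K) : bfun in
  let S := \sum_(F <- E) SF T u F in
  (S + lapNorm T u) / 2 <= ah T u w -> H1T T w w <= C2 * (S + lapNorm T u) ->
  exists v' w', [/\ inVh k T v', inWh k Om T w', Nuc Om om T eps (1 / 2) v' w' != 0 &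
    (1 + C2)^-1 / 8 * Nuc Om om T eps (1 / 2) u lam <=
      Auc Om om T eps (1 / 2) u lam v' w' / Nuc Om om T eps (1 / 2) v' w'].
Proof.
move=> e0 C20 hu hl E w S h1 h2.
have S0 : 0 <= S by apply: sumr_ge0 => F _; apply: SF_ge0.
have Q0 : 0 <= S + lapNorm T u by rewrite addr_ge0 ?lapNorm_ge0.
set de := (1 + C2)^-1; pose w' := (fun K => cst2 (-1) * lam K + cst2 de * w K) : bfun.
have := test_estimate hc lam C20 Q0 h1 h2; cbv zeta; rewrite -/de -/w' => -[P0 Y0 hA hY hP].
have de01 : 0 < de <= 1 by rewrite invr_gt0 addr_gt0 //= invf_le1 ?addr_gt0 // lerDl ltW.
have g0 : 0 < (1 / 2 : R) ^+ 2 by rewrite exprn_gt0.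
have H0 x : 0 <= eps * H1T T x x by rewrite mulr_ge0 ?H1T_ge0 // ltW.
have O0 x : 0 <= L2om om T x x by apply: L2om_ge0.
have NE y : Nuc Om om T eps (1 / 2) u y = Num.sqrt (eps * H1T T u u + L2om om T u u + (S + lapNorm T u) + (1 / 2) ^+ 2 * H1T T y y).
  by rewrite /Nuc Jh_SF !addrA.
have [N0|N0] := eqVneq (Nuc Om om T eps (1 / 2) u lam) 0; last first.
  exists u, w'; rewrite !NE in N0 *.
  have hA' : eps * H1T T u u + L2om om T u u + ((1 / 2) ^+ 2 * H1T T lam lam / 2 + 3 / 8 * de * (S + lapNorm T u)) <=
      Auc Om om T eps (1 / 2) u lam u w' by exact: ler_shuffle.
  have [nz hq] := infsup_arith (addr_ge0 (H0 u) (O0 u)) Q0 P0 Y0 de01 hY hP hA' N0.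
  by split=> //; exact: inWh_test (proj1 hu) hl.
(* The degenerate case: [u] and [lam] vanish on the mesh, so the form is zero on every pair, and any
   pair of nonzero norm keeps the supremum nonnegative. The constant [1] has one because
   [eps > 0]. *)
have sq : eps * H1T T u u + L2om om T u u + (S + lapNorm T u) + (1 / 2) ^+ 2 * H1T T lam lam <= 0.
  by rewrite -sqrtr_eq0 -NE N0.
have [u0 l0] : (forall K, K \in T -> u K = 0) /\ (forall K, K \in T -> lam K = 0).
  have [/eqP + /(pmul_eq0 g0) hl1] := sum3_le0 (addr_ge0 (H0 u) (O0 u)) Q0 P0 sq.
  rewrite paddr_eq0 // => /andP[/eqP /(pmul_eq0 e0) hu1 _].
  by split; apply: (H1T_eq0 hc).
have [K0 KT0] := conf_nonempty hc.
exists (fun=> cst2 1), (fun=> 0); split; [exact: inVh_cst|exact: inWh0| |].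
  rewrite /Nuc gt_eqF // sqrtr_gt0.
  apply: ltr_sum5; [|exact: O0|exact: Jh_ge0|exact: lapNorm_ge0].
  apply: ltr_wpDr; first by rewrite mulr_ge0 ?H1T_ge0 // ltW.
  by rewrite mulr_gt0 // (H1T_gt0 (z := (0, 0)) KT0) // ev_cst oner_eq0.
by rewrite N0 mulr0 /Auc !H1T_0l // !ah_0l // L2om_0l // !mulr0 !addr0 subr0 mul0r.
Qed.

Lemma infsup_cp G0 (eps C2 al : R) u lam : 0 < eps -> 0 < C2 ->
  eopen Om -> (exists U, eopen U /\ G0 = U `&` eboundary Om) ->
  (forall F, F \in edgesT T -> ~ (openSeg F `<=` Om) ->
     openSeg F `<=` G0 \/ openSeg F `<=` eboundary Om `\` G0) ->
  inV0h k T G0 u -> inV1h k Om G0 T lam ->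
  let E := edgesI Om T ++ edgesG0 Om G0 T in
  let w := (fun K => vB T u al K + wE k T u E K) : bfun in
  let S := \sum_(F <- E) SF T u F in
  (S + lapNorm T u) / 2 <= ah T u w -> H1T T w w <= C2 * (S + lapNorm T u) ->
  exists v' w', [/\ inV0h k T G0 v', inV1h k Om G0 T w', Ncp Om G0 T eps (1 / 2) v' w' != 0 &
    (1 + C2)^-1 / 8 * Ncp Om G0 T eps (1 / 2) u lam <=
      Acp T eps (1 / 2) u lam v' w' / Ncp Om G0 T eps (1 / 2) v' w'].
Proof.
move=> e0 C20 oO hG hE hu hl E w S h1 h2.
have S0 : 0 <= S by apply: sumr_ge0 => F _; apply: SF_ge0.
have Q0 : 0 <= S + lapNorm T u by rewrite addr_ge0 ?lapNorm_ge0.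
set de := (1 + C2)^-1; pose w' := (fun K => cst2 (-1) * lam K + cst2 de * w K) : bfun.
have := test_estimate hc lam C20 Q0 h1 h2; cbv zeta; rewrite -/de -/w' => -[P0 Y0 hA hY hP].
have de01 : 0 < de <= 1 by rewrite invr_gt0 addr_gt0 //= invf_le1 ?addr_gt0 // lerDl ltW.
have g0 : 0 < (1 / 2 : R) ^+ 2 by rewrite exprn_gt0.
have H0 x : 0 <= eps * H1T T x x by rewrite mulr_ge0 ?H1T_ge0 // ltW.
have NE y : Ncp Om G0 T eps (1 / 2) u y = Num.sqrt (eps * H1T T u u + (S + lapNorm T u) + (1 / 2) ^+ 2 * H1T T y y).
  by rewrite /Ncp Jh_SF bdry_SF /S /E big_cat /= !addrA.
have [N0|N0] := eqVneq (Ncp Om G0 T eps (1 / 2) u lam) 0; last first.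
  exists u, w'; rewrite !NE in N0 *.
  have hA' : eps * H1T T u u + ((1 / 2) ^+ 2 * H1T T lam lam / 2 + 3 / 8 * de * (S + lapNorm T u)) <=
      Acp T eps (1 / 2) u lam u w' by rewrite /Acp -!addrA lerD2l addrA.
  have [nz hq] := infsup_arith (H0 u) Q0 P0 Y0 de01 hY hP hA' N0.
  by split=> //; exact: inV1h_test (proj1 (proj1 hu)) hl.
have sq : eps * H1T T u u + (S + lapNorm T u) + (1 / 2) ^+ 2 * H1T T lam lam <= 0.
  by rewrite -sqrtr_eq0 -NE N0.
have [u0 l0] : (forall K, K \in T -> u K = 0) /\ (forall K, K \in T -> lam K = 0).
  have [/(pmul_eq0 e0) hu1 /(pmul_eq0 g0) hl1] := sum3_le0 (H0 u) Q0 P0 sq.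
  by split; apply: (H1T_eq0 hc).
have A0 v y : Acp T eps (1 / 2) u lam v y = 0.
  by rewrite /Acp !H1T_0l // !ah_0l // !mulr0 !addr0 subr0.
suff [v' [y' [hv hy hpos]]] : exists v' y', [/\ inV0h k T G0 v', inV1h k Om G0 T y' &
    0 < eps * H1T T v' v' + (1 / 2) ^+ 2 * H1T T y' y'].
  exists v', y'; split=> //; last by rewrite A0 N0 mulr0 mul0r.
  rewrite /Ncp gt_eqF // sqrtr_gt0.
  by apply: ltr_sum5; [|exact: Jh_ge0|exact: bdryG0_ge0|exact: lapNorm_ge0].
(* Constants need not lie in the Dirichlet space. Without selected edges no triangle meets [G0] and
   the constant [1] is admissible; otherwise the bubble of a selected edge is a nonzero second
   component. *)
have [EE|[F FE]] : (forall F, F \notin E) \/ exists F, F \in E.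
    by case: (E) => [|F s]; [left|right; exists F; rewrite inE eqxx].
  have [K0 KT0] := conf_nonempty hc.
  exists (fun=> cst2 1), (fun=> 0); split.
  - split; first exact: inVh_cst.
    move=> K KT z Gz Kz; exfalso; apply: (no_dirichlet_edge oO hG _ KT Gz Kz) => F FT.
    have := EE F; rewrite mem_cat !mem_filter FT !andbT negb_or => /andP[/asboolPn nI /asboolPn nG].
    by case: (hE F FT nI) => // hG0; exfalso; apply: nG.
  - do 5!eexists; split; [split; [exact: (spanLag0 hc (ltn0Sn k))|exact: (spanLag0 hc k0)]|
      exact: (spanLag0 hc k0)|exact: spanNC0|exact: spanNC0|].
    by move=> K _; rewrite !addr0.
  - apply: ltr_wpDr; first by rewrite mulr_ge0 ?H1T_ge0 // ltW.
    by rewrite mulr_gt0 // (H1T_gt0 (z := (0, 0)) KT0) // ev_cst oner_eq0.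
have /edgesTP[K [i [KT eF]]] := edges_cp_sub FE.
have one (s : seq edge) : F \in s -> inSpanNC k T s (bubble k F).
  move=> Fs; exists [:: F], (fun=> 1); split=> [x|K' _]; first by rewrite inE => /eqP ->.
  by rewrite big_seq1 cst21 mul1r.
exists (fun=> cst2 0), (bubble k F); split.
- split; first exact: inVh_cst.
  by move=> K' _ z _ _; rewrite ev_cst.
- move: FE; rewrite mem_cat => /orP[] Fs.
    exists (fun=> 0), (fun=> 0), (fun=> 0), (bubble k F), (fun=> 0).
    split; [split; [exact: (spanLag0 hc (ltn0Sn k))|exact: (spanLag0 hc k0)]|
      exact: (spanLag0 hc k0)|exact: one|exact: spanNC0|].
    by move=> K' _; rewrite !addr0 add0r.
  exists (fun=> 0), (fun=> 0), (fun=> 0), (fun=> 0), (bubble k F).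
  split; [split; [exact: (spanLag0 hc (ltn0Sn k))|exact: (spanLag0 hc k0)]|
    exact: (spanLag0 hc k0)|exact: spanNC0|exact: one|].
  by move=> K' _; rewrite !addr0 add0r.
- apply: ltr_wpDl; first exact: H0.
  by rewrite mulr_gt0 // (H1T_gt0 (z := seg_pt F (1 / 2)) KT) // eF bubble_mid // oner_eq0.
Qed.

End Mesh.
End Concl.

Local Open Scope classical_set_scope.
Theorem mainTheorem14 (R : realType) (k : nat) (Om om G0 : set (pt R))
  (I : Type) (Th : I -> mesh R) :
  (1 <= k)%N -> odd k ->
  (* Omega: bounded open set, triangulated conformingly by every T_h *)
  eopen Om -> (exists M : R, forall x, Om x -> pnorm x <= M) ->
  (forall i, conforming Om (Th i)) ->
  (* omega: nonempty open subset with positive distance to the boundary *)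
  om !=set0 -> eopen om -> om `<=` Om ->
  (exists2 delta : R, 0 < delta &
     forall x y, om x -> eboundary Om y -> delta <= pdist x y) ->
  (* Gamma_0: relatively open part of the boundary; Gamma_1 its complement *)
  (exists U, eopen U /\ G0 = U `&` eboundary Om) ->
  (* no edge lies (with its relative interior) in both Gamma_0 and Gamma_1 *)
  (forall i F, F \in edgesT (Th i) -> ~ (openSeg F `<=` Om) ->
     openSeg F `<=` G0 \/ openSeg F `<=` eboundary Om `\` G0) ->
  (* shape regularity and quasi-uniformity of the family *)
  (exists2 sigma : R, 0 < sigma &
     forall i K, K \in Th i -> diamT K <= sigma * inradius K) ->
  (exists2 c : R, 0 < c &
     forall i K, K \in Th i -> c * meshsize (Th i) <= diamT K) ->
  exists gam C : R, [/\ 0 < gam < 1, 0 < C &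
    forall i (eps : R), 0 < eps ->
      let T := Th i in
      (forall u lam, inVh k T u -> inWh k Om T lam ->
         (ereal_sup [set (Auc Om om T eps gam u lam vw.1 vw.2 / Nuc Om om T eps gam vw.1 vw.2)%R%:E
                    | vw in [set vw : bfun R * bfun R |
                               [/\ inVh k T vw.1, inWh k Om T vw.2 &
                                   (Nuc Om om T eps gam vw.1 vw.2 != 0)%R]]]
           >= (C * Nuc Om om T eps gam u lam)%R%:E)%E) /\
      (forall u lam, inV0h k T G0 u -> inV1h k Om G0 T lam ->
         (ereal_sup [set (Acp T eps gam u lam vw.1 vw.2 / Ncp Om G0 T eps gam vw.1 vw.2)%R%:E
                    | vw in [set vw : bfun R * bfun R |
                               [/\ inV0h k T G0 vw.1, inV1h k Om G0 T vw.2 &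
                                   (Ncp Om G0 T eps gam vw.1 vw.2 != 0)%R]]]
           >= (C * Ncp Om G0 T eps gam u lam)%R%:E)%E)].

Proof.
move=> k1 kodd oO [M hM] hc _ _ _ _ hG hE [sig sig0 hs] [c c0 hq].
(* The shape constant [c ^+ 2 / sig] and the bound [4 (|M| + 1)] for [h] hold for the whole family,
   so the lifting constants are fixed before [i] and [eps]. *)
have [al [C2 [C20 lift]]] := lifting k1 kodd (divr_gt0 (exprn_gt0 2 c0) sig0)
  (mulr_gt0 (ltr0n R 4) (ltr_wpDl (normr_ge0 M) ltr01)).
have C0 : (0 < (1 + C2)^-1 / 8)%R by rewrite divr_gt0 // invr_gt0 addr_gt0.
exists (1 / 2)%R, ((1 + C2)^-1 / 8)%R; split=> //; first by apply/andP; split; lra.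
move=> i eps e0 T; have hT := hc i.
have sh := shaped_of_regular hT sig0 c0 (hs i) (hq i).
have m0 := meshsize_gt0 hT; have mb := meshsize_bound hT hM.
split=> u lam hu hl.
  have [h1 h2] := lift Om T u _ hT (proj1 hu) (uniq_edgesI Om T) (@edgesI_sub R Om T) sh m0 mb.
  have [v [w [hv hw nz h]]] := infsup_uc hT k1 om e0 C20 hu hl h1 h2.
  apply: ereal_sup_ge; eexists; first by exists (v, w).
  by rewrite lee_fin.
have [h1 h2] := lift Om T u _ hT (proj1 (proj1 hu)) (uniq_edges_cp Om T G0) (@edges_cp_sub R Om T G0) sh m0 mb.
have [v [w [hv hw nz h]]] := infsup_cp hT k1 e0 C20 oO hG (hE i) hu hl h1 h2.
apply: ereal_sup_ge; eexists; first by exists (v, w).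
by rewrite lee_fin.
Qed.
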